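(* Let $\Lambda$ be a Radon measure on $(0,1)$ with infinite total mass $\Lambda((0,1))=\infty$. Suppose that $\chi(\Lambda)<1$. Then almost surely, the Mandelbrot random covering measure $\mathrm{MRC}_\Lambda$ and the closed uncovered set $E_\Lambda$ have positive Fourier dimensions, with $$\dim_F(E_\Lambda)\ge\dim_F(\mathrm{MRC}_\Lambda)\ge 1-\chi(\Lambda)>0.$$
   Context: Let $\mathrm{PPP}(\omega_\Lambda)$ be the Poisson point process on $\mathbb R\times(0,1)$ with intensity $\omega_\Lambda(dx\,dy)=dx\otimes\Lambda(dy)$. For $z=(x,y)$ put $I_z=(x,x+y)$. The uncovered set is $E_\Lambda=[0,1]\setminus\bigcup_{z\in\mathrm{PPP}(\omega_\Lambda)}I_z$. For $\epsilon\in(0,1)$ let $E_\Lambda(\epsilon)=[0,1]\setminus\bigcup_{z\in\mathrm{PPP}(\omega_\Lambda)\cap(\mathbb R\times(\epsilon,1))}I_z$ and $$\mathrm{MRC}_\Lambda^\epsilon(dt)=\frac{\mathbf 1_{E_\Lambda(\epsilon)}(t)}{\mathbb E[\mathbf 1_{E_\Lambda(\epsilon)}(t)]}\,dt\quad\text{on }[0,1].$$ By Kahane's $T$-martingale theory, $\mathrm{MRC}_\Lambda^\epsilon$ converges weakly as $\epsilon\to0^+$ to a random measure $\mathrm{MRC}_\Lambda$ on $[0,1]$, with support $E_\Lambda$; this is the Mandelbrot random covering measure. For an integer $b\ge2$, $\displaystyle\chi(b,\Lambda)=\limsup_{j\to\infty}\frac1{\log b}\int_{[b^{-j},b^{-(j-1)})}y\,\Lambda(dy)$,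 and $\chi(\Lambda)=\inf_{b\ge 2,\ b\in\mathbb N}\chi(b,\Lambda)$. For a finite positive Borel measure $\nu$ on $[0,1]$, $\widehat\nu(x)=\int e^{-2\pi ixt}\nu(dt)$ and $\dim_F(\nu)=\sup\{D\in[0,1):|\widehat\nu(x)|^2=O(|x|^{-D})\text{ as }|x|\to\infty\}$. For a compact set $E\subset\mathbb R$, $\dim_F(E)=\sup\{\dim_F(\nu):\nu\text{ is a Radon measure supported on }E\}$.
   Formalization: The Fourier dimension of a set is taken over nonzero measures only (otherwise it is always 1), and the inequality dim_F(E) ≥ dim_F(MRC) is claimed almost surely on the event that the uncovered set E is nonempty, since E is empty with positive probability in general. *)

(* Defs.v *)
From HB Require Import structures.
From mathcomp Require Import all_boot all_order all_algebra.
From mathcomp Require Import complex.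
From mathcomp Require Import all_classical all_reals all_analysis.
From mathcomp Require Import measurable_realfun.

Set Implicit Arguments.
Unset Strict Implicit.
Unset Printing Implicit Defensive.

Import Order.TTheory GRing.Theory Num.Theory.
Import numFieldNormedType.Exports.

Local Open Scope classical_set_scope.
Local Open Scope ring_scope.

Section Intensity.
Context {R : realType}.

(* A measure on (0,1) is a Borel measure on R that does not charge the
   complement of (0,1). On (0,1) a Borel measure which is finite on compact
   sets is automatically regular. Nothing is required near 0 nor near 1. *)
Definition radon01 (Lambda : {measure set (measurableTypeR R) -> \bar R}) :=
  Lambda (~` `]0, 1[) = 0%E /\
  forall K : set R, compact K -> K `<=` `]0, 1[ -> (Lambda K < +oo)%E.

Definition chi_base (Lambda : {measure set (measurableTypeR R) -> \bar R})
    (b : nat) : \bar R :=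
  limn_esup (fun j : nat =>
    (ln (b%:R : R))^-1%:E *
    \int[Lambda]_(y in `[b%:R ^- j, b%:R ^- j.-1[) y%:E)%E.

Definition chi (Lambda : {measure set (measurableTypeR R) -> \bar R}) :
    \bar R :=
  ereal_inf [set chi_base Lambda b | b in [set b : nat | (2 <= b)%N]].

End Intensity.

Section PoissonPointProcess.
Context {R : realType} d (Omega : measurableType d) (P : probability Omega R).
Context d' (T : measurableType d') (mu : set T -> \bar R).
Local Open Scope ereal_scope.

(* A point process is a random set of points, observed through its counts
   [#(Z w `&` B)], valued in nat plus [+oo]. The Poisson weights are written
   out because the library's [poisson_pmf] is 1, not the Dirac weight at 0,
   when the rate is 0. *)
Definition is_PPP (Z : Omega -> set T) :=
  let N (B : set T) (w : Omega) : \bar R := counting (Z w `&` B) in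
  [/\ forall B, measurable B -> measurable_fun setT (N B),
      forall B, measurable B -> mu B < +oo -> forall k : nat,
        P [set w | N B w = k%:R%:E] =
        (fine (mu B) ^+ k / k`!%:R * expR (- fine (mu B)))%:E,
      forall B, measurable B -> mu B = +oo -> P [set w | N B w = +oo] = 1
    & forall (n : nat) (B : 'I_n -> set T) (k : 'I_n -> \bar R),
        (forall i, measurable (B i)) -> trivIset setT B ->
        P [set w | forall i, N (B i) w = k i] =
        \prod_(i < n) P [set w | N (B i) w = k i] ].

End PoissonPointProcess.

Section MandelbrotCovering.
Context {R : realType}.

Definition uncovered (Z : set (R * R)) : set R :=
  `[0, 1]%classic `\` \bigcup_(z in Z) `]z.1, z.1 + z.2[%classic.

Definition uncovered_eps (Z : set (R * R)) (eps : R) : set R :=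
  uncovered (Z `&` [set z | eps < z.2 < 1]).

Context d (Omega : measurableType d) (P : probability Omega R).

(* The normalising constant vanishes exactly when [Lambda] has infinite mass near
   1; then [t] is almost surely covered and the density is 0 by [0^-1 = 0]. *)
Definition MRC_density (Z : Omega -> set (R * R)) (eps : R) (w : Omega)
    (t : R) : R :=
  \1_(uncovered_eps (Z w) eps) t /
  fine 'E_P[fun w' => \1_(uncovered_eps (Z w') eps) t].

(* The random measure [M] (a kernel, i.e. [w |-> M w A] is measurable for every
   Borel [A]) is almost surely the weak limit on [0,1] of the measures with
   Lebesgue density [MRC_density Z eps w], as [eps] decreases to 0. *)
Definition is_MRC (Z : Omega -> set (R * R))
    (M : R.-ker Omega ~> measurableTypeR R) :=
  {ae P, forall w,
    [/\ (M w setT < +oo)%E, M w (~` `[0, 1]) = 0%E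
      & forall f : R -> R, continuous f ->
          (\int[lebesgue_measure]_(t in `[0%R, 1%R])
             (f t * MRC_density Z eps w t)%:E)%E @[eps --> 0^'+] -->
          (\int[M w]_(t in `[0%R, 1%R]) (f t)%:E)%E ]}.

End MandelbrotCovering.

Section FourierDimension.
Context {R : realType}.
Implicit Types nu : {measure set (measurableTypeR R) -> \bar R}.

(* Real and imaginary parts of the integral of [exp (- 2 i pi x t)]. *)
Definition fourier nu (x : R) : R[i] :=
  ((\int[nu]_t cos (2 * pi * x * t)) +i*
   (- \int[nu]_t sin (2 * pi * x * t)))%C.

Definition dimF nu : \bar R :=
  ereal_sup [set D%:E | D in [set D : R | 0 <= D < 1 /\
    exists C A : R, forall x : R, A <= `|x| ->
      ComplexField.Normc.normc (fourier nu x) ^+ 2 <= C * `|x| `^ (- D)]].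

(* The zero measure is supported on every set and has [dimF] equal to 1, hence
   the restriction to nonzero measures. *)
Definition dimF_set (E : set R) : \bar R :=
  ereal_sup [set dimF nu | nu in
    [set nu : {measure set (measurableTypeR R) -> \bar R} |
      [/\ (nu setT < +oo)%E, nu (~` E) = 0%E & nu setT != 0%E]]].

End FourierDimension.

(* Main.v *)
(* Let [kap eps 0] be the intensity of the intervals longer than [eps] covering a given
   point; [chi Lambda < c] bounds it by [C - c * ln eps].

   Fourier decay: on a block of length [eps], the set left uncovered by the intervals
   longer than [eps] is an interval, so the integral of a wave of frequency [x] over the
   block is at most [expR (kap eps 0) * min eps (1 / x)]. When the scale is halved, the
   increments over far apart blocks form a martingale difference sequence, and an
   exponential moment bound with Borel-Cantelli over scales and frequencies yields every
   decay exponent below [1 - c].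

   The limit measure is nonzero when the uncovered set is not empty: given the first cell
   of a fine grid that no interval longer than [eps] covers entirely, the covering of
   the points to its right is regenerated. The mass found there, averaged over many
   separated scales, has mean 1 and variance close to 0, so it is rarely below 1/2. *)

Require Import Defs.
From HB Require Import structures.
From mathcomp Require Import all_boot all_order all_algebra.
From mathcomp Require Import complex finmap.
From mathcomp Require Import all_classical all_reals all_analysis.
From mathcomp Require Import measurable_realfun.
From mathcomp Require Import ring lra zify.

Set Implicit Arguments.
Unset Strict Implicit.
Unset Printing Implicit Defensive.

Import Order.TTheory GRing.Theory Num.Theory.
Import numFieldNormedType.Exports.

Local Open Scope classical_set_scope.
Local Open Scope ring_scope.

(** * Void probabilities of the point process *)

Section VoidEvents.
Context {R : realType} d (Omega : measurableType d) (P : probability Omega R).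
Context d' (T : measurableType d') (mu : {measure set T -> \bar R}).
Variable Z : Omega -> set T.

(** Independence enters only through void events, whose probabilities are exponentials of minus an
    intensity; this replaces filtrations and conditional expectations. The increments have no
    deterministic bound on their sum of squares: it is at most the largest increment times the total
    mass. The masses stay bounded along the scales only because they converge, which is why the
    deviation events require masses below an integer [K].

    A second moment of the total mass would give a nonzero limit only with positive probability. To
    reach probability one on the event that some point is uncovered, the argument restarts at the
    first cell left uncovered by a single long interval. Knowing that no long interval covers this
    cell makes the cells near it more likely to be free, so the weights on the cells to its right
    must be normalised by this bias. The condition [chi Lambda < 1] makes the correlation function,
    of order [r ^ (- c)] with [c < 1], integrable at 0; this bounds the second moment at one scale,
    and separated scales are nearly uncorrelated. *)

Definition void (B : set T) : set Omega := [set w | Z w `&` B = set0].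

Lemma voidU (A B : set T) : void (A `|` B) = void A `&` void B.
Proof.
by apply/seteqP; split => w; rewrite /void /= setIUr setU_eq0.
Qed.

Lemma void_sub (A B : set T) : A `<=` B -> void B `<=` void A.
Proof. by move=> AB w /= h; apply/seteqP; split=> // z [Zz Az]; rewrite -h; split=> //; exact: AB. Qed.

Lemma voidE (B : set T) :
  void B = [set w | counting (Z w `&` B) = 0%R%:E :> \bar R].
Proof.
apply/seteqP; split => w; rewrite /void /=.
  by move=> ->; rewrite /counting asboolT ?fset_set0//= ?cardfs0.
rewrite /counting; case: ifPn => // /asboolP fin.
move=> /eqP; rewrite eqe pnatr_eq0 cardfs_eq0 => /eqP.
by move=> h; have /(congr1 (fun X => [set` X])) := h; rewrite fset_setK// set_fset0.
Qed.

Hypothesis hZ : is_PPP P mu Z.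

Lemma measurable_void (B : set T) : measurable B -> measurable (void B).
Proof.
move=> mB; have [mN _ _ _] := hZ; rewrite voidE -[X in measurable X]setTI.
by have := mN B mB measurableT [set 0%R%:E] (emeasurable_set1 _).
Qed.

Lemma prob_void (B : set T) : measurable B -> (mu B < +oo)%E ->
  P (void B) = (expR (- fine (mu B)))%:E.
Proof.
move=> mB Bfin; have [_ h _ _] := hZ; rewrite voidE.
by have := h B mB Bfin 0%N; rewrite expr0 fact0 divr1 mul1r.
Qed.

Lemma prob_void_pinfty (B : set T) : measurable B -> mu B = +oo%E ->
  P (void B) = 0%E.
Proof.
move=> mB Boo; have [mN _ h _] := hZ.
have h1 := h B mB Boo; apply/eqP; rewrite eq_le measure_ge0 andbT.
have mS : measurable [set w | counting (Z w `&` B) = +oo%E :> \bar R].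
  by rewrite -[X in measurable X]setTI; exact: (mN B mB measurableT [set +oo%E] (emeasurable_set1 _)).
rewrite -(_ : P (~` [set w | counting (Z w `&` B) = +oo%E :> \bar R]) = 0%E).
  apply: le_measure; rewrite ?inE; [exact: measurable_void|exact: measurableC|].
  by rewrite voidE => w /= ->.
by rewrite probability_setC// h1 subee.
Qed.

Lemma prob_void_disjoint (A B : set T) : measurable A -> measurable B ->
  (mu A < +oo)%E -> (mu B < +oo)%E -> A `&` B = set0 ->
  P (void A `&` void B) = (P (void A) * P (void B))%E.
Proof.
move=> mA mB Afin Bfin AB0; rewrite -voidU.
have mAB : mu (A `|` B) = (mu A + mu B)%E by rewrite measureU.
rewrite !prob_void//; [|exact: measurableU|by rewrite mAB lte_add_pinfty].
rewrite mAB fineD ?ge0_fin_numE// opprD expRD EFinM//.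
Qed.

Definition hits (A : nat -> set T) (k : nat) : set Omega :=
  [set w | forall i, (i < k)%N -> ~ void (A i) w].

Lemma hitsS (A : nat -> set T) k : hits A k.+1 = hits A k `\` void (A k).
Proof.
apply/seteqP; split=> [w h|w [h hk] i].
  by split=> [i ik|]; [apply: h; rewrite ltnW|exact: h].
by rewrite ltnS leq_eqVlt => /predU1P[->//|]; exact: h.
Qed.

Lemma hits0 (A : nat -> set T) : hits A 0 = setT.
Proof. by apply/seteqP; split. Qed.

Lemma measurable_hits (A : nat -> set T) k : (forall i, measurable (A i)) ->
  measurable (hits A k).
Proof.
move=> mA; elim: k => [|k ih]; first by rewrite hits0.
by rewrite hitsS; apply: measurableD => //; exact: measurable_void.
Qed.

(** The sets [A i] may overlap, so independence of the counts over disjoint sets does not apply to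
    them. As [hits A k.+1] is [hits A k] minus a void event, the induction meets only void events,
    which accumulate in [B]; hence the generality in [B]. *)
Lemma prob_hits_void (A : nat -> set T) k (B C : set T) :
  (forall i, measurable (A i)) -> measurable B -> measurable C ->
  (forall i, mu (A i) < +oo)%E -> (mu B < +oo)%E -> (mu C < +oo)%E ->
  (forall i, (i < k)%N -> A i `&` C = set0) -> B `&` C = set0 ->
  P (hits A k `&` void B `&` void C) = (P (hits A k `&` void B) * P (void C))%E.
Proof.
move=> mA mB mC Af Bf Cf; elim: k B mB Bf => [|k ih] B mB Bf AC BC.
  by rewrite hits0 !setTI prob_void_disjoint.
have e D : hits A k.+1 `&` D = (hits A k `&` D) `\` (hits A k `&` D `&` void (A k)).
  rewrite hitsS; apply/seteqP; split=> w /=; tauto.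
have mh := measurable_hits k mA.
have mv D : measurable D -> measurable (void D) by exact: measurable_void.
have mBA : measurable (B `|` A k) by exact: measurableU.
have BAf : (mu (B `|` A k) < +oo)%E.
  by rewrite (le_lt_trans (measureU2 mu mB (mA k)))//; apply: lte_add_pinfty => //; exact: Af.
have AC' : forall i, (i < k)%N -> A i `&` C = set0 by move=> i ik; apply: AC; exact: ltnW.
have BAC : (B `|` A k) `&` C = set0 by rewrite setIUl BC AC// setU0.
have h1 := ih B mB Bf AC' BC.
have h2 := ih _ mBA BAf AC' BAC.
have PD (D E : set Omega) : measurable D -> measurable E ->
    P (D `\` E) = (P D - P (D `&` E))%E.
  by move=> mD mE; rewrite measureD// ltey_eq fin_num_measure.
have mvB := mv _ mB; have mvC := mv _ mC; have mvA := mv _ (mA k).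
rewrite -setIA !e [LHS]PD; [|by repeat apply: measurableI..].
rewrite [in RHS]PD; [|by repeat apply: measurableI..].
have -> : hits A k `&` (void B `&` void C) `&`
    (hits A k `&` (void B `&` void C) `&` void (A k)) =
    hits A k `&` void (B `|` A k) `&` void C.
  by rewrite voidU; apply/seteqP; split=> w /=; tauto.
have -> : hits A k `&` void B `&` (hits A k `&` void B `&` void (A k)) =
    hits A k `&` void (B `|` A k).
  by rewrite voidU; apply/seteqP; split=> w /=; tauto.
rewrite setIA h1 h2 muleBl// ?fin_num_measure//.
by apply: fin_num_adde_defr; rewrite fin_num_measure//; apply: measurableI.
Qed.

End VoidEvents.

(** * Intensity of the intervals that cover or touch a segment *)

Section Strips.
Context {R : realType}.
Variable Lambda : {sigma_finite_measure set (measurableTypeR R) -> \bar R}.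
Local Notation mR := (measurableTypeR R).
Local Notation omega := ((@lebesgue_measure R) \x Lambda)%E.

(** For [s <= t] these intervals cover the segment from [s] to [t]; for [t < s] and [0 <= eps] they
    are the ones that meet the open segment from [t] to [s]. One family serves both uses and is
    stable under intersection. *)
Definition strip (eps s t : R) : set (mR * mR) :=
  [set z | [/\ z.1 < s, t < z.1 + z.2 & eps < z.2 < 1]].

Lemma measurable_strip eps s t : measurable (strip eps s t).
Proof.
have -> : strip eps s t = (fst @^-1` `]-oo, s[%classic) `&`
   ((fun z : mR * mR => z.1 + z.2) @^-1` `]t, +oo[%classic) `&`
   (snd @^-1` `]eps, 1[%classic).
  apply/seteqP; split=> z; rewrite /strip /= !in_itv/= ?andbT.
    by move=> [h1 h2 h3]; repeat split.
  by move=> [[h1 h2] h3]; split.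
apply: measurableI; first apply: measurableI.
- by rewrite -[X in measurable X]setTI; apply: measurable_fst => //; exact: measurable_itv.
- rewrite -[X in measurable X]setTI.
  by apply: (measurable_funD measurable_fst measurable_snd) => //; exact: measurable_itv.
- by rewrite -[X in measurable X]setTI; apply: measurable_snd => //; exact: measurable_itv.
Qed.

Lemma stripI eps s t eps' s' t' : strip eps s t `&` strip eps' s' t' =
  strip (Num.max eps eps') (Num.min s s') (Num.max t t').
Proof.
apply/seteqP; split=> z; rewrite /strip /= lt_min !gt_max.
  move=> [[a b /andP[c e]] [a' b' /andP[c' e']]].
  by rewrite a b c e a' b' c'.
move=> [/andP[a b] /andP[a' b'] /andP[/andP[a'' b''] c]].
by rewrite a b a' b' a'' b'' c.
Qed.

Definition kapE (eps r : R) : \bar R :=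
  (\int[Lambda]_(y in `]eps, 1%R[) (Num.max 0 (y - r))%R%:E)%E.

(** Fubini in the length: the left end points of the intervals of length [y] fill an interval of
    length [y - (t - s)], or nothing when this is negative. *)
Lemma measure_strip eps s t : omega (strip eps s t) = kapE eps (t - s).
Proof.
have mS := measurable_strip eps s t.
rewrite /product_measure1 -(indic_fubini_tonelli_FE _ mS).
rewrite (indic_fubini_tonelli _ _ mS) (indic_fubini_tonelli_GE _ mS).
rewrite /kapE [RHS]integral_mkcond; apply: eq_integral => y _ /=.
rewrite patchE; case: ifPn => [|].
  rewrite inE/= in_itv/= => yI.
  have -> : ysection (strip eps s t) y = `]t - y, s[%classic.
    apply/seteqP; split=> x; rewrite /ysection/strip/= inE/= in_itv/=.
      by move=> [-> h _]; rewrite ltrBlDr h.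
    by move=> /andP[h ->]; split=> //; rewrite -ltrBlDr.
  rewrite lebesgue_measure_itv/= lte_fin.
  case: ltP => h; rewrite -?EFinB; congr (_%:E).
    by rewrite max_r; lra.
  by rewrite max_l//; lra.
rewrite notin_setE/= in_itv/= => /negP yI.
rewrite (_ : ysection _ _ = set0) ?measure0//.
by rewrite -subset0 => x; rewrite /ysection/strip/= inE/= => -[_ _]; rewrite (negbTE yI).
Qed.

Lemma measurable_pos_part (D : set mR) (r : R) :
  measurable_fun D (fun y : mR => Num.max 0 (y - r)).
Proof.
apply: measurable_maxr; first exact: measurable_cst.
by apply: measurable_funB; [exact: measurable_id|exact: measurable_cst].
Qed.

Hypothesis Lfin : forall eps : R, (0 < eps)%R -> (Lambda `]eps, 1%R[%classic < +oo)%E.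

Local Notation mI := (fun eps : R => measurable_itv `]eps, 1[ : @measurable _ mR _).

Lemma integrable_bounded (eps : R) (f : mR -> R) (c : R) : 0 < eps ->
  measurable_fun `]eps, 1[ f -> (forall y, eps < y < 1 -> `|f y| <= c) ->
  Lambda.-integrable `]eps, 1[ (EFin \o f).
Proof.
move=> e0 mf fc; apply: measurable_bounded_integrable => //.
  exact: Lfin.
exists c; split; first exact: num_real.
by move=> M cM y /= yI; rewrite (le_trans _ (ltW cM))// fc// -in_itv.
Qed.

Lemma integrable_pos_part (eps r : R) : 0 < eps ->
  Lambda.-integrable `]eps, 1[ (EFin \o (fun y : mR => Num.max 0 (y - r))).
Proof.
move=> e0; apply: (@integrable_bounded _ _ (1 + `|r|)) => //.
  exact: measurable_pos_part.
move=> y /andP[y0 y1]; have y0' : 0 < y by exact: lt_trans y0.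
rewrite ger0_norm ?le_max ?lexx// ge_max; apply/andP; split.
  by rewrite addr_ge0.
by rewrite (le_trans (ler_norm _))// (le_trans (ler_normB _ _))// lerD2r gtr0_norm// ltW.
Qed.

Definition kap (eps r : R) : R := \int[Lambda]_(y in `]eps, 1[) Num.max 0 (y - r).

Lemma kapEE eps r : 0 < eps -> kapE eps r = (kap eps r)%:E.
Proof.
move=> e0; rewrite /kap /Rintegral fineK//; apply: integrable_fin_num => //.
exact: integrable_pos_part.
Qed.

Lemma kap_ge0 eps r : 0 <= kap eps r.
Proof. by apply: Rintegral_ge0 => y _; rewrite le_max lexx. Qed.

Lemma le_kap eps r r' : 0 < eps -> r <= r' -> kap eps r' <= kap eps r.
Proof.
move=> e0 rr'; apply: le_Rintegral; [by []|exact: integrable_pos_part..|].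
by move=> y _; rewrite ge_max !le_max lexx/= lerB// orbT.
Qed.

(** An interval shorter than [r] cannot contain two points at distance [r], so lowering the cutoff
    further below [r] adds nothing. *)
Lemma kap_cutoff eps eps' r : 0 < eps -> eps <= eps' -> eps' <= r ->
  kap eps r = kap eps' r.
Proof.
move=> e0 ee' er; rewrite /kap Rintegral_mkcond [RHS]Rintegral_mkcond.
apply: eq_Rintegral => y _; rewrite !patchE !mem_setE !in_itv/=.
case: (ltP eps' y) => h /=; first by rewrite (le_lt_trans ee' h).
by case: ifPn => // _; rewrite max_l// subr_le0 (le_trans h).
Qed.

Definition tail (eps : R) : R := fine (Lambda `]eps, 1[%classic).

Lemma tail_ge0 eps : 0 <= tail eps. Proof. by rewrite fine_ge0. Qed.

Lemma kap_lipschitz eps r r' : 0 < eps -> r <= r' ->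
  kap eps r <= kap eps r' + (r' - r) * tail eps.
Proof.
move=> e0 rr'; rewrite /tail -(Rintegral_cst _ (mI eps)) -RintegralD//; last 2 first.
- exact: integrable_pos_part.
- by apply: (@integrable_bounded _ _ `|r' - r|) => //; exact: measurable_cst.
apply: le_Rintegral => //.
- exact: integrable_pos_part.
- apply: (@integrable_bounded _ _ (`|r'| + 1 + `|r' - r|)) => //.
    by apply: measurable_funD; [exact: measurable_pos_part|exact: measurable_cst].
  move=> y /andP[y0 y1]; rewrite (le_trans (ler_normD _ _))// lerD2r.
  have y0' : 0 < y by exact: lt_trans y0.
  rewrite ger0_norm ?le_max ?lexx// ge_max; apply/andP; split.
    by rewrite addr_ge0.
  rewrite (le_trans (ler_norm _))// (le_trans (ler_normB _ _))// addrC lerD2l gtr0_norm// ltW//.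
move=> y _; rewrite ge_max; apply/andP; split.
  by rewrite addr_ge0 ?subr_ge0// le_max lexx.
rewrite -lerBlDr le_max; apply/orP; right; lra.
Qed.

Lemma kapN eps r : 0 < eps -> 0 <= r -> kap eps (- r) = kap eps 0 + r * tail eps.
Proof.
move=> e0 r0; rewrite /tail -(Rintegral_cst _ (mI eps)) -RintegralD//; last 2 first.
- exact: integrable_pos_part.
- by apply: (@integrable_bounded _ _ `|r|) => //; exact: measurable_cst.
apply: eq_Rintegral => y; rewrite inE/= in_itv/= => /andP[y0 y1].
rewrite !max_r; lra.
Qed.

Lemma kap_le0 eps r : 0 < eps -> eps <= r -> kap eps r <= kap r 0.
Proof.
move=> e0 er; rewrite (kap_cutoff e0 er)//; have r0 := lt_le_trans e0 er; exact: le_kap (ltW r0).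
Qed.

Lemma kap_split eps eps' : 0 < eps -> eps <= eps' -> kap eps' 0 <= kap eps 0.
Proof.
move=> e0 ee'; rewrite -lee_fin -!kapEE//; last exact: lt_le_trans ee'.
apply: ge0_subset_integral; [by []|by []| | |].
- by apply/measurable_EFinP; exact: measurable_pos_part.
- by move=> y _; rewrite lee_fin le_max lexx.
- by move=> y /=; rewrite !in_itv/= => /andP[h ->]; rewrite (le_lt_trans ee' h).
Qed.

End Strips.

(** * Bounded measurable functions and Fubini's theorem for them *)

Section BoundedMeasurable.
Context {R : realType} d (T : measurableType d).
Implicit Types X Y : T -> R.

(** A class stable under the ring operations whose members are integrable on every measurable set of
    finite measure, so that integrability reduces to closure properties. *)
Definition bmf X := measurable_fun setT X /\ exists c, forall x, `|X x| <= c.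

Lemma bmf_cst (r : R) : bmf (fun=> r).
Proof. by split; [exact: measurable_cst|exists `|r|]. Qed.

Lemma bmfD X Y : bmf X -> bmf Y -> bmf (fun x => X x + Y x).
Proof.
move=> [mX [c Xc]] [mY [c' Yc]]; split; first exact: measurable_funD.
by exists (c + c') => x; rewrite (le_trans (ler_normD _ _))// lerD.
Qed.

Lemma bmfM X Y : bmf X -> bmf Y -> bmf (fun x => X x * Y x).
Proof.
move=> [mX [c Xc]] [mY [c' Yc]]; split; first exact: measurable_funM.
by exists (c * c') => x; rewrite normrM ler_pM.
Qed.

Lemma bmfB X Y : bmf X -> bmf Y -> bmf (fun x => X x - Y x).
Proof.
move=> [mX [c Xc]] [mY [c' Yc]]; split; first exact: measurable_funB.
by exists (c + c') => x; rewrite (le_trans (ler_normB _ _))// lerD.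
Qed.

Lemma bmf_indic (A : set T) : measurable A -> bmf (\1_A : T -> R).
Proof.
move=> mA; split; first exact: measurable_indic.
by exists 1 => x; rewrite indicE; case: (_ \in _); rewrite ?normr1 ?normr0.
Qed.

Lemma bmf_sum (I : Type) (r : seq I) (F : I -> T -> R) : (forall i, bmf (F i)) ->
  bmf (fun x => \sum_(i <- r) F i x).
Proof.
move=> h; elim: r => [|i r ih].
  by under eq_fun do rewrite big_nil; exact: bmf_cst.
by under eq_fun do rewrite big_cons; exact: bmfD.
Qed.

Lemma bmf_integrable (mu : {measure set T -> \bar R}) (D : set T) X :
  measurable D -> (mu D < +oo)%E -> bmf X -> mu.-integrable D (EFin \o X).
Proof.
move=> mD Dfin [mX [c Xc]]; apply: measurable_bounded_integrable => //.
  exact: measurable_funTS.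
exists c; split; first exact: num_real.
by move=> M cM x _; exact: le_trans (Xc x) (ltW cM).
Qed.

Lemma bmf_norm_Rintegral (mu : {measure set T -> \bar R}) (D : set T) X (c : R) :
  measurable D -> (mu D < +oo)%E -> bmf X -> (forall x, D x -> `|X x| <= c) ->
  `|\int[mu]_(x in D) X x| <= c * fine (mu D).
Proof.
move=> mD Dfin bX Xc; apply: le_trans (le_normr_Rintegral mD _) _.
  exact: bmf_integrable.
rewrite -Rintegral_cst//; apply: le_Rintegral => //.
- have : mu.-integrable D (EFin \o X) by exact: bmf_integrable.
  by move=> /integrable_norm.
- by apply: bmf_integrable => //; exact: bmf_cst.
Qed.

End BoundedMeasurable.

Lemma lebesgue_itv_lty {R : realType} (p q : bool) (a b : R) :
  (@lebesgue_measure R [set` Interval (BSide p a) (BSide q b)] < +oo)%E.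
Proof. by rewrite lebesgue_measure_itv/=; case: ifPn => _; rewrite ?ltry. Qed.

Section FubiniBounded.
Context {R : realType} d (Omega : measurableType d) (P : probability Omega R).
Local Notation mR := (measurableTypeR R).
Local Notation leb := (@lebesgue_measure R).
Variables (a b : R) (g : mR * Omega -> R).
Hypothesis bg : bmf g.

Let D : set (mR * Omega) := `[a, b]%classic `*` setT.
Let mD : measurable D.
Proof. by apply: measurableX => //; exact: measurable_itv. Qed.

Let int_gD : (leb \x P)%E.-integrable setT ((EFin \o g) \_ D).
Proof.
have Dfin : ((leb \x P) D < +oo)%E.
  have -> : (leb \x P)%E D = (leb `[a, b]%classic * P setT)%E.
    by apply: product_measure1E => //; exact: measurable_itv.
  by rewrite probability_setT mule1 /= lebesgue_measure_itv/=; case: ifPn => _; rewrite ?ltry.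
by apply/(integrable_mkcond (EFin \o g) mD); exact: bmf_integrable.
Qed.

Lemma bmf_section_l (x : mR) : bmf (fun w => g (x, w)).
Proof.
have [mg [c gc]] := bg; split; last by exists c.
by apply: (measurableT_comp mg); exact: measurable_pair1.
Qed.

Lemma bmf_section_r (w : Omega) : bmf (fun x => g (x, w)).
Proof.
have [mg [c gc]] := bg; split; last by exists c.
by apply: (measurableT_comp mg); exact: measurable_pair2.
Qed.

Let P_lty : (P setT < +oo)%E. Proof. by rewrite probability_setT ltry. Qed.

Let inner_l w : (\int[leb]_x ((EFin \o g) \_ D) (x, w))%E =
  (\int[leb]_(x in `[a, b]) g (x, w))%:E.
Proof.
rewrite /Rintegral fineK; last first.
  apply: integrable_fin_num; [exact: measurable_itv|].
  by apply: bmf_integrable; [exact: measurable_itv|exact: lebesgue_itv_lty|exact: bmf_section_r].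
rewrite [RHS]integral_mkcond; apply: eq_integral => x _; rewrite !patchE /D.
congr (if _ then _ else _); apply/idP/idP; rewrite !inE => //; first by case.
Qed.

Let inner_r x : (\int[P]_w ((EFin \o g) \_ D) (x, w))%E =
  (((fun x => \int[P]_w g (x, w)) \_ `[a, b]) x)%:E.
Proof.
rewrite patchE; case: ifPn => xab.
  rewrite /Rintegral fineK; last first.
    apply: integrable_fin_num => //.
    by apply: bmf_integrable => //; exact: bmf_section_l.
  apply: eq_integral => w _; rewrite patchE ifT//.
  by move: xab; rewrite !inE.
rewrite integral0_eq// => w _; rewrite patchE ifF//.
by apply/negbTE; apply: contra xab; rewrite !inE => -[].
Qed.

Lemma bmf_Rintegral_l : bmf (fun w => \int[leb]_(x in `[a, b]) g (x, w)).
Proof.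
split.
  apply/measurable_EFinP.
  apply: eq_measurable_fun (measurable_fubini_G int_gD) => w _.
  by rewrite /fubini_G inner_l.
have [_ [c gc]] := bg; exists (c * fine (leb `[a, b]%classic)) => w.
by apply: bmf_norm_Rintegral; [exact: measurable_itv|exact: lebesgue_itv_lty|exact: bmf_section_r|].
Qed.

Lemma Fubini_bounded : \int[P]_w \int[leb]_(x in `[a, b]) g (x, w) =
  \int[leb]_(x in `[a, b]) \int[P]_w g (x, w).
Proof.
have := Fubini int_gD.
under eq_integral do rewrite inner_r.
under [X in _ = X]eq_integral do rewrite inner_l.
move=> /(congr1 fine) e.
by rewrite [RHS]Rintegral_mkcond /Rintegral e.
Qed.

End FubiniBounded.

(** * Products of block increments *)

Section BlockMartingale.
Context {R : realType} d (Omega : measurableType d) (P : probability Omega R).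
Variable Lambda : {sigma_finite_measure set (measurableTypeR R) -> \bar R}.
Local Notation mR := (measurableTypeR R).
Local Notation leb := (@lebesgue_measure R).
Local Notation omega := (leb \x Lambda)%E.
Variable Z : Omega -> set (mR * mR).
Hypothesis hZ : is_PPP P omega Z.
Hypothesis Lfin : forall eps : R, (0 < eps)%R -> (Lambda `]eps, 1%R[%classic < +oo)%E.
Local Notation kap := (kap Lambda).
Local Notation void := (void Z).

Definition free (eps t : R) : set Omega := void (strip eps t t).

Definition density (eps t : R) (w : Omega) : R :=
  expR (kap eps 0) * \1_(free eps t) w.

Lemma measurable_free eps t : measurable (free eps t).
Proof. by apply: (measurable_void hZ); exact: measurable_strip. Qed.

(* A point is covered by an interval iff a rational neighbourhood of it is covered
   by that interval, so that joint measurability needs countably many counts. *)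
Lemma measurable_free2 eps : measurable [set p : mR * Omega | free eps p.1 p.2].
Proof.
rewrite -[X in measurable X]setCK; apply: measurableC.
rewrite (_ : ~` _ = \bigcup_(p : rat) \bigcup_(q : rat)
    (`]ratr p, ratr q[%classic `*` ~` void (strip eps (ratr p) (ratr q)))); last first.
  apply/seteqP; split => -[t w] /=.
    rewrite /free /void /= => /eqP/set0P[z [Zz [z1 z2 z3]]].
    have [p] := rat_in_itvoo z1; rewrite in_itv/= => /andP[zp pt].
    have [q] := rat_in_itvoo z2; rewrite in_itv/= => /andP[tq qz].
    exists p => //; exists q => //; split; rewrite /= ?in_itv/= ?pt ?tq//.
    by apply/eqP/set0P; exists z; split=> //; split.
  move=> [p _ [q _ []]] /=; rewrite in_itv/= => /andP[pt tq].
  move=> /eqP/set0P[z [Zz [z1 z2 z3]]]; apply/eqP/set0P.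
  by exists z; split=> //; split=> //; [exact: lt_trans pt|exact: lt_trans z2].
apply: bigcupT_measurable_rat => p; apply: bigcupT_measurable_rat => q.
apply: measurableX; first exact: measurable_itv.
by apply: measurableC; apply: (measurable_void hZ); exact: measurable_strip.
Qed.

Lemma bmf_density2 eps : bmf (fun p : mR * Omega => density eps p.1 p.2).
Proof.
apply: bmfM; first exact: bmf_cst.
have -> : (fun p : mR * Omega => \1_(free eps p.1) p.2 : R) =
   \1_[set p : mR * Omega | free eps p.1 p.2].
  by apply/funext => p; rewrite !indicE; congr (_%:R); apply/idP/idP; rewrite !inE.
by apply: bmf_indic; exact: measurable_free2.
Qed.

Lemma omega_strip eps s t : 0 < eps -> omega (strip eps s t) = (kap eps (t - s))%:E.
Proof. by move=> e0; rewrite [LHS]measure_strip kapEE. Qed.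

Lemma omega_strip_fin eps s t : 0 < eps -> (omega (strip eps s t) < +oo)%E.
Proof. by move=> e0; rewrite omega_strip// ltry. Qed.

Variables (eps1 eps0 : R) (f : R -> R).
Hypotheses (eps1_gt0 : 0 < eps1) (eps10 : eps1 <= eps0).
Hypotheses (mf : measurable_fun setT (f : mR -> R)) (f1 : forall x, `|f x| <= 1).

Let eps0_gt0 : 0 < eps0. Proof. exact: lt_le_trans eps10. Qed.

Definition incr t w := density eps1 t w - density eps0 t w.

Definition block_sum (a b : R) (w : Omega) : R :=
  \int[leb]_(t in `[a, b]) (f t * incr t w).

(** The intervals of length at most [eps0] that meet the block. A void condition on a set disjoint
    from them keeps the mean of the block's increment at 0, whatever it prescribes about longer
    intervals. *)
Definition band (a b : R) : set (mR * mR) :=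
  [set z | [/\ z.1 < b, a < z.1 + z.2 & z.2 <= eps0]].

Let bf : bmf (f : mR -> R). Proof. by split=> //; exists 1. Qed.

Lemma bmf_incr2 : bmf (fun p : mR * Omega => incr p.1 p.2).
Proof. by apply: bmfB; exact: bmf_density2. Qed.

Lemma bmf_fst : bmf (fun p : mR * Omega => f p.1).
Proof.
split; last by exists 1.
by apply: (measurableT_comp mf); exact: measurable_fst.
Qed.

Lemma bmf_block_sum a b : bmf (block_sum a b).
Proof. by apply: (@bmf_Rintegral_l _ _ _ P a b (fun p => f p.1 * incr p.1 p.2)); apply: bmfM; [exact: bmf_fst|exact: bmf_incr2]. Qed.

Let E (X : Omega -> R) : R := \int[P]_w X w.

Let P_lty : (P setT < +oo)%E. Proof. by rewrite probability_setT ltry. Qed.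

Let intP X : bmf X -> P.-integrable setT (EFin \o X).
Proof. by move=> bX; exact: bmf_integrable. Qed.

Let ED X Y : bmf X -> bmf Y -> E (fun w => X w + Y w) = E X + E Y.
Proof. by move=> bX bY; rewrite /E RintegralD//; exact: intP. Qed.

Let EB X Y : bmf X -> bmf Y -> E (fun w => X w - Y w) = E X - E Y.
Proof. by move=> bX bY; rewrite /E RintegralB//; exact: intP. Qed.

Let EZ c X : bmf X -> E (fun w => c * X w) = c * E X.
Proof. by move=> bX; rewrite /E RintegralZl//; exact: intP. Qed.

Let pv (C : set (mR * mR)) : R := expR (- fine (omega C)).

(** Both sides are expectations of a normalised density at [t], restricted to the void event of [C].
    Lowering the cutoff adds to the strip only lengths in []eps1, eps0]]; [C] avoids them, and their
    intensity is exactly the change of [kap], so the normalisation cancels it. *)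
Lemma prob_void_incr C t : measurable C -> (omega C < +oo)%E ->
  (forall z, C z -> ~ (eps1 < z.2 <= eps0 /\ z.1 < t < z.1 + z.2)) ->
  expR (kap eps1 0) * pv (C `|` strip eps1 t t) =
  expR (kap eps0 0) * pv (C `|` strip eps0 t t).
Proof.
move=> mC Cf Cband.
have [m1 m0] := (measurable_strip eps1 t t, measurable_strip eps0 t t).
pose B := strip eps1 t t `\` strip eps0 t t.
have mB : measurable B by exact: measurableD.
have S1E : strip eps1 t t = strip eps0 t t `|` B.
  apply/esym/setDUK => z [z1 z2 /andP[z3 z4]]; split=> //.
  by rewrite (le_lt_trans eps10 z3).
have S0B : strip eps0 t t `&` B = set0 by rewrite setDIK.
have CB : (C `|` strip eps0 t t) `&` B = set0.
  rewrite setIUl S0B setU0 -subset0 => z [Cz [[z1 z2 /andP[z3 z4]] z5]].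
  apply: (Cband z Cz); rewrite z3 z1 z2; split=> //=.
  by rewrite leNgt; apply/negP => z6; apply: z5; split=> //; rewrite z6.
have : omega (strip eps1 t t) = (omega (strip eps0 t t) + omega B)%E.
  by rewrite {1}S1E; exact: (measureU _ m0 mB S0B).
have oE e : 0 < e -> omega (strip e t t) = (kap e 0)%:E by move=> h; rewrite omega_strip// subrr.
rewrite (oE _ eps1_gt0) (oE _ eps0_gt0) => kE.
have Bf : omega B \is a fin_num.
  by rewrite fin_numE; apply/andP; split; apply/eqP => h; move: kE; rewrite h.
have kE' : kap eps1 0 = kap eps0 0 + fine (omega B).
  by apply: EFin_inj; rewrite kE EFinD (fineK Bf).
have CSf : omega (C `|` strip eps0 t t) \is a fin_num.
  rewrite ge0_fin_numE//; apply: le_lt_trans (measureU2 _ mC m0) _.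
  by apply: lte_add_pinfty => //; exact: omega_strip_fin.
have e : omega (C `|` strip eps1 t t) = (omega (C `|` strip eps0 t t) + omega B)%E.
  rewrite S1E setUA; apply: (measureU _ _ mB CB); exact: measurableU.
by rewrite /pv e fineD// kE' -!expRD; congr expR; ring.
Qed.

Variables (a b : nat -> R) (s : R).
Hypothesis (sep : forall i j, (i < j)%N -> b i + eps0 <= a j).

(* Blocks at mutual distance at least [eps0] are not touched by a common interval of
   length in [eps1, eps0], which makes these products martingales. *)
Definition block_mart n w := \prod_(i < n) (1 + s * block_sum (a i) (b i) w).

Lemma bmf_block_mart n : bmf (block_mart n).
Proof.
rewrite /block_mart; elim: n => [|n ih].
  by under eq_fun do rewrite big_ord0; exact: bmf_cst.
under eq_fun do rewrite big_ord_recr/=; apply: bmfM => //.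
by apply: bmfD; [exact: bmf_cst|apply: bmfM; [exact: bmf_cst|exact: bmf_block_sum]].
Qed.

(** The void condition on [C] makes the induction work. By Fubini the last factor turns into void
    conditions on two strips through a point [t] of the last block; these join [C], and
    [prob_void_incr] shows that the two terms cancel. This stands in for the martingale property. *)
Lemma block_mart_void n C : measurable C -> (omega C < +oo)%E ->
  (forall i, (i < n)%N -> C `&` band (a i) (b i) = set0) ->
  E (fun w => block_mart n w * \1_(void C) w) = pv C.
Proof.
elim: n C => [|n ih] C mC Cf Cn.
  rewrite /block_mart; under eq_fun do rewrite big_ord0 mul1r.
  rewrite /E /Rintegral integral_indic//; last exact: (measurable_void hZ mC).
  by rewrite setIT; exact: (congr1 fine (prob_void hZ mC Cf)).
have mv D : measurable D -> measurable (void D) by move=> mD; exact: (measurable_void hZ mD).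
have -> : (fun w => block_mart n.+1 w * \1_(void C) w) = (fun w =>
    block_mart n w * \1_(void C) w + s * (block_mart n w * \1_(void C) w * block_sum (a n) (b n) w)).
  by apply/funext => w; rewrite /block_mart big_ord_recr/=; ring.
have bX : bmf (fun w => block_mart n w * \1_(void C) w).
  by apply: bmfM; [exact: bmf_block_mart|apply: bmf_indic; exact: mv].
rewrite ED//; last first.
  by apply: bmfM; [exact: bmf_cst|apply: bmfM => //; exact: bmf_block_sum].
rewrite EZ; last by apply: bmfM => //; exact: bmf_block_sum.
rewrite ih//; last by move=> i ni; apply: Cn; rewrite ltnW.
rewrite [X in s * X](_ : _ = 0) ?mulr0 ?addr0//.
pose g (p : mR * Omega) := block_mart n p.2 * \1_(void C) p.2 * (f p.1 * incr p.1 p.2).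
have bX2 : bmf (fun p : mR * Omega => block_mart n p.2 * \1_(void C) p.2).
  have [mX [c Xc]] := bX; split; last by exists c.
  by apply: (measurableT_comp mX); exact: measurable_snd.
have bg : bmf g.
  by apply: bmfM => //; apply: bmfM; [exact: bmf_fst|exact: bmf_incr2].
have -> : E (fun w => block_mart n w * \1_(void C) w * block_sum (a n) (b n) w) =
    E (fun w => \int[leb]_(t in `[a n, b n]) g (t, w)).
  congr E; apply/funext => w; rewrite /g /block_sum/= RintegralZl//.
  apply: bmf_integrable; first exact: measurable_itv.
    exact: lebesgue_itv_lty.
  by apply: (@bmf_section_r _ _ _ (fun p => f p.1 * incr p.1 p.2)); apply: bmfM; [exact: bmf_fst|exact: bmf_incr2].
rewrite /E Fubini_bounded//.
under eq_Rintegral => t tab.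
  rewrite (_ : \int[P]_w g (t, w) = 0); first over.
  rewrite -[LHS]/(E (fun w => g (t, w))).
  have -> : (fun w => g (t, w)) = (fun w => f t * (
     expR (kap eps1 0) * (block_mart n w * \1_(void (C `|` strip eps1 t t)) w) -
     expR (kap eps0 0) * (block_mart n w * \1_(void (C `|` strip eps0 t t)) w))).
    apply/funext => w; rewrite /g /incr /density /free !voidU !indicI/=.
    by rewrite mulrCA mulrBr; congr (_ * (_ - _)); rewrite mulrCA -mulrA.
  have [m1 m0] := (measurable_strip eps1 t t, measurable_strip eps0 t t).
  have Uf D : measurable D -> (omega D < +oo)%E -> (omega (C `|` D) < +oo)%E.
    by move=> mD Df; rewrite (le_lt_trans (measureU2 _ mC mD))// lte_add_pinfty.
  have f1' := Uf _ m1 (omega_strip_fin _ _ eps1_gt0).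
  have f0' := Uf _ m0 (omega_strip_fin _ _ eps0_gt0).
  have M1 : measurable (C `|` strip eps1 t t) by exact: measurableU.
  have M0 : measurable (C `|` strip eps0 t t) by exact: measurableU.
  have b' D : measurable D -> bmf (fun w => block_mart n w * \1_(void D) w).
    by move=> mD; apply: bmfM; [exact: bmf_block_mart|apply: bmf_indic; exact: mv].
  have b'' c D : measurable D -> bmf (fun w => c * (block_mart n w * \1_(void D) w)).
    by move=> mD; apply: bmfM; [exact: bmf_cst|exact: b'].
  rewrite EZ; last by apply: bmfB; exact: b''.
  rewrite EB ?EZ; [|exact: b'|exact: b'|exact: b''|exact: b''].
  move: tab; rewrite inE/= in_itv/= => /andP[at_ tb].
  (* An interval of length at most [eps0] that meets block [i] ends before block [n] begins, hence
     cannot contain [t]. *)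
  have dis e i : (i < n)%N -> (C `|` strip e t t) `&` band (a i) (b i) = set0.
    move=> ni; rewrite setIUl Cn; last exact: ltnW.
    rewrite set0U -subset0 => z [] [z1 z2 z3] [y1 y2 y3].
    suff : t < t by rewrite ltxx.
    apply: (lt_le_trans z2); apply: (le_trans (lerD (ltW y1) y3)).
    exact: le_trans (sep ni) at_.
  rewrite !ih//; [|by move=> i; exact: dis..].
  have -> : expR (kap eps1 0) * pv (C `|` strip eps1 t t) =
      expR (kap eps0 0) * pv (C `|` strip eps0 t t).
    apply: prob_void_incr => // z Cz [/andP[z1 z2] /andP[z3 z4]].
    have : (C `&` band (a n) (b n)) z.
      by split=> //; split=> //; [exact: lt_le_trans tb|exact: le_lt_trans z4].
    by rewrite Cn.
  by rewrite subrr mulr0.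
by rewrite Rintegral_cst ?mul0r//; exact: measurable_itv.
Qed.

Lemma expectation_block_mart n : E (block_mart n) = 1.
Proof.
have := @block_mart_void n set0 measurable0.
rewrite /pv measure0 oppr0 expR0 => <-//.
- congr E; apply/funext => w; rewrite indicE mem_set ?mulr1//.
  by rewrite /void /= setI0.
- by move=> i _; rewrite set0I.
Qed.

End BlockMartingale.

(** * Integrals of waves over intervals *)

Section IntervalIntegrals.
Context {R : realType}.
Local Notation mR := (measurableTypeR R).
Local Notation leb := (@lebesgue_measure R).

Lemma bmf_integrable_itv (f : mR -> R) (a b : R) : bmf f ->
  leb.-integrable `[a, b] (EFin \o f).
Proof.
by move=> bf; apply: bmf_integrable => //; exact: lebesgue_itv_lty.
Qed.

Lemma Rintegral_itv_cat (f : mR -> R) (a b c : R) : bmf f -> a <= b -> b <= c ->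
  \int[leb]_(t in `[a, c]) f t =
  \int[leb]_(t in `[a, b]) f t + \int[leb]_(t in `[b, c]) f t.
Proof.
move=> bf ab bc.
have := @Rintegral_itvB R f (BLeft a) (BRight c) b (bmf_integrable_itv a c bf).
rewrite !bnd_simp => /(_ ab bc) h.
rewrite -(@Rintegral_itv_obnd_cbnd R b (BRight c) f) -?h ?subrKC//.
apply: bmf_integrable => //.
exact: lebesgue_itv_lty.
Qed.

Lemma Rintegral_itv_sum (f : mR -> R) (h : R) (n : nat) : bmf f -> 0 <= h ->
  \int[leb]_(t in `[0, n%:R * h]) f t =
  \sum_(k < n) \int[leb]_(t in `[k%:R * h, k.+1%:R * h]) f t.
Proof.
move=> bf h0; elim: n => [|n ih].
  by rewrite mul0r big_ord0 set_itv1 Rintegral_set1.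
rewrite big_ord_recr/= -ih; apply: Rintegral_itv_cat => //.
  by rewrite mulr_ge0.
by rewrite ler_wpM2r// ler_nat.
Qed.

Lemma is_interval_Rintegral (f : mR -> R) (a b : R) (S : set mR) :
  bmf f -> S `<=` `[a, b]%classic -> is_interval S -> S !=set0 ->
  exists c e, [/\ a <= c, c <= e, e <= b &
    \int[leb]_(t in S) f t = \int[leb]_(t in `[c, e]) f t].
Proof.
move=> [mf _] Sab iS S0; have [t0 St0] := S0.
have hl : has_lbound S by exists a => t /Sab; rewrite /= in_itv/= => /andP[].
have hu : has_ubound S by exists b => t /Sab; rewrite /= in_itv/= => /andP[].
exists (inf S), (sup S); split.
- by apply: lb_le_inf => // t /Sab; rewrite /= in_itv/= => /andP[].
- by apply: le_trans (ub_le_sup hu St0); exact: ge_inf.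
- by apply: ge_sup => // t /Sab; rewrite /= in_itv/= => /andP[].
have mf' (D : set mR) : measurable_fun D (EFin \o f).
  by apply/measurable_EFinP; exact: measurable_funTS.
have /is_intervalP SE := iS.
rewrite /Rintegral; congr fine; rewrite {1}SE /Rhull.
rewrite (asboolT hl) (asboolT hu) integral_itv_bndoo; last exact: mf'.
by apply/esym; apply: integral_itv_bndoo; exact: mf'.
Qed.

Lemma abs_Rintegral_cos (c th a b : R) : 0 < c -> a <= b ->
  `|\int[leb]_(t in `[a, b]) cos (c * t + th)| <= 2 / c.
Proof.
move=> c0; rewrite le_eqVlt => /predU1P[<-|ab].
  by rewrite set_itv1 Rintegral_set1 normr0 divr_ge0// ltW.
pose F (t : R) : R := sin (c * t + th) / c.
have dF (t : R) : is_derive t 1 F (cos (c * t + th)).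
  have d1 : is_derive t 1 (fun t => c * t + th) c.
    rewrite (_ : (fun t => c * t + th) = c *: (id : R -> R) + cst th)//.
    by apply: is_derive_eq; rewrite addr0 /GRing.scale/= mulr1.
  have d2 := @is_derive1_comp R sin (fun t => c * t + th) t _ _ (is_derive_sin (c * t + th)) d1.
  rewrite /F (_ : (fun t => _) = c^-1 *: (sin \o (fun t => c * t + th))); last first.
    by apply/funext => u /=; rewrite mulrC.
  by apply: is_derive_eq; rewrite /GRing.scale/= mulrC mulfK// gt_eqF.
have cF : continuous F.
  by move=> t; apply/differentiable_continuous/derivable1_diffP; have [] := dF t.
rewrite /Rintegral (@continuous_FTC2 _ _ F)//.
- rewrite -EFinB /= /F -mulrBl normrM (gtr0_norm (_ : 0 < c^-1)) ?invr_gt0//.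
  rewrite ler_wpM2r ?invr_ge0 ?(ltW c0)//.
  rewrite (le_trans (ler_normB _ _))// (_ : 2 = 1 + 1)//.
  by rewrite lerD// ler_norml sin_geN1 sin_le1.
- apply: continuous_subspaceT => t.
  apply: (@continuous_comp _ _ _ (fun t => c * t + th) cos); last exact: continuous_cos.
  apply: cvgD; last exact: cvg_cst.
  by apply: cvgM; [exact: cvg_cst|exact: cvg_id].
- split.
  + by move=> t _; have [] := dF t.
  + exact/cvg_at_right_filter/cF.
  + exact/cvg_at_left_filter/cF.
- by move=> t _; rewrite derive1E; have /@derive_val := dF t.
Qed.

End IntervalIntegrals.

(** * Concentration of the Fourier coefficients *)

(** Lets a product of factors [1 + z], of mean exactly 1, play the part of an exponential moment, at
    the cost of [2 * z ^+ 2]. It rests on [(1 + z) * (1 - z + 2 * z ^+ 2) = 1 + z ^+ 2 * (1 + 2 *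
    z)]. *)
Lemma expR_sub_sqr_le {R : realType} (z : R) : - 2^-1 <= z -> expR (z - 2 * z ^+ 2) <= 1 + z.
Proof.
move=> hz; have h := expR_ge1Dx (2 * z ^+ 2 - z).
rewrite -opprB expRN -[leLHS]mul1r ler_pdivrMr ?expR_gt0//.
apply: (@le_trans _ _ ((1 + z) * (1 + (2 * z ^+ 2 - z)))); last first.
  by rewrite ler_wpM2l//; lra.
have : 0 <= z ^+ 2 * (1 + 2 * z) by rewrite mulr_ge0 ?sqr_ge0//; lra.
nra.
Qed.

Section TailBound.
Context {R : realType} d (Omega : measurableType d) (P : probability Omega R).
Variable Lambda : {sigma_finite_measure set (measurableTypeR R) -> \bar R}.
Local Notation mR := (measurableTypeR R).
Local Notation leb := (@lebesgue_measure R).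
Local Notation omega := (leb \x Lambda)%E.
Variable Z : Omega -> set (mR * mR).
Hypothesis hZ : is_PPP P omega Z.
Hypothesis Lfin : forall eps : R, (0 < eps)%R -> (Lambda `]eps, 1%R[%classic < +oo)%E.
Let P_lty : (P setT < +oo)%E. Proof. by rewrite probability_setT ltry. Qed.
Local Notation kap := (kap Lambda).
Local Notation void := (void Z).
Local Notation free := (free Z).
Local Notation density := (density Lambda Z).
Local Notation incr := (incr Lambda Z).
Local Notation block_sum := (block_sum Lambda Z).

(** An interval covering a point between two free points contains neither of them, so it fits
    between them; its length is then at most [b - a], too short for the cutoff. *)
Lemma free_is_interval (eps a b : R) w : b - a <= eps ->
  is_interval (`[a, b]%classic `&` [set t | free eps t w]).
Proof.
move=> abe x y [/= + fx] [/= + fy] z /andP[xz zy].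
rewrite !in_itv/= => /andP[ax xb] /andP[ay yb]; split.
  by rewrite /= ?in_itv/= (le_trans ax xz) (le_trans zy yb).
apply/eqP/negP => /negP/set0P[p [Zp [p1 p2 /andP[p3 p4]]]].
have xp : x <= p.1.
  rewrite leNgt; apply/negP => px; suff : set0 p by [].
  by rewrite -fx; split=> //; split; rewrite ?p3//; exact: le_lt_trans p2.
have yp : p.1 + p.2 <= y.
  rewrite leNgt; apply/negP => px; suff : set0 p by [].
  by rewrite -fy; split=> //; split; rewrite ?p3//; exact: lt_le_trans zy.
lra.
Qed.

Lemma bmf_density eps w : bmf (fun t : mR => density eps t w).
Proof. exact: (@bmf_section_r _ _ _ (fun p => density eps p.1 p.2) (bmf_density2 hZ _)). Qed.

Lemma density_ge0 eps t w : 0 <= density eps t w.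
Proof. by rewrite mulr_ge0 ?expR_ge0// indicE. Qed.

Definition mass eps w := \int[leb]_(t in `[0, 1]) density eps t w.

Variables (f : R -> R) (osc : R).
Hypotheses (mf : measurable_fun setT (f : mR -> R)) (f1 : forall x, `|f x| <= 1).
Hypothesis fosc : forall a b, a <= b -> `|\int[leb]_(t in `[a, b]) f t| <= osc.

Let bf : bmf (f : mR -> R). Proof. by split=> //; exists 1. Qed.

Lemma block_density_bound (eps a b : R) w : a <= b -> b - a <= eps ->
  `|\int[leb]_(t in `[a, b]) (f t * density eps t w)| <=
  expR (kap eps 0) * Num.min (b - a) osc.
Proof.
move=> ab abe.
pose S : set mR := [set t | free eps t w].
have mS : measurable S.
  have := measurable_free2 hZ eps => m2.
  have -> : S = ysection [set p : mR * Omega | free eps p.1 p.2] w.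
    by apply/seteqP; split=> t; rewrite /ysection/= inE.
  exact: measurable_ysection.
have -> : \int[leb]_(t in `[a, b]) (f t * density eps t w) =
    expR (kap eps 0) * \int[leb]_(t in `[a, b] `&` S) f t.
  rewrite Rintegral_mkcondr -RintegralZl//.
    apply: eq_Rintegral => t _; rewrite patchE /density indicE.
    have -> : (w \in free eps t) = (t \in S) by apply/idP/idP; rewrite !inE.
    by case: (t \in S); rewrite ?mulr1 ?mulr0 // mulrC.
  rewrite (_ : f \_ S = fun t => f t * \1_S t).
    by apply: bmf_integrable_itv; apply: bmfM => //; exact: bmf_indic.
  apply/funext => t; rewrite patchE indicE.
  by case: (t \in S); rewrite ?mulr1 ?mulr0.
rewrite normrM (gtr0_norm (expR_gt0 _)) ler_wpM2l ?expR_ge0//.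
have osc0 : 0 <= osc by exact: le_trans (fosc (lexx 0)).
have [S0|/set0P S0] := eqVneq (`[a, b]%classic `&` S) set0.
  by rewrite S0 Rintegral_set0 normr0 le_min subr_ge0 ab.
have [c [e [ac ce eb ->]]] := is_interval_Rintegral bf (@subIsetl _ _ S) (free_is_interval abe) S0.
rewrite le_min fosc// andbT; apply: (@le_trans _ _ (e - c)); last by rewrite lerB.
have h : `|\int[leb]_(t in `[c, e]) f t| <= 1 * fine (leb `[c, e]%classic).
  by apply: bmf_norm_Rintegral => //; exact: lebesgue_itv_lty.
apply: le_trans h _; rewrite mul1r lebesgue_measure_itv/= lte_fin.
by case: ltP => //= _; rewrite subr_ge0.
Qed.

Lemma bmf_incr eps1 eps0 w : bmf (fun t : mR => incr eps1 eps0 t w).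
Proof. by apply: bmfB; exact: bmf_density. Qed.

Let fZ eps w : bmf (fun t : mR => f t * density eps t w).
Proof. by apply: bmfM => //; exact: bmf_density. Qed.

Lemma block_sumE eps1 eps0 a b w : block_sum eps1 eps0 f a b w =
  \int[leb]_(t in `[a, b]) (f t * density eps1 t w) -
  \int[leb]_(t in `[a, b]) (f t * density eps0 t w).
Proof.
rewrite -RintegralB//; [|exact: bmf_integrable_itv..].
by apply: eq_Rintegral => t _; rewrite mulrBr.
Qed.

Lemma abs_block_sum_mass eps1 eps0 a b w : `|block_sum eps1 eps0 f a b w| <=
  \int[leb]_(t in `[a, b]) (density eps1 t w + density eps0 t w).
Proof.
have bX : bmf (fun t : mR => f t * incr eps1 eps0 t w).
  by apply: bmfM => //; exact: bmf_incr.
apply: le_trans (le_normr_Rintegral _ _) _ => //.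
  exact: bmf_integrable_itv.
apply: le_Rintegral => //.
- by have := bmf_integrable_itv a b bX => /integrable_norm.
- by apply: bmf_integrable_itv; apply: bmfD; exact: bmf_density.
move=> t _; rewrite normrM -[leRHS]mul1r ler_pM//.
rewrite (le_trans (ler_normB _ _))// !ger0_norm//; exact: density_ge0.
Qed.

(* Splits the blocks into residue classes modulo 4; blocks of length [eta] in one class
   are at distance at least [2 * eta]. *)
Lemma sum_quadruples (F : nat -> R) n : \sum_(k < 4 * n) F k =
  \sum_(r < 4) \sum_(i < n) F (4 * i + r)%N.
Proof.
rewrite !big_ord_recl big_ord0 /= /bump /=.
elim: n => [|n ih]; first by rewrite muln0 !big_ord0 !addr0.
rewrite mulnS addnC addn4 !big_ord_recr/= ih !addn0 !addr0 !addn1 !addn2.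
by rewrite !addn3; ring.
Qed.

Variables (n : nat) (eta K m s : R).
Hypotheses (n0 : (0 < n)%N) (etaE : (4 * n)%:R * eta = 1) (s0 : 0 < s) (sm : s * m <= 2^-1).
Hypothesis hm : 2 * expR (kap eta 0) * Num.min eta osc <= m.

Let eta0 : 0 < eta.
Proof.
have : 0 < (4 * n)%:R * eta by rewrite etaE.
by rewrite pmulr_rgt0// ltr0n muln_gt0.
Qed.

Let Y k w := block_sum eta (2 * eta) f (k%:R * eta) (k.+1%:R * eta) w.

Lemma abs_block_sum k w : `|Y k w| <= m.
Proof.
rewrite /Y block_sumE (le_trans (ler_normB _ _))// (le_trans _ hm)//.
have len : k.+1%:R * eta - k%:R * eta = eta by rewrite -mulrBl -natrB// subSnn mul1r.
have le : k%:R * eta <= k.+1%:R * eta by rewrite ler_wpM2r ?ler_nat// ltW.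
have e2 : eta <= 2 * eta by have := eta0; lra.
have h1 := @block_density_bound eta (k%:R * eta) (k.+1%:R * eta) w le.
have h2 := @block_density_bound (2 * eta) (k%:R * eta) (k.+1%:R * eta) w le.
rewrite len in h1 h2.
rewrite (_ : 2 * expR (kap eta 0) = expR (kap eta 0) + expR (kap eta 0)); last by ring.
rewrite [leRHS]mulrDl lerD ?h1//; apply: le_trans (h2 e2) _.
apply: ler_wpM2r; last by rewrite ler_expR (kap_split Lfin).
by rewrite le_min (ltW eta0) (le_trans _ (fosc (lexx 0))).
Qed.

(** Together with the uniform bound [m] on one increment, this controls the sum of squares by the
    mass instead of the number of blocks. *)
Lemma sum_abs_block_sum w : \sum_(k < 4 * n) `|Y k w| <= mass eta w + mass (2 * eta) w.
Proof.
have bD : bmf (fun t : mR => density eta t w + density (2 * eta) t w).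
  by apply: bmfD; exact: bmf_density.
rewrite /mass -RintegralD//; [|apply: bmf_integrable_itv; exact: bmf_density..].
rewrite -[X in `[0, X]]etaE Rintegral_itv_sum; [|exact: bD|exact: ltW].
by apply: ler_sum => k _; exact: abs_block_sum_mass.
Qed.

Let bY k : bmf (Y k). Proof. exact: (bmf_block_sum hZ). Qed.

Lemma bmf_mass eps : bmf (mass eps).
Proof. exact: (bmf_Rintegral_l P 0 1 (bmf_density2 hZ eps)). Qed.

Let measurable_masses : measurable [set w | mass eta w < K /\ mass (2 * eta) w < K].
Proof.
have h eps : measurable [set w | mass eps w < K].
  have [m0 _] := bmf_mass eps.
  rewrite (_ : mkset _ = setT `&` mass eps @^-1` `]-oo, K[%classic).
    by apply: m0 => //; exact: measurable_itv.
  by apply/seteqP; split=> w; rewrite /= in_itv//= => -[].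
have -> : [set w | mass eta w < K /\ mass (2 * eta) w < K] =
  [set w | mass eta w < K] `&` [set w | mass (2 * eta) w < K] by [].
exact: measurableI.
Qed.

Let class_event r lam := [set w | (mass eta w < K /\ mass (2 * eta) w < K)%R] `&`
  [set w | (lam <= \sum_(i < n) Y (4 * i + r) w)%R].

Let measurable_class_event r lam : measurable (class_event r lam).
Proof.
apply: measurableI; first exact: measurable_masses.
have [mS _] : bmf (fun w => \sum_(i < n) Y (4 * i + r) w) by exact: bmf_sum.
rewrite (_ : mkset _ = setT `&`
    (fun w => \sum_(i < n) Y (4 * i + r) w) @^-1` `[lam, +oo[%classic).
  by apply: mS => //; exact: measurable_itv.
by apply/seteqP; split=> w; rewrite /= in_itv//= andbT => -[].
Qed.

(** Markov's inequality for the product of mean 1. On the event, the squares of the increments sum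
    to at most [m * (2 * K)], so the product is at least [expR (s * lam - 4 * K * s ^+ 2 * m)]. *)
Let class_sum_tail (r : nat) (lam : R) : (r < 4)%N ->
  (P (class_event r lam) <= (expR (4 * K * s ^+ 2 * m - s * lam))%:E)%E.
Proof.
move=> r4; set A := class_event r lam.
have mA : measurable A by exact: measurable_class_event.
pose a i : R := (4 * i + r)%:R * eta; pose b i : R := (4 * i + r).+1%:R * eta.
have ab i : a i <= b i by rewrite /a /b ler_wpM2r ?ler_nat// ltW.
have sep i j : (i < j)%N -> b i + 2 * eta <= a j.
  move=> ij; rewrite /a /b -mulrDl -(natrD _ _ 2) ler_wpM2r ?(ltW eta0)// ler_nat; lia.
have e12 : eta <= 2 * eta by have := eta0; lra.
have e20 : 0 < 2 * eta by rewrite mulr_gt0.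
pose X := block_mart Lambda Z eta (2 * eta) f a b s n.
have EX : \int[P]_w X w = 1.
  exact: (expectation_block_mart hZ Lfin eta0 e12 mf f1 s sep).
have bX : bmf X by exact: (bmf_block_mart hZ).
have sY k w : - 2^-1 <= s * Y k w.
  have : `|s * Y k w| <= 2^-1.
    by rewrite normrM gtr0_norm// (le_trans _ sm)// ler_wpM2l ?(ltW s0)// abs_block_sum.
  by rewrite ler_norml => /andP[].
have X0 w : 0 <= X w.
  by apply: prodr_ge0 => i _; rewrite -/(Y (4 * i + r) w); have := sY (4 * i + r)%N w; lra.
pose c := expR (s * lam - 4 * K * s ^+ 2 * m).
have cX w : c * \1_A w <= X w.
  rewrite indicE; case: (boolP (w \in A)) => [|_]; last by rewrite mulr0.
  rewrite inE mulr1 => -[[/= m1 m2] lamY].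
  apply: (@le_trans _ _ (\prod_(i < n) expR (s * Y (4 * i + r) w - 2 * (s * Y (4 * i + r) w) ^+ 2))).
    rewrite -expR_sum ler_expR sumrB -!mulr_sumr lerB//.
      by rewrite ler_wpM2l// ltW.
    under eq_bigr do rewrite exprMn.
    rewrite -mulr_sumr.
    have h1 : \sum_(i < n) Y (4 * i + r) w ^+ 2 <= m * (2 * K).
      apply: (@le_trans _ _ (m * \sum_(i < n) `|Y (4 * i + r) w|)).
        rewrite mulr_sumr; apply: ler_sum => i _.
        by rewrite -real_normK ?num_real// expr2 ler_wpM2r// abs_block_sum.
      rewrite ler_wpM2l//; first exact: le_trans (abs_block_sum 0 w).
      apply: (@le_trans _ _ (mass eta w + mass (2 * eta) w)); last by lra.
      apply: le_trans (sum_abs_block_sum w).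
      rewrite (sum_quadruples (fun k => `|Y k w|)) (bigD1 (Ordinal r4))//= lerDl.
      by apply: sumr_ge0 => j _; apply: sumr_ge0 => i _.
    have : 0 <= s ^+ 2 by rewrite sqr_ge0.
    nra.
  rewrite /X /block_mart; apply: ler_prod => i _.
  by rewrite expR_ge0/= expR_sub_sqr_le.
have PAE : P A = (fine (P A))%:E by rewrite fineK// fin_num_measure.
have : c * fine (P A) <= 1.
  rewrite -EX.
  have <- : \int[P]_w (c * \1_A w) = c * fine (P A).
    rewrite RintegralZl//; last by apply: bmf_integrable => //; exact: bmf_indic.
    by congr (_ * _); rewrite /Rintegral integral_indic// setIT.
  apply: le_Rintegral => //.
  - apply: bmf_integrable => //.
    by apply: bmfM; [exact: bmf_cst|exact: bmf_indic].
  - exact: bmf_integrable.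
rewrite PAE lee_fin mulrC -ler_pdivlMr ?expR_gt0// => h; apply: le_trans h _.
by rewrite mul1r -expRN opprB.
Qed.

Lemma measurable_increment_event (lam : R) :
  measurable ([set w | mass eta w < K /\ mass (2 * eta) w < K] `&`
    [set w | lam <= block_sum eta (2 * eta) f 0 1 w]).
Proof.
apply: measurableI; first exact: measurable_masses.
have [mS _] : bmf (block_sum eta (2 * eta) f 0 1) by exact: (bmf_block_sum hZ).
rewrite (_ : mkset _ = setT `&` block_sum eta (2 * eta) f 0 1 @^-1` `[lam, +oo[%classic).
  by apply: mS => //; exact: measurable_itv.
by apply/seteqP; split=> w; rewrite /= in_itv//= andbT => -[].
Qed.

Lemma increment_tail (lam : R) :
  (P ([set w | (mass eta w < K /\ mass (2 * eta) w < K)%R] `&`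
      [set w | (4 * lam <= block_sum eta (2 * eta) f 0 1 w)%R]) <=
   (4 * expR (4 * K * s ^+ 2 * m - s * lam))%:E)%E.
Proof.
apply: (@le_trans _ _ (P (\big[setU/set0]_(r < 4) class_event r lam))).
  apply: le_measure; rewrite ?inE; first exact: measurable_increment_event.
    by apply: bigsetU_measurable => r _.
  move=> w [/= Kw]; rewrite /block_sum -[X in `[0, X]]etaE Rintegral_itv_sum; last 2 first.
  - by apply: bmfM => //; exact: bmf_incr.
  - exact: ltW.
  rewrite -/(Y _ w) (sum_quadruples (fun k => Y k w)) => lamY.
  rewrite -(bigcup_mkord 4 (fun r => class_event r lam)); have [r rlam] : exists r : 'I_4, lam <= \sum_(i < n) Y (4 * i + r) w.
    apply: contrapT => /forallNP h.
    suff : \sum_(r < 4) \sum_(i < n) Y (4 * i + r) w < \sum_(r < 4) lam.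
      by rewrite sumr_const card_ord -mulr_natl ltNge lamY.
    apply: ltr_sum; first by apply/hasP; exists ord0 => //; rewrite mem_index_enum.
    by move=> r _; rewrite ltNge; apply/negP; exact: h.
  by exists r => //=.
apply: (@le_trans _ _ (\sum_(r < 4) P (class_event r lam))%E).
  by apply: (@Boole_inequality _ _ _ P (fun r => class_event r lam)) => r _; exact: measurable_class_event.
have -> : (4 * expR (4 * K * s ^+ 2 * m - s * lam))%:E =
    (\sum_(r < 4) (expR (4 * K * s ^+ 2 * m - s * lam))%:E)%E.
  by rewrite sumEFin sumr_const card_ord mulr_natl.
by apply: lee_sum => r _; exact: class_sum_tail.
Qed.

End TailBound.

(** * Growth of the covering intensity *)

Section Growth.
Context {R : realType}.
Variable Lambda : {sigma_finite_measure set (measurableTypeR R) -> \bar R}.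
Local Notation mR := (measurableTypeR R).

(** [radon01] allows infinite mass near 1, so finiteness above 1/2 is assumed separately; between
    [eps] and 1/2 compactness gives it. *)
Lemma radon01_tail_fin : radon01 Lambda -> (Lambda `](2^-1)%R, 1%R[%classic < +oo)%E ->
  forall eps : R, (0 < eps)%R -> (Lambda `]eps, 1%R[%classic < +oo)%E.
Proof.
move=> [_ rad] half eps e0.
apply: (@le_lt_trans _ _ (Lambda (`[eps, 2^-1]%classic `|` `]2^-1, 1[%classic))).
  apply: le_measure; rewrite ?inE; [exact: measurable_itv| |].
    by apply: measurableU; exact: measurable_itv.
  move=> y /=; rewrite !in_itv/= => /andP[ey y1].
  by case: (leP y 2^-1) => h; [left|right]; rewrite ?(ltW ey) ?h ?y1.
apply: le_lt_trans (measureU2 _ _ _) _; [exact: measurable_itv|exact: measurable_itv|].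
apply: lte_add_pinfty => //; apply: rad; first exact: segment_compact.
move=> y /=; rewrite !in_itv/= => /andP[ey y1].
by rewrite (lt_le_trans e0 ey)/= (le_lt_trans y1)// invf_lt1// ltr1n.
Qed.

Hypothesis Lfin : forall eps : R, (0 < eps)%R -> (Lambda `]eps, 1%R[%classic < +oo)%E.

Lemma chi_ge0 : (0 <= chi Lambda)%E.
Proof.
apply: le_ereal_inf_tmp => _ [b b2 <-].
apply: le_ereal_inf_tmp => _ [V [N _ NV] <-].
apply: (@le_trans _ _ ((ln (b%:R : R))^-1%:E *
    \int[Lambda]_(y in `[b%:R ^- N, b%:R ^- N.-1[) y%:E)%E).
  rewrite mule_ge0//; first by rewrite lee_fin invr_ge0 ln_ge0// ler1n ltnW.
  apply: integral_ge0 => y /=; rewrite in_itv/= lee_fin => /andP[h _].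
  by rewrite (le_trans _ h)// invr_ge0 exprn_ge0.
by apply: ereal_sup_ubound; exists N => //; apply: NV => /=.
Qed.

(** Each shell of base [b] beyond some index [N] contributes at most [c * ln b] to the first moment
    of [Lambda], and about [- ln eps / ln b] shells reach down to [eps]: the base cancels. *)
Lemma kap_growth (c : R) : (chi Lambda < c%:E)%E ->
  exists C, forall eps, 0 < eps -> eps <= 1 -> kap Lambda eps 0 <= C - c * ln eps.
Proof.
move=> hc; have c0 : 0 <= c by rewrite -lee_fin; apply: le_trans chi_ge0 (ltW hc).
have [_ [b b2 <-] hb] := ereal_inf_lt hc.
have [_ [V [N _ NV] <-] hV] := ereal_inf_lt hb.
have lb : 0 < ln (b%:R : R) by rewrite ln_gt0// ltr1n.
have b0 : 0 < (b%:R : R) by rewrite ltr0n ltnW.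
have hI k : (N <= k)%N -> (\int[Lambda]_(y in `[b%:R ^- k, b%:R ^- k.-1[) y%:E <= (c * ln (b%:R : R))%:E)%E.
  move=> Nk.
  have : ((ln (b%:R : R))^-1%:E * \int[Lambda]_(y in `[b%:R ^- k, b%:R ^- k.-1[) y%:E <= c%:E)%E.
    apply: ltW; apply: le_lt_trans hV; apply: ereal_sup_ubound.
    by exists k => //; exact: NV.
  by rewrite muleC lee_pdivrMr// EFinM.
pose G k : \bar R := (\int[Lambda]_(y in `[b%:R ^- k, 1%R[) y%:E)%E.
have bk k : 0 < (b%:R : R) ^- k by rewrite invr_gt0 exprn_gt0.
have mid (D : set mR) : measurable_fun D (EFin \o (id : mR -> R)).
  by apply/measurable_EFinP; exact: measurable_id.
have Gfin k : (G k < +oo)%E.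
  apply: (@le_lt_trans _ _ (\int[Lambda]_(y in `[b%:R ^- k, 1%R[) (cst 1%E) y)%E).
    apply: ge0_le_integral => //.
    - by move=> y /=; rewrite in_itv/= lee_fin => /andP[h _]; rewrite (le_trans _ h)// ltW.
    - by move=> y /=; rewrite in_itv/= lee_fin => /andP[_ /ltW].
  rewrite integral_cst; last exact: measurable_itv.
  rewrite mul1e; apply: le_lt_trans (Lfin (_ : 0 < b%:R ^- k / 2)%R); last by rewrite divr_gt0.
  apply: le_measure; rewrite ?inE; [exact: measurable_itv|exact: measurable_itv|].
  move=> y /=; rewrite !in_itv/= => /andP[h ->]; rewrite andbT (lt_le_trans _ h)//.
  by rewrite ltr_pdivrMr// ltr_pMr// ltr1n.
have GS k : (G k.+1 <= \int[Lambda]_(y in `[b%:R ^- k.+1, b%:R ^- k[) y%:E + G k)%E.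
  rewrite /G -ge0_integral_setU.
  - apply: ge0_subset_integral => //.
    + by apply: measurableU; exact: measurable_itv.
    + move=> y [] /=; rewrite in_itv/= lee_fin => /andP[h _]; rewrite (le_trans _ h)//; exact: ltW.
    + move=> y /=; rewrite !in_itv/= => /andP[h1 h2].
      by case: (ltP y (b%:R ^- k)) => h; [left|right]; rewrite ?h ?h1 ?h2.
  - exact: measurable_itv.
  - exact: measurable_itv.
  - exact: mid.
  - move=> y [] /=; rewrite in_itv/= lee_fin => /andP[h _]; rewrite (le_trans _ h)//; exact: ltW.
  - apply/disj_setPS => y [/=]; rewrite !in_itv/= => /andP[_ h1] /andP[h2 _].
    by rewrite ltNge h2 in h1.
have Gk k : (G (N + k)%N <= G N + (k%:R * (c * ln b%:R))%:E)%E.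
  elim: k => [|k ih]; first by rewrite addn0 mul0r adde0.
  rewrite addnS; apply: le_trans (GS _) _.
  have h := hI (N + k).+1 (leqW (leq_addr _ _)).
  have -> : (G N + (k.+1%:R * (c * ln b%:R))%:E =
      (c * ln b%:R)%:E + (G N + (k%:R * (c * ln b%:R))%:E))%E.
    by rewrite addeCA -EFinD -natr1 mulrDl mul1r [X in (_ + X%:E)%E]addrC.
  exact: leeD h ih.
have kG k : ((kap Lambda (b%:R ^- k) 0)%:E <= G k)%E.
  rewrite -kapEE// /kapE.
  have -> : (\int[Lambda]_(y in `]b%:R ^- k, 1%R[) (Num.max 0 (y - 0))%R%:E =
      \int[Lambda]_(y in `]b%:R ^- k, 1%R[) y%:E)%E.
    apply: eq_integral => y; rewrite inE/= in_itv/= subr0 => /andP[h _].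
    by rewrite max_r// (le_trans _ (ltW h))// ltW.
  apply: ge0_subset_integral => //.
  - move=> y /=; rewrite in_itv/= lee_fin => /andP[h _]; rewrite (le_trans _ h)//; exact: ltW.
  - by move=> y /=; rewrite !in_itv/= => /andP[/ltW -> ->].
exists (fine (G N) + c * ln b%:R * N.+1%:R) => eps e0 e1.
pose k := (Num.truncn (- ln eps / ln b%:R)).+1.
have q0 : 0 <= - ln eps / ln b%:R by rewrite divr_ge0 ?(ltW lb)// oppr_ge0 ln_le0.
have /andP[k1 k2] := truncn_itv q0.
have bke : b%:R ^- (N + k) <= eps.
  have be : b%:R ^+ k >= eps^-1.
    rewrite -ler_ln ?posrE ?invr_gt0 ?exprn_gt0// lnV ?posrE// lnXn// -[ln _ *+ _]mulr_natl.
    by rewrite -ler_pdivrMr// ltW.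
  rewrite -[leRHS]invrK lef_pV2 ?posrE ?invr_gt0 ?exprn_gt0//.
  by apply: le_trans be _; rewrite ler_weXn2l ?leq_addl// ler1n ltnW.
apply: (@le_trans _ _ (kap Lambda (b%:R ^- (N + k)) 0)).
  exact: kap_split.
rewrite -lee_fin; apply: le_trans (kG _) _; apply: le_trans (Gk _) _.
rewrite -[G N]fineK ?ge0_fin_numE ?Gfin//; last first.
  by apply: integral_ge0 => y /=; rewrite in_itv/= lee_fin => /andP[h _]; rewrite (le_trans _ h)// ltW.
rewrite -EFinD lee_fin.
have : (Num.truncn (- ln eps / ln b%:R))%:R * ln b%:R <= - ln eps :> R.
  by rewrite -ler_pdivlMr.
move=> h; rewrite /k -!natr1.
have : 0 <= c * ln b%:R * N%:R by rewrite !mulr_ge0// ltW.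
have /= := ler_wpM2l c0 h.
move: (fine (G N)) (Num.truncn (- ln eps / ln b%:R)) => g m.
by move: (m%:R) (ln b%:R) (ln eps) => m' l1 l2; clear; lra.
Qed.

End Growth.

Section Series.
Context {R : realType}.

Lemma nneseries_le_partial (u : nat -> \bar R) (c : \bar R) :
  (forall n, 0 <= u n)%E -> (forall n, \sum_(0 <= i < n) u i <= c)%E ->
  (\sum_(0 <= i <oo) u i <= c)%E.
Proof.
move=> u0 uc; apply: lime_le; first exact: is_cvg_nneseries.
by near=> n; exact: uc.
Unshelve. all: by end_near. Qed.

Lemma sum_half_pow_le (n : nat) : \sum_(0 <= j < n) (2 ^+ j)^-1 <= 2 :> R.
Proof.
suff : \sum_(0 <= j < n) (2 ^+ j)^-1 = 2 - 2 * (2 ^+ n)^-1 :> R.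
  by move=> ->; rewrite gerBl mulr_ge0// invr_ge0 exprn_ge0.
elim: n => [|n ih]; first by rewrite big_geq// expr0 invr1 mulr1 subrr.
by rewrite big_nat_recr//= ih exprS invfM; field.
Qed.

Lemma sum_inv_sqr_le (n : nat) : \sum_(0 <= k < n) (k.+1%:R ^+ 2)^-1 <= 2 :> R.
Proof.
suff : \sum_(0 <= k < n) (k.+1%:R ^+ 2)^-1 <= 2 - 2 * n.+1%:R^-1 :> R.
  by move=> h; apply: le_trans h _; rewrite gerBl mulr_ge0// invr_ge0.
elim: n => [|n ih]; first by rewrite big_geq// invr1 mulr1 subrr.
rewrite big_nat_recr//=; apply: le_trans (lerD ih (lexx _)) _.
rewrite -(natr1 n.+1); set x : R := n.+1%:R.
have x1 : 1 <= x by rewrite /x ler1n.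
have -> : 2 - 2 * (x + 1)^-1 = 2 - 2 * x^-1 + 2 * (x * (x + 1))^-1.
  by field; apply/andP; split; apply/eqP => h; lra.
have x0 : 0 < x by lra.
have -> : (x ^+ 2)^-1 = 2 * (2 * x ^+ 2)^-1 by field; rewrite gt_eqF.
rewrite lerD2l ler_wpM2l// lef_pV2 ?posrE ?mulr_gt0 ?exprn_gt0//; last by lra.
nra.
Qed.

Lemma sum_arith_geo_le (q : R) (n : nat) : 0 <= q -> q < 1 ->
  \sum_(0 <= j < n) (j.+1%:R * q ^+ j) <= ((1 - q) ^+ 2)^-1.
Proof.
move=> q0 q1; have q2 : 0 < (1 - q) ^+ 2 by rewrite exprn_gt0// subr_gt0.
rewrite -[leRHS]mul1r ler_pdivlMr//.
suff -> : (\sum_(0 <= j < n) (j.+1%:R * q ^+ j)) * (1 - q) ^+ 2 =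
    1 - q ^+ n * (1 + n%:R * (1 - q)).
  by rewrite gerBl mulr_ge0 ?exprn_ge0// addr_ge0// mulr_ge0// subr_ge0 ltW.
elim: n => [|n ih]; first by rewrite big_geq// mul0r expr0 mul0r addr0 mulr1 subrr.
by rewrite big_nat_recr//= mulrDl ih (exprS q) -!natr1; ring.
Qed.

End Series.

(** * Almost sure decay along a grid of frequencies *)

Section GridDecay.
Context {R : realType} d (Omega : measurableType d) (P : probability Omega R).
Variable Lambda : {sigma_finite_measure set (measurableTypeR R) -> \bar R}.
Local Notation mR := (measurableTypeR R).
Local Notation leb := (@lebesgue_measure R).
Local Notation omega := (leb \x Lambda)%E.
Variable Z : Omega -> set (mR * mR).
Hypothesis hZ : is_PPP P omega Z.
Hypothesis Lfin : forall eps : R, (0 < eps)%R -> (Lambda `]eps, 1%R[%classic < +oo)%E.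
Local Notation kap := (kap Lambda).
Local Notation density := (density Lambda Z).
Local Notation incr := (incr Lambda Z).
Local Notation mass := (mass Lambda Z).
Local Notation block_sum := (block_sum Lambda Z).

(** The shift in the exponent makes [scale j.+1] the length of the [4 * 2 ^ j] blocks that tile the
    unit interval. *)
Definition scale (j : nat) : R := (2 ^+ j.+1)^-1.

Lemma scale_gt0 j : 0 < scale j. Proof. by rewrite invr_gt0 exprn_gt0. Qed.

Lemma scaleS j : 2 * scale j.+1 = scale j.
Proof. by rewrite /scale (exprS _ j.+1) invfM mulrA divff// mul1r. Qed.

(* The square roots make the frequencies so dense that the Lipschitz continuity of the
   Fourier transform controls it between them, and Borel-Cantelli still applies. *)
Definition freq (k : nat) : R := 2 * pi * Num.sqrt k.+1%:R.

Lemma freq_gt0 k : 0 < freq k.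
Proof. by rewrite !mulr_gt0 ?pi_gt0 ?sqrtr_gt0. Qed.

Variables (th chi' C theta : R).
Hypothesis growth : forall eps, 0 < eps -> eps <= 1 -> kap eps 0 <= C - chi' * ln eps.
Hypotheses (chi_theta : chi' < theta) (theta0 : 0 <= theta) (theta1 : theta < 1).

(** Only upper bounds are proved for these waves. The phases 0, [pi] and [- (pi / 2)], [pi / 2] turn
    them into bounds on the absolute values of the cosine and sine integrals. *)
Definition wave (k : nat) (t : R) : R := cos (freq k * t + th).

Let wave_meas k : measurable_fun setT (wave k : mR -> R).
Proof.
apply: continuous_measurable_fun => t.
apply: (@continuous_comp _ _ _ (fun t => freq k * t + th) cos); last exact: continuous_cos.
apply: cvgD; last exact: cvg_cst.
by apply: cvgM; [exact: cvg_cst|exact: cvg_id].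
Qed.

Let wave1 k t : `|wave k t| <= 1.
Proof. by rewrite ler_norml cos_geN1 cos_le1. Qed.

Let osc k : R := expR (- (ln k.+1%:R / 2)).

Let wave_osc k a b : a <= b -> `|\int[leb]_(t in `[a, b]) wave k t| <= osc k.
Proof.
move=> ab; apply: le_trans (abs_Rintegral_cos _ (freq_gt0 k) ab) _.
have s0 : 0 < Num.sqrt (k.+1%:R : R) by rewrite sqrtr_gt0.
have -> : osc k = (Num.sqrt k.+1%:R)^-1.
  rewrite /osc expRN; congr (_^-1); apply/eqP.
  rewrite -(@eqrXn2 _ 2)// ?expR_ge0 ?sqrtr_ge0//.
  by rewrite sqr_sqrtr// -expRM_natl mulrC divfK// lnK// posrE.
rewrite ler_pdivrMr ?freq_gt0// /freq [_ * Num.sqrt _]mulrC mulKf ?gt_eqF//.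
by have := pi_ge2 R; lra.
Qed.

(** The factor [expR (kap eps 0)] costs [eps ^ (- chi')] and the interpolation gains [eps ^ theta],
    so halving the scale gains [expR (- rate)]. In [beta], the division by 2 comes from [osc k],
    which is [k.+1] to the power [- 1 / 2]. *)
Let rate : R := (theta - chi') * ln 2.
Let beta : R := (1 - theta) / 2.

(* Interpolates with weight [theta] between the two bounds [scale] and [osc] of the
   integral of a wave over a block. *)
Definition block_bound (k j : nat) : R :=
  expR (ln 2 + C - rate * j%:R - beta * ln k.+1%:R).

Let block_boundP k j :
  2 * expR (kap (scale j.+1) 0) * Num.min (scale j.+1) (osc k) <= block_bound k j.
Proof.
have ln2 : 0 < ln 2 :> R by rewrite ln_gt0// ltr1n.
pose u : R := ln (scale j.+1).
have uE : u = - (j.+2%:R * ln 2).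
  by rewrite /u /scale lnV ?posrE ?exprn_gt0// lnXn// mulr_natl.
have hk : kap (scale j.+1) 0 <= C - chi' * u.
  apply: growth; first exact: scale_gt0.
  by rewrite invf_le1 ?exprn_gt0// exprn_ege1// ler1n.
have hmin : Num.min (scale j.+1) (osc k) <=
    expR (theta * u + (1 - theta) * (- (ln k.+1%:R / 2))).
  rewrite -(lnK (_ : scale j.+1 \is Num.pos)) ?posrE ?scale_gt0// -/u /osc.
  rewrite ge_min !ler_expR.
  set v := - (ln k.+1%:R / 2); case: (lerP u v) => h; apply/orP; [left|right].
    have : 0 <= (1 - theta) * (v - u) by rewrite mulr_ge0// subr_ge0// ltW.
    lra.
  have : 0 <= theta * (u - v) by rewrite mulr_ge0// subr_ge0 ltW.
  lra.
rewrite -[X in X * _ * _](lnK (_ : 2 \is Num.pos)) ?posrE// -expRD.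
have hr : 0 <= Num.min (scale j.+1) (osc k).
  by rewrite le_min ltW ?scale_gt0// expR_ge0.
apply: (@le_trans _ _ (expR (ln 2 + (C - chi' * u)) *
   expR (theta * u + (1 - theta) * (- (ln k.+1%:R / 2))))).
  by apply: ler_pM; rewrite ?expR_ge0// ler_expR lerD2l.
rewrite -expRD ler_expR /beta /rate uE -(natr1 j.+1) -(natr1 j) -subr_ge0.
have h : 0 <= (theta - chi') * ln 2 by rewrite mulr_ge0 ?(ltW ln2)// subr_ge0 ltW.
rewrite [leRHS](_ : _ = 2 * ((theta - chi') * ln 2)) ?mulr_ge0 ?(ltW ln2) ?subr_ge0 ?(ltW chi_theta)//.
by field.
Qed.

(* [increment_tail] with [s = (2 sqrt (block_bound k j))^-1] then bounds the
   probability of [bad K k j] by a multiple of [k^-2 2^-j]. *)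
Definition deviation (k j : nat) : R :=
  2 * expR ((ln 2 + C - rate * j%:R - beta * ln k.+1%:R) / 2) *
  (2 * ln k.+1%:R + j%:R * ln 2).

Definition bad (K k j : nat) : set Omega :=
  [set w | mass (scale j.+1) w < K%:R /\ mass (scale j) w < K%:R] `&`
  [set w | 4 * deviation k j <= block_sum (scale j.+1) (scale j) (wave k) 0 1 w].

Let scale_sum j : (4 * 2 ^ j)%:R * scale j.+1 = 1.
Proof.
rewrite /scale natrM natrX (_ : 4%:R * 2 ^+ j = 2 ^+ j.+2 :> R) ?divff ?expf_neq0//.
by rewrite !exprS; ring.
Qed.

Let measurable_bad K k j : measurable (bad K k j).
Proof.
rewrite /bad -(scaleS j).
exact: (measurable_increment_event hZ (@wave_meas k) (@wave1 k)).
Qed.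

(** The hypothesis says that [block_bound k 0] is at most 1, as needed for [s * m <= 1 / 2]; it
    holds for all large [k]. The chosen [s] makes [4 * K * s ^+ 2 * m] equal to [K], which leaves
    the factor [expR K%:R]. *)
Let prob_bad K k j : ln 2 + C - beta * ln k.+1%:R <= 0 ->
  (P (bad K k j) <= (4 * expR K%:R * ((k.+1%:R ^+ 2)^-1 * (2 ^+ j)^-1))%:E)%E.
Proof.
move=> hk.
have r0 : 0 <= rate * j%:R.
  by rewrite !mulr_ge0 ?ln_ge0 ?ler1n// subr_ge0 ltW.
pose v := (ln 2 + C - rate * j%:R - beta * ln k.+1%:R) / 2.
have v0 : v <= 0 by rewrite /v; lra.
have mE : block_bound k j = expR v ^+ 2.
  by rewrite -expRM_natl; congr expR; rewrite /v; lra.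
have sm : (2 * expR v)^-1 * block_bound k j <= 2^-1.
  rewrite mE expr2 mulrA invfM -(mulrA 2^-1) mulVf ?gt_eqF ?expR_gt0//.
  by rewrite mulr1 ler_piMr ?invr_ge0// -expR0 ler_expR.
have s0 : 0 < (2 * expR v)^-1 by rewrite invr_gt0 mulr_gt0// expR_gt0.
have n0 : (0 < 2 ^ j)%N by rewrite expn_gt0.
have := @increment_tail _ _ _ _ _ _ hZ Lfin _ _ (@wave_meas k) (@wave1 k) (@wave_osc k)
   _ _ K%:R _ _ n0 (scale_sum j) s0 sm (block_boundP k j) (deviation k j).
rewrite scaleS => h; apply: le_trans h _.
rewrite lee_fin -[leRHS]mulrA ler_wpM2l//.
have -> : 4 * K%:R * (2 * expR v)^-1 ^+ 2 * block_bound k j = K%:R.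
  rewrite mE; field; rewrite gt_eqF ?expR_gt0//.
have -> : (2 * expR v)^-1 * deviation k j = 2 * ln k.+1%:R + j%:R * ln 2.
  by rewrite /deviation -/v mulrA mulVf ?mul1r// gt_eqF// mulr_gt0// expR_gt0.
rewrite expRD ler_wpM2l ?expR_ge0// expRN expRD !expRM_natl !lnK ?posrE//.
by rewrite invfM.
Qed.

Let ae_not_bad (K : nat) : {ae P, forall w, exists k1, forall k, (k1 <= k)%N ->
  forall j, ~ bad K k j w}.
Proof.
have beta0 : 0 < beta by rewrite divr_gt0// subr_gt0.
have [k0 hk0] : exists k0 : nat, expR ((ln 2 + C) / beta) < k0%:R.
  by eexists; apply: archi_boundP; exact: expR_ge0.
have small k : ln 2 + C - beta * ln (k0 + k).+1%:R <= 0.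
  rewrite subr_le0 mulrC -ler_pdivrMr// -ler_expR lnK ?posrE//.
  by rewrite (le_trans (ltW hk0))// ler_nat; lia.
pose F k := \bigcup_j bad K (k0 + k) j.
have mF k : measurable (F k) by apply: bigcupT_measurable => j; exact: measurable_bad.
have PF k : (P (F k) <= (8 * expR K%:R * (k.+1%:R ^+ 2)^-1)%:E)%E.
  apply: le_trans (measure_sigma_subadditive P _ (mF k) (@subset_refl _ _)) _ => [j|].
    exact: measurable_bad.
  apply: nneseries_le_partial => // n.
  apply: (@le_trans _ _ (\sum_(0 <= j < n)
      (4 * expR K%:R * (((k0 + k).+1%:R ^+ 2)^-1 * (2 ^+ j)^-1))%:E)%E).
    by apply: lee_sum => j _; exact: prob_bad.
  rewrite sumEFin lee_fin -mulr_sumr.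
  rewrite (_ : 8 * expR K%:R * (k.+1%:R ^+ 2)^-1 =
    4 * expR K%:R * ((k.+1%:R ^+ 2)^-1 * 2)); last by ring.
  rewrite ler_wpM2l ?mulr_ge0 ?expR_ge0// -mulr_sumr ler_pM//.
  - by apply: sumr_ge0 => j _; rewrite invr_ge0 exprn_ge0.
  - by rewrite lef_pV2 ?posrE ?exprn_gt0// lerXn2r ?nnegrE// ler_nat; lia.
  - exact: sum_half_pow_le.
exists (lim_sup_set F); split.
- by apply: bigcapT_measurable => n; exact: bigcup_measurable.
- apply: lim_sup_set_cvg0 => //.
  apply: (@le_lt_trans _ _ (16 * expR K%:R)%:E); last exact: ltry.
  apply: nneseries_le_partial => // n.
  apply: (@le_trans _ _ (\sum_(0 <= k < n) (8 * expR K%:R * (k.+1%:R ^+ 2)^-1)%:E)%E).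
    by apply: lee_sum => k _; exact: PF.
  rewrite sumEFin lee_fin -mulr_sumr (_ : 16 * expR K%:R = 8 * expR K%:R * 2); last by ring.
  by rewrite ler_wpM2l ?mulr_ge0 ?expR_ge0// sum_inv_sqr_le.
move=> w /= h n _; apply: contrapT => hn; apply: h; exists (n + k0)%N => k nk j bkj.
apply: hn; exists (k - k0)%N => /=; first by lia.
by exists j => //; rewrite subnKC//; lia.
Qed.

(** The functional [I] is quantified inside the almost sure event: that event concerns only the
    approximating densities, and any limit along the scales inherits their bound. *)
Lemma grid_decay : {ae P, forall w, forall I : (R -> R) -> R,
  (forall f : R -> R, continuous f ->
    (fun j => \int[leb]_(t in `[0, 1]) (f t * density (scale j) t w)) @ \oo --> I f) ->
  exists B k1, forall k, (k1 <= k)%N ->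
    I (wave k) <= B * expR (- (beta / 2) * ln k.+1%:R) * (2 * ln k.+1%:R + 1)}.
Proof.
have wave_cont k : continuous (wave k).
  move=> t.
  apply: (@continuous_comp _ _ _ (fun t => freq k * t + th) cos); last exact: continuous_cos.
  apply: cvgD; last exact: cvg_cst.
  by apply: cvgM; [exact: cvg_cst|exact: cvg_id].
have := ae_foralln ae_not_bad; apply: filterS => w good I cvI.
(* Convergence tested on the constant 1 bounds all masses, which tells which of the countably many
   events [ae_not_bad K] to use. *)
have [K massK] : exists K : nat, forall j, mass (scale j) w < K%:R.
  have cv1 := cvI (fun=> 1) (@cst_continuous _ _ (1 : R)).
  have [M [_ hM]] := cvg_seq_bounded (cvgP _ cv1).
  have M0 : 0 <= `|M| + 1 by rewrite addr_ge0.
  exists (Num.Def.archi_bound (`|M| + 1)) => j.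
  apply: le_lt_trans (archi_boundP M0).
  have Mlt : M < `|M| + 1 by rewrite (le_lt_trans (ler_norm _))// ltrDl.
  have := hM _ Mlt j Logic.I; apply: le_trans; rewrite (le_trans _ (ler_norm _))//.
  by rewrite le_eqVlt; apply/orP; left; apply/eqP; apply: eq_Rintegral => t _; rewrite mul1r.
have [k1 hk1] := good K.
(* Half of [rate], because the deviations are of the order of the square root of [block_bound]. *)
pose q := expR (- rate / 2).
have rate0 : 0 < rate by rewrite mulr_gt0 ?subr_gt0// ln_gt0// ltr1n.
have q1 : q < 1 by rewrite -expR0 ltr_expR mulNr oppr_lt0 divr_gt0.
pose B := 2 * expR (kap (scale 0) 0) + 8 * expR ((ln 2 + C) / 2) * ((1 - q) ^+ 2)^-1.
exists B, k1 => k k1k.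
have l0 : 0 <= ln k.+1%:R :> R by rewrite ln_ge0// ler1n.
pose D := expR (- (beta / 2) * ln k.+1%:R) * (2 * ln k.+1%:R + 1).
have D0 : 0 <= D by rewrite mulr_ge0 ?expR_ge0// addr_ge0// mulr_ge0.
pose S j := \int[leb]_(t in `[0, 1]) (wave k t * density (scale j) t w).
have SS j : S j.+1 <= S j + 4 * deviation k j.
  have := hk1 k k1k j; rewrite /bad /= => /not_andP[[]|/negP].
    by split; exact: massK.
  rewrite -ltNge => h; rewrite -lerBlDl; apply: ltW; apply: le_lt_trans h.
  by rewrite (block_sumE hZ (@wave_meas k) (@wave1 k)).
have SJ J : S J <= S 0 + \sum_(0 <= j < J) 4 * deviation k j.
  elim: J => [|J ih]; first by rewrite big_geq// addr0.
  by rewrite big_nat_recr//= addrA (le_trans (SS J))// lerD2r.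
have dev j : deviation k j <= 2 * expR ((ln 2 + C) / 2) * D * (j.+1%:R * q ^+ j).
  have -> : deviation k j = 2 * expR ((ln 2 + C) / 2) *
      expR (- (beta / 2) * ln k.+1%:R) * (2 * ln k.+1%:R + j%:R * ln 2) * q ^+ j.
    rewrite /deviation /q -expRM_natl (_ : _ / 2 = (ln 2 + C) / 2 +
       (- (beta / 2) * ln k.+1%:R) + j%:R * (- rate / 2)); last by field.
    by rewrite !expRD; ring.
  rewrite /D !mulrA ler_wpM2r ?exprn_ge0 ?expR_ge0// -!mulrA.
  rewrite ler_wpM2l// ler_wpM2l ?expR_ge0// ler_wpM2l ?expR_ge0//.
  have ln21 : ln 2 <= 1 :> R.
    by rewrite -[leRHS]expRK ler_ln ?posrE ?expR_gt0// (le_trans _ (expR_ge1Dx 1)).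
  have := ler_wpM2l (ler0n R j) ln21; rewrite mulr1.
  have := mulr_ge0 l0 (ler0n R j).
  rewrite -natr1; nra.
(* At the coarsest scale two blocks of length 1/2 tile the interval. Each is bounded through [osc k]
   alone, which is at most [D] because [beta <= 1]. *)
have S0 : S 0%N <= 2 * expR (kap (scale 0) 0) * D.
  have s0 := scale_gt0 0.
  have e2 : 2%:R * scale 0 = 1 by rewrite /scale expr1 divff.
  have bX : bmf (fun t : mR => wave k t * density (scale 0) t w).
    by apply: bmfM; [split; [exact: wave_meas|exists 1; exact: wave1]|exact: (bmf_density hZ)].
  rewrite /S -[X in `[0, X]]e2 Rintegral_itv_sum//; last exact: ltW.
  apply: (@le_trans _ _ (\sum_(i < 2) expR (kap (scale 0) 0) * D)).
    apply: ler_sum => i _; apply: le_trans (ler_norm _) _.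
    have len : i.+1%:R * scale 0 - i%:R * scale 0 = scale 0.
      by rewrite -mulrBl -natrB// subSnn mul1r.
    apply: le_trans (block_density_bound hZ (@wave_meas k) (@wave1 k) (@wave_osc k) _ _ _) _.
    - by rewrite -subr_ge0 len ltW.
    - by rewrite len.
    rewrite ler_wpM2l ?expR_ge0// (@le_trans _ _ (osc k))//; first by rewrite ge_min lexx orbT.
    rewrite -[leLHS]mulr1 /D ler_pM ?expR_ge0//; last by rewrite lerDr mulr_ge0.
    rewrite ler_expR mulNr lerN2.
    have : beta <= 1 by rewrite /beta ler_pdivrMr// mul1r; have := theta0; lra.
    nra.
  by rewrite sumr_const card_ord -mulrA mulr_natl.
have bound J : S J <= B * D.
  apply: le_trans (SJ J) _; rewrite /B mulrDl lerD//.
  rewrite -mulr_sumr.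
  apply: (@le_trans _ _ (4 * \sum_(0 <= j < J)
     (2 * expR ((ln 2 + C) / 2) * D * (j.+1%:R * q ^+ j)))).
    by rewrite ler_wpM2l//; apply: ler_sum => j _; exact: dev.
  rewrite -mulr_sumr (_ : 8 * _ * _ * D =
     4 * (2 * expR ((ln 2 + C) / 2) * D * ((1 - q) ^+ 2)^-1)); last by ring.
  rewrite ler_wpM2l// ler_wpM2l//; first by rewrite mulr_ge0// mulr_ge0 ?expR_ge0.
  by apply: sum_arith_geo_le => //; exact: expR_ge0.
rewrite -mulrA -/D; have cvS := cvI _ (wave_cont k).
rewrite -(cvg_lim _ cvS)//; apply: limr_le; first exact: cvgP cvS.
by near=> J; exact: bound.
Unshelve. all: by end_near. Qed.

End GridDecay.

(** * From the grid to all real frequencies *)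

Section RealFrequencies.
Context {R : realType}.
Local Notation mR := (measurableTypeR R).
Variable nu : {measure set (measurableTypeR R) -> \bar R}.
Hypothesis nu_fin : (nu setT < +oo)%E.
Hypothesis nu01 : nu (~` `[0%R, 1%R]%classic) = 0%E.

Lemma cos_lipschitz (a b : R) : `|cos a - cos b| <= `|a - b|.
Proof.
wlog ab : a b / a <= b.
  by move=> h; have [/h//|/ltW/h] := leP a b; rewrite distrC (distrC b).
have cc : {within `[a, b], continuous (@cos R)}.
  exact/continuous_subspaceT/continuous_cos.
have [c _ e] := MVT_segment ab (fun x _ => is_derive_cos x) cc.
rewrite distrC e normrM normrN (distrC a) -[leRHS]mul1r ler_wpM2r//.
by rewrite ler_norml sin_geN1 sin_le1.
Qed.

Lemma normc_fourier_sqr x : ComplexField.Normc.normc (fourier nu x) ^+ 2 =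
  (\int[nu]_t cos (2 * pi * x * t)) ^+ 2 + (\int[nu]_t sin (2 * pi * x * t)) ^+ 2.
Proof. by rewrite /fourier /= sqr_sqrtr ?addr_ge0 ?sqr_ge0// sqrrN. Qed.

Lemma Rintegral_concentrated (f : mR -> R) : bmf f ->
  \int[nu]_t f t = \int[nu]_(t in `[0, 1]) f t.
Proof.
move=> bf; have m01 : measurable (`[0%R, 1%R]%classic : set mR) by exact: measurable_itv.
have -> : \int[nu]_t f t = \int[nu]_(t in `[0%R, 1%R]%classic `|` ~` `[0%R, 1%R]%classic) f t.
  by rewrite setUv.
rewrite Rintegral_setU//; last 3 first.
- exact: measurableC.
- by rewrite setUv; exact: bmf_integrable.
- by apply/disj_setPCl.
have [_ [c fc]] := bf; rewrite [X in _ + X](_ : _ = 0) ?addr0//.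
apply/eqP; rewrite -normr_le0.
have : `|\int[nu]_(x in ~` `[0%R, 1%R]%classic) f x| <= c * fine (nu (~` `[0%R, 1%R]%classic)).
  apply: bmf_norm_Rintegral => //; first exact: measurableC.
  by rewrite nu01 ltry.
by rewrite nu01 mulr0.
Qed.

Lemma bmf_wave (c th : R) : bmf (fun t : mR => cos (c * t + th)).
Proof.
split; last by exists 1 => t; rewrite ler_norml cos_geN1 cos_le1.
apply: continuous_measurable_fun => t.
apply: (@continuous_comp _ _ _ (fun t => c * t + th) cos); last exact: continuous_cos.
apply: cvgD; last exact: cvg_cst.
by apply: cvgM; [exact: cvg_cst|exact: cvg_id].
Qed.

Lemma wave_frequency_lipschitz (y s th : R) :
  \int[nu]_(t in `[0, 1]) cos (y * t + th) <=
  \int[nu]_(t in `[0, 1]) cos (s * t + th) + `|y - s| * fine (nu setT).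
Proof.
have m01 : measurable (`[0%R, 1%R]%classic : set mR) by exact: measurable_itv.
have f01 : (nu `[0%R, 1%R]%classic < +oo)%E.
  by apply: le_lt_trans nu_fin; apply: le_measure; rewrite ?inE.
rewrite -lerBlDl -RintegralB//; [|by apply: bmf_integrable => //; exact: bmf_wave..].
have bD : bmf (fun t : mR => cos (y * t + th) - cos (s * t + th)).
  by apply: bmfB; exact: bmf_wave.
apply: le_trans (ler_norm _) _.
apply: (@le_trans _ _ (`|y - s| * fine (nu `[0%R, 1%R]%classic))).
  apply: bmf_norm_Rintegral => // t; rewrite /= in_itv/= => /andP[t0 t1].
  apply: le_trans (cos_lipschitz _ _) _.
  rewrite opprD addrACA subrr addr0 -mulrBl normrM ler_piMr// ger0_norm//.
rewrite ler_wpM2l// fine_le//.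
- by rewrite ge0_fin_numE.
- by rewrite ge0_fin_numE.
- by apply: le_measure; rewrite ?inE.
Qed.

Lemma log_factor_absorb (gam u : R) : 0 < gam -> 0 <= u ->
  2 * u + 1 <= (2 / gam + 1) * expR (gam * u).
Proof.
move=> g0 u0; have h := expR_ge1Dx (gam * u).
have h2 : u <= gam^-1 * expR (gam * u).
  by rewrite mulrC ler_pdivlMr// mulrC; lra.
have h1 : 1 <= expR (gam * u) by rewrite -expR0 ler_expR mulr_ge0// ltW.
lra.
Qed.

Variables (B beta D : R) (k1 : nat).
Hypotheses (beta1 : beta <= 1) (D0 : 0 <= D) (Dbeta : D < 2 * beta).
Hypothesis grid : forall th, th \in [:: 0; pi; - (pi / 2); pi / 2] ->
  forall k, (k1 <= k)%N -> \int[nu]_(t in `[0, 1]) wave th k t <=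
    B * expR (- (beta / 2) * ln k.+1%:R) * (2 * ln k.+1%:R + 1).

(** With [k.+1] the integer part of [y ^+ 2], the grid point [s = sqrt k.+1] satisfies
    [y - s <= 1 / s], so the Lipschitz error stays within the order of the grid bound because
    [beta <= 1]. *)
Lemma wave_decay : exists C A : R, forall y, A <= y -> forall th,
  th \in [:: 0; pi; - (pi / 2); pi / 2] ->
  \int[nu]_(t in `[0, 1]) cos (2 * pi * y * t + th) <= C * expR (- (D / 2) * ln y).
Proof.
(* The room for absorbing the logarithmic factor: [- beta / 2 + gam = - D / 4], a power of [k.+1]
   that amounts to the power [- D / 2] of [y]. *)
pose gam : R := (beta - D / 2) / 2.
have gam0 : 0 < gam by rewrite /gam; have := Dbeta; lra.
pose B2 : R := `|B| + 2 * pi * fine (nu setT).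
have pi0 := pi_gt0 R.
have nu0 : 0 <= fine (nu setT) by exact: fine_ge0.
have B20 : 0 <= B2 by rewrite /B2 addr_ge0// !mulr_ge0// ltW.
exists (B2 * (2 / gam + 1) * expR (D / 4 * ln 2)), (k1.+2%:R) => y Ay th thP.
have y1 : 1 <= y by apply: le_trans Ay; rewrite ler1n.
have y0 : 0 < y by lra.
have y20 : 0 <= y ^+ 2 by exact: sqr_ge0.
pose k := (Num.Def.trunc (y ^+ 2)).-1.
have k1y : (k1.+2 <= Num.Def.trunc (y ^+ 2))%N.
  rewrite truncn_ge_nat//; by apply: le_trans Ay _; rewrite expr2 ler_peMl// ltW.
have kE : k.+1 = Num.Def.trunc (y ^+ 2) by rewrite /k prednK// (leq_trans _ k1y).
have /andP[ky yk] := truncn_itv y20; rewrite -kE in ky yk.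
have kk1 : (k1 <= k)%N by rewrite -kE in k1y; rewrite -ltnS ltnW.
pose s : R := Num.sqrt k.+1%:R.
have s0 : 0 < s by rewrite sqrtr_gt0.
have s2 : s ^+ 2 = k.+1%:R by rewrite sqr_sqrtr.
have s1 : 1 <= s by rewrite -sqrtr1 ler_wsqrtr// ler1n.
have sy : s <= y by rewrite -(@ler_pXn2r _ 2) ?nnegrE ?(ltW s0) ?(ltW y0)// s2.
have ys : y - s <= s^-1.
  have h : y ^+ 2 < s ^+ 2 + 1 by rewrite s2 natr1.
  rewrite -[leRHS]mul1r ler_pdivlMr//.
  have : (y - s) * s <= (y - s) * (y + s) by rewrite ler_wpM2l//; lra.
  lra.
pose u : R := ln k.+1%:R.
have u0 : 0 <= u by rewrite ln_ge0// ler1n.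
have uE : u = 2 * ln s by rewrite /u -s2 lnXn// mulr_natl.
have sE : s^-1 = expR (- (u / 2)) by rewrite uE mulrC mulKf// expRN lnK.
have := wave_frequency_lipschitz (2 * pi * y) (2 * pi * s) th.
have := grid thP kk1; rewrite /wave /freq -/s -/u => h1 h2; apply: le_trans h2 _.
apply: le_trans (lerD h1 (lexx _)) _.
rewrite -mulrBr normrM (ger0_norm (_ : 0 <= 2 * pi)) ?mulr_ge0 ?(ltW pi0)//.
rewrite ger0_norm ?subr_ge0//.
pose E := expR (- (beta / 2) * u) * (2 * u + 1).
have E0 : 0 <= E by rewrite mulr_ge0 ?expR_ge0//; lra.
have sE' : s^-1 <= E.
  rewrite sE -[leLHS]mulr1 ler_pM ?expR_ge0//; last by lra.
  rewrite ler_expR; have : 0 <= (1 - beta) * u by rewrite mulr_ge0// subr_ge0.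
  lra.
have step1 : B * expR (- (beta / 2) * u) * (2 * u + 1) +
    2 * pi * (y - s) * fine (nu setT) <= B2 * E.
  rewrite /B2 [leRHS]mulrDl lerD//; first by rewrite -mulrA ler_wpM2r// ler_norm.
  rewrite -!mulrA ler_wpM2l// ler_wpM2l ?(ltW pi0)// mulrC ler_wpM2l//.
  exact: le_trans sE'.
apply: le_trans step1 _; rewrite -!mulrA ler_wpM2l//.
have lny : ln y <= (u + ln 2) / 2.
  rewrite ler_pdivlMr// mulrC mulr_natl -lnXn// /u -lnM ?posrE// ler_ln ?posrE ?exprn_gt0 ?mulr_gt0//.
  by apply: le_trans (ltW yk) _; rewrite -natrM ler_nat muln2 doubleS !ltnS -addnn leq_addr.
apply: (@le_trans _ _ (expR (- (beta / 2) * u) * ((2 / gam + 1) * expR (gam * u)))).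
  by rewrite ler_wpM2l ?expR_ge0// log_factor_absorb.
rewrite mulrCA ler_wpM2l//; first by rewrite addr_ge0// divr_ge0// ltW.
rewrite -!expRD ler_expR.
have : D * ln y <= D * ((u + ln 2) / 2) by rewrite ler_wpM2l.
rewrite /gam; lra.
Qed.

Lemma fourier_decay : exists C A : R, forall x : R, A <= `|x| ->
  ComplexField.Normc.normc (fourier nu x) ^+ 2 <= C * `|x| `^ (- D).
Proof.
have [C [A h]] := wave_decay.
exists (2 * C ^+ 2), (Num.max A 1) => x; rewrite ge_max => /andP[Ax x1].
have x0 : 0 < `|x| by lra.
pose e := expR (- (D / 2) * ln `|x|).
have eE : `|x| `^ (- D) = e ^+ 2.
  by rewrite /powR gt_eqF// /e -expRM_natl; congr expR; field.
rewrite normc_fourier_sqr eE.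
pose c := \int[nu]_(t in `[0, 1]) cos (2 * pi * `|x| * t).
pose s := \int[nu]_(t in `[0, 1]) sin (2 * pi * `|x| * t).
have m01 : measurable (`[0%R, 1%R]%classic : set mR) by exact: measurable_itv.
have f01 : (nu `[0%R, 1%R]%classic < +oo)%E.
  by apply: le_lt_trans nu_fin; apply: le_measure; rewrite ?inE.
have bsin (w : R) : bmf (fun t : mR => sin (w * t)).
  rewrite (_ : (fun t => _) = fun t => cos (w * t + - (pi / 2))); first exact: bmf_wave.
  by apply/funext => t; rewrite cosBpihalf.
have bcos (w : R) : bmf (fun t : mR => cos (w * t)).
  rewrite (_ : (fun t => _) = fun t => cos (w * t + 0)); first exact: bmf_wave.
  by apply/funext => t; rewrite addr0.
have cE : (\int[nu]_t cos (2 * pi * x * t)) ^+ 2 = c ^+ 2.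
  rewrite Rintegral_concentrated//; congr (_ ^+ 2); apply: eq_Rintegral => t _.
  by case: (ger0P x) => // _; rewrite !(mulrN, mulNr) cosN.
have sE : (\int[nu]_t sin (2 * pi * x * t)) ^+ 2 = s ^+ 2.
  rewrite Rintegral_concentrated// /s; case: (ger0P x) => // _.
  rewrite (_ : \int[nu]_(t in `[0, 1]) sin (2 * pi * - x * t) =
     - \int[nu]_(t in `[0, 1]) sin (2 * pi * x * t)) ?sqrrN//.
  rewrite -[RHS]mulN1r -RintegralZl//; last exact: bmf_integrable.
  by apply: eq_Rintegral => t _; rewrite mulN1r !(mulrN, mulNr) sinN.
have absle (r : R) : r <= C * e -> - r <= C * e -> r ^+ 2 <= (C * e) ^+ 2.
  move=> h1 h2; rewrite -(real_normK (num_real r)) lerXn2r ?nnegrE//.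
    by apply: le_trans (normr_ge0 r) _; rewrite ler_norml lerNl h1 h2.
  by rewrite ler_norml lerNl h1 h2.
have hc : c <= C * e.
  have := h _ Ax 0 (mem_head _ _).
  by under eq_Rintegral do rewrite addr0.
have hcN : - c <= C * e.
  have := h _ Ax pi; rewrite !inE eqxx orbT => /(_ isT).
  by under eq_Rintegral do rewrite cosDpi -mulN1r; rewrite RintegralZl ?mulN1r//; exact: bmf_integrable.
have hs : s <= C * e.
  have := h _ Ax (- (pi / 2)); rewrite !inE eqxx !orbT => /(_ isT).
  by under eq_Rintegral do rewrite cosBpihalf.
have hsN : - s <= C * e.
  have := h _ Ax (pi / 2); rewrite !inE eqxx !orbT => /(_ isT).
  by under eq_Rintegral do rewrite cosDpihalf -mulN1r; rewrite RintegralZl ?mulN1r//; exact: bmf_integrable.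
rewrite cE sE; have := absle _ hc hcN; have := absle _ hs hsN.
rewrite exprMn; lra.
Qed.

End RealFrequencies.

(** * Passage to the limit measure *)

Section Limit.
Context {R : realType} d (Omega : measurableType d) (P : probability Omega R).
Variable Lambda : {sigma_finite_measure set (measurableTypeR R) -> \bar R}.
Local Notation mR := (measurableTypeR R).
Local Notation leb := (@lebesgue_measure R).
Local Notation omega := (leb \x Lambda)%E.
Variable Z : Omega -> set (mR * mR).
Hypothesis hZ : is_PPP P omega Z.
Hypothesis Lfin : forall eps : R, (0 < eps)%R -> (Lambda `]eps, 1%R[%classic < +oo)%E.
Local Notation kap := (kap Lambda).
Local Notation density := (density Lambda Z).

Lemma uncovered_epsE eps t w : 0 <= t <= 1 ->
  uncovered_eps (Z w) eps t <-> free Z eps t w.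
Proof.
move=> t01; rewrite /uncovered_eps /uncovered /free /void /=; split=> [[_ h]|h].
  rewrite -subset0 => z [Zz [z1 z2 z3]]; apply: h; exists z; first by split.
  by rewrite /= in_itv/= z1 z2.
split; first by rewrite /= in_itv/=.
move=> [z [Zz z3]] /=; rewrite in_itv/= => /andP[z1 z2].
suff : set0 z by []. by rewrite -h; split.
Qed.

Lemma MRC_densityE eps w t : 0 < eps -> 0 <= t <= 1 ->
  MRC_density P Z eps w t = density eps t w.
Proof.
move=> e0 t01; rewrite /MRC_density /density.
have e w' : (t \in uncovered_eps (Z w') eps) = (w' \in free Z eps t).
  by apply/idP/idP => /set_mem h; apply/mem_set; exact/(uncovered_epsE _ _ t01).
have -> : (fun w' => \1_(uncovered_eps (Z w') eps) t) = \1_(free Z eps t) :> (Omega -> R).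
  by apply/funext => w'; rewrite !indicE e.
rewrite expectation_indic; last exact: (measurable_free hZ).
have pE : P (free Z eps t) = (expR (- kap eps 0))%:E.
  apply: etrans (prob_void hZ (measurable_strip eps t t) _) _; first exact: omega_strip_fin.
  have h := omega_strip Lfin t t e0; rewrite subrr in h.
  by congr (expR (- _))%:E; exact: (congr1 fine h).
by rewrite pE/= expRN invrK mulrC !indicE e.
Qed.

Lemma scale_cvg0 : scale (R := R) @ \oo --> 0.
Proof.
rewrite (_ : scale (R := R) = geometric 2^-1 2^-1); last first.
  by apply/funext => j; rewrite /scale /geometric /= exprS invfM exprVn.
by apply: cvg_geometric; rewrite gtr0_norm// invf_lt1// ltr1n.
Qed.

Variable M : R.-ker Omega ~> measurableTypeR R.

(** The content of [is_MRC] at one outcome: [is_MRC] unfolds to its almost sure validity. The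
    arguments at a fixed outcome are thereby separated from the probabilistic ones. *)
Definition MRC_limit (w : Omega) : Prop :=
  [/\ (M w setT < +oo)%E, M w (~` `[0%R, 1%R]) = 0%E
    & forall f : R -> R, continuous f ->
      (\int[lebesgue_measure]_(t in `[0%R, 1%R])
        (f t * MRC_density P Z eps w t)%:E)%E @[eps --> 0^'+] -->
      (\int[M w]_(t in `[0%R, 1%R]) (f t)%:E)%E ].

Lemma kernel_integrable w f : MRC_limit w -> continuous f ->
  (M w).-integrable `[0%R, 1%R]%classic (EFin \o (f : mR -> R)).
Proof.
move=> [Mfin _ _] cf.
have m01 : measurable (`[0%R, 1%R]%classic : set mR) by exact: measurable_itv.
have f01 : (M w `[0%R, 1%R]%classic < +oo)%E.
  by apply: le_lt_trans Mfin; apply: le_measure; rewrite ?inE.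
apply: measurable_bounded_integrable => //.
  by apply: measurable_funTS; exact: continuous_measurable_fun.
have cn : {within `[0, 1], continuous (fun t => `|f t|)}.
  apply: continuous_subspaceT => t; apply: continuous_comp; [exact: cf|].
  exact: norm_continuous.
have [c _ hc] := EVT_max ler01 cn.
exists `|f c|; split; first exact: num_real.
by move=> x cx t /= t01; rewrite (le_trans (hc _ _))// ltW.
Qed.

Lemma MRC_limit_scale w : MRC_limit w -> forall f : R -> R, continuous f ->
  (fun j => \int[leb]_(t in `[0, 1]) (f t * density (scale j) t w)) @ \oo -->
  \int[M w]_(t in `[0, 1]) f t.
Proof.
move=> good f cf; have [_ _ cvM] := good.
have kf : (\int[M w]_(t in `[0%R, 1%R]) (f t)%:E)%E =
    (\int[M w]_(t in `[0, 1]) f t)%:E.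
  rewrite /Rintegral fineK//; apply: integrable_fin_num; first exact: measurable_itv.
  exact: kernel_integrable.
have cv0 : scale (R := R) @ \oo --> 0^'+.
  move=> A hA; have h := scale_cvg0 hA.
  change (\forall j \near \oo, A (scale j)).
  change (\forall j \near \oo, (fun u : R => 0 < u -> A u) (scale j)) in h.
  by apply: filterS h => j; apply; exact: scale_gt0.
have := cvg_comp _ _ cv0 (cvM f cf); rewrite kf => /fine_cvg.
apply: cvg_trans; apply: near_eq_cvg; near=> j => /=.
rewrite /Rintegral; congr fine; apply: eq_integral => t; rewrite inE/= in_itv/= => t01.
by rewrite MRC_densityE// scale_gt0.
Unshelve. all: by end_near. Qed.

Hypothesis chi1 : (chi Lambda < 1)%E.

Lemma Fourier_decay_ae (D : R) : 0 <= D -> (D%:E < 1 - chi Lambda)%E ->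
  {ae P, forall w, MRC_limit w -> exists C A : R, forall x : R, A <= `|x| ->
    ComplexField.Normc.normc (fourier (M w) x) ^+ 2 <= C * `|x| `^ (- D)}.
Proof.
have [c chiE] : exists c, chi Lambda = c%:E.
  have := chi_ge0 Lambda; case: (chi Lambda) chi1 => [c _ _|//|//]; first by exists c.
have c0 : 0 <= c by rewrite -lee_fin -chiE chi_ge0.
rewrite chiE -EFinB lte_fin => D0 Dc.
(* The gap between [D] and [1 - c] is cut into four: [kap] grows with exponent [c + tau], the choice
   [theta = c + 2 * tau] leaves a positive rate, and the resulting exponent [1 - theta] still
   exceeds [D] by [2 * tau]. *)
pose tau := (1 - c - D) / 4.
have tau0 : 0 < tau by rewrite /tau; lra.
have [C hC] : exists C, forall eps, 0 < eps -> eps <= 1 -> kap eps 0 <= C - (c + tau) * ln eps.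
  by apply: kap_growth => //; rewrite chiE lte_fin ltrDl.
have th1 : c + tau < c + 2 * tau by lra.
have th2 : 0 <= c + 2 * tau by lra.
have th3 : c + 2 * tau < 1 by rewrite /tau; lra.
have grid th := grid_decay hZ Lfin th hC th1 th2 th3.
(* The four phases are read off a list by index, so that one countable intersection of almost sure
   events covers them; the indices past its end give phase 0 again. *)
have := ae_foralln (fun n => grid (nth 0 [:: 0; pi; - (pi / 2); pi / 2] n)).
apply: filterS => w g good.
have [g1 g2 g3 g4] := And4 (g 0%N) (g 1%N) (g 2%N) (g 3%N).
have [Mfin M01 _] := good.
pose I (f : R -> R) := \int[M w]_(t in `[0, 1]) f t.
have [B1 [k1 h1]] := g1 I (MRC_limit_scale good).
have [B2 [k2 h2]] := g2 I (MRC_limit_scale good).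
have [B3 [k3 h3]] := g3 I (MRC_limit_scale good).
have [B4 [k4 h4]] := g4 I (MRC_limit_scale good).
pose beta := (1 - (c + 2 * tau)) / 2.
pose B := `|B1| + `|B2| + `|B3| + `|B4|.
apply: (@fourier_decay _ (M w) Mfin M01 B beta D (k1 + k2 + k3 + k4)%N).
- by rewrite /beta; lra.
- by [].
- by rewrite /beta /tau; lra.
have E0 k : 0 <= expR (- (beta / 2) * ln (k.+1%:R : R)) * (2 * ln k.+1%:R + 1).
  by rewrite mulr_ge0 ?expR_ge0// addr_ge0// mulr_ge0// ln_ge0// ler1n.
have Ble b th k : b <= B -> I (wave th k) <=
    b * expR (- (beta / 2) * ln k.+1%:R) * (2 * ln k.+1%:R + 1) ->
    I (wave th k) <= B * expR (- (beta / 2) * ln k.+1%:R) * (2 * ln k.+1%:R + 1).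
  by move=> bB h; apply: le_trans h _; rewrite -[leLHS]mulrA -[leRHS]mulrA; apply: ler_wpM2r => //; exact: E0.
have [n1 n2 n3 n4] := And4 (ler_norm B1) (ler_norm B2) (ler_norm B3) (ler_norm B4).
have [p1 p2 p3 p4] := And4 (normr_ge0 B1) (normr_ge0 B2) (normr_ge0 B3) (normr_ge0 B4).
move=> th; rewrite !inE => /or4P[] /eqP-> k hk.
- by apply: (Ble B1); [rewrite /B; lra|by apply: h1; rewrite (leq_trans _ hk)// -!addnA leq_addr].
- by apply: (Ble B2); [rewrite /B; lra|by apply: h2; rewrite (leq_trans _ hk)// -!addnA addnCA leq_addr].
- by apply: (Ble B3); [rewrite /B; lra|by apply: h3; rewrite (leq_trans _ hk)// -addnA addnCA leq_addr].
- by apply: (Ble B4); [rewrite /B; lra|by apply: h4; rewrite (leq_trans _ hk)// leq_addl].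
Qed.

End Limit.

(** A sequence of exponents tending to [1 - c] is enough for the supremum and keeps the number of
    almost sure events countable. *)
Lemma dimF_ge (R : realType) (nu : {measure set (measurableTypeR R) -> \bar R}) (c : R) :
  0 <= c ->
  (forall n : nat, 0 <= 1 - c - n.+1%:R^-1 -> exists C A : R, forall x : R, A <= `|x| ->
    ComplexField.Normc.normc (fourier nu x) ^+ 2 <= C * `|x| `^ (- (1 - c - n.+1%:R^-1))) ->
  c < 1 -> (1 - c%:E <= dimF nu)%E.
Proof.
move=> c0 h c1; rewrite -EFinB; apply/lee_addgt0Pr => e e0.
have [n hn] : exists n : nat, n.+1%:R^-1 < Num.min e (1 - c).
  have m0 : 0 < Num.min e (1 - c) by rewrite lt_min e0 subr_gt0.
  exists (Num.Def.archi_bound (Num.min e (1 - c))^-1).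
  rewrite -[ltRHS]invrK ltf_pV2 ?posrE ?invr_gt0//.
  rewrite (lt_le_trans (archi_boundP _))// ?ler_nat//.
  by rewrite invr_ge0 ltW.
move: hn; rewrite lt_min => /andP[ne nc].
have D0 : 0 <= 1 - c - n.+1%:R^-1 by rewrite subr_ge0 ltW.
apply: (@le_trans _ _ ((1 - c - n.+1%:R^-1)%:E + e%:E)%E).
  by rewrite -EFinD lee_fin -addrA lerDl addrC subr_ge0 ltW.
apply: leeD => //; apply: ereal_sup_ubound; exists (1 - c - n.+1%:R^-1) => //; split.
  by rewrite D0 /= -addrA gtrDl -opprD oppr_lt0 ltr_wpDl// invr_gt0.
exact: h.
Qed.

(** * Non-degeneracy of the limit measure *)

Section FirstUncoveredCell.
Context {R : realType} dsp (Omega : measurableType dsp) (P : probability Omega R).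
Variable Lambda : {sigma_finite_measure set (measurableTypeR R) -> \bar R}.
Local Notation mR := (measurableTypeR R).
Local Notation leb := (@lebesgue_measure R).
Local Notation omega := (leb \x Lambda)%E.
Variable Z : Omega -> set (mR * mR).
Hypothesis hZ : is_PPP P omega Z.
Hypothesis Lfin : forall eps : R, (0 < eps)%R -> (Lambda `]eps, 1%R[%classic < +oo)%E.
Local Notation kap := (kap Lambda).
Local Notation void := (void Z).
Local Notation density := (density Lambda Z).
Local Notation mass := (mass Lambda Z).
Let P_lty : (P setT < +oo)%E. Proof. by rewrite probability_setT ltry. Qed.

Variables (eps eps' : R) (N : nat).
Hypotheses (eps'_gt0 : 0 < eps') (eps'_le : eps' <= eps) (N0 : (0 < N)%N).

Let eps_gt0 : 0 < eps. Proof. exact: lt_le_trans eps'_le. Qed.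
Let pt (k : nat) : R := k%:R / N%:R.
Let le_pt k l : (k <= l)%N -> pt k <= pt l.
Proof. by move=> kl; rewrite /pt ler_wpM2r ?invr_ge0// ler_nat. Qed.
Let ptB k l : (k <= l)%N -> pt l - pt k = pt (l - k).
Proof. by move=> kl; rewrite /pt -mulrBl natrB. Qed.

Definition coverer (k : nat) : set (mR * mR) := strip eps (pt k) (pt k.+1).
Definition toucher (l : nat) : set (mR * mR) := strip eps' (pt l.+1) (pt l).

(** A cell counts as covered only when a single interval covers it, so that the event is built from
    void events of strips. The cell of an uncovered point is never covered in this sense. *)
Definition first_cell (k : nat) : set Omega :=
  hits Z coverer k `&` void (coverer k).

Let mcov k : measurable (coverer k). Proof. exact: measurable_strip. Qed.
Let mtou k : measurable (toucher k). Proof. exact: measurable_strip. Qed.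

Lemma measurable_first_cell k : measurable (first_cell k).
Proof.
apply: measurableI; first by apply: (measurable_hits hZ).
exact: (measurable_void hZ).
Qed.

Lemma trivIset_first_cell : trivIset setT first_cell.
Proof.
apply/trivIsetP => i j _ _; wlog : i j / (i < j)%N.
  move=> h; rewrite neq_ltn => /orP[ij|ji]; first by apply: h => //; rewrite ltn_eqF.
  by rewrite setIC; apply: h => //; rewrite ltn_eqF.
move=> ij _; rewrite -subset0 => w [[_ vi] [hj _]].
exact: (hj i ij vi).
Qed.

(* Given that [k] is the first cell which no large interval covers, the points
   seen so far end before the cell [k.+1], and the future is regenerated. *)
Lemma prob_first_cell_void k (C : set (mR * mR)) : measurable C -> (omega C < +oo)%E ->
  (forall z, C z -> pt k.+1 < z.1 + z.2) ->
  P (first_cell k `&` void C) = (P (first_cell k) * P (void (C `\` coverer k)))%E.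
Proof.
move=> mC Cf Ck.
have e1 : first_cell k = hits Z (fun i => coverer i `\` coverer k) k `&` void (coverer k).
  apply/seteqP; split=> w [h1 h2]; split=> // i ik h3.
    apply: (h1 i ik); rewrite /void /= -subset0 => z [Zz iz].
    case: (pselect (coverer k z)) => kz.
      have : (Z w `&` coverer k) z by split.
      by rewrite h2.
    have : (Z w `&` (coverer i `\` coverer k)) z by split.
    by rewrite h3.
  apply: (h1 i ik); move: w h3 {h1 h2}; apply: void_sub; exact: subDsetl.
have e2 : first_cell k `&` void C = first_cell k `&` void (C `\` coverer k).
  apply/seteqP; split=> w [[h1 h2] h3]; split=> //.
    by move: w h3 {h1 h2}; apply: void_sub; exact: subDsetl.
  rewrite /void /= -subset0 => z [Zz Cz].
  case: (pselect (coverer k z)) => kz.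
    have : (Z w `&` coverer k) z by split.
    by rewrite h2.
  have : (Z w `&` (C `\` coverer k)) z by split.
  by rewrite h3.
rewrite e2 e1.
apply: (@prob_hits_void _ _ _ P _ _ omega) => //.
- by move=> i; exact: measurableD.
- exact: measurableD.
- move=> i; apply: le_lt_trans (omega_strip_fin Lfin (pt i) (pt i.+1) eps_gt0).
  apply: le_measure; rewrite ?inE; [exact: measurableD|exact: mcov|exact: subDsetl].
- exact: omega_strip_fin.
- apply: le_lt_trans Cf.
  by apply: le_measure; rewrite ?inE; [exact: measurableD| |exact: subDsetl].
(* An interval that covers cell [i] starts before [pt k]; if it also ends past [pt k.+1], it covers
   cell [k]. *)
- move=> i ik; rewrite -subset0 => z [[[z1 z2 z3] z4] [Cz _]].
  apply: z4; split=> //; last exact: Ck.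
  by apply: lt_le_trans z1 _; apply: le_pt; exact: ltnW.
- by rewrite setDE setIA setIAC setICr set0I.
Qed.

Let omegaD (A B : set (mR * mR)) (a b : R) : measurable A -> measurable B ->
  omega A = a%:E -> omega (A `&` B) = b%:E -> omega (A `\` B) = (a - b)%:E.
Proof.
move=> mA mB hA hAB; have Af : (omega A < +oo)%E by rewrite hA ltry.
have := measureD mA mB Af; rewrite [X in _ = (X - _)%E]hA => ->.
by rewrite [X in (_ - X)%E]hAB EFinB.
Qed.

Let tau : R := kap eps' (- N%:R^-1).

Let omega_toucher l : omega (toucher l) = tau%:E.
Proof.
rewrite omega_strip//; congr (kap _ _)%:E.
by rewrite /pt -mulrBl -natr1 opprD addrA subrr add0r mulN1r.
Qed.

Lemma omega_toucherD k l : (k < l)%N ->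
  omega (toucher l `\` coverer k) = (tau - kap eps (pt (l - k)))%:E.
Proof.
move=> kl; apply: (omegaD (mtou l) (mcov k) (omega_toucher l)).
rewrite /toucher /coverer stripI max_r// min_r; last by apply: le_pt; lia.
rewrite max_l; last exact: le_pt.
by rewrite omega_strip// ptB// ltnW.
Qed.

(** An interval that covers cell [k] and meets cell [m] also meets the cell [l] between them, so
    removing [toucher l] from [toucher m] already removes the coverers of [k]. The offset
    [(m - l).-1] counts the cells strictly between [l] and [m]. *)
Lemma omega_toucherUD k l m : (k < l)%N -> (l < m)%N ->
  omega ((toucher l `|` toucher m) `\` coverer k) =
  (tau - kap eps (pt (l - k)) + (tau - kap eps' (pt (m - l).-1)))%:E.
Proof.
move=> kl lm.
have -> : (toucher l `|` toucher m) `\` coverer k =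
    (toucher l `\` coverer k) `|` (toucher m `\` toucher l).
  apply/seteqP; split=> z.
    move=> [[lz|mz] kz]; first by left.
    by case: (pselect (toucher l z)) => lz; [left|right].
  move=> [[lz kz]|[mz lz]]; first by split=> //; left.
  split; first by right.
  move=> [z1 z2 /andP[z3 z4]]; apply: lz; case: mz => y1 y2 y3; split=> //.
    by apply: lt_le_trans z1 _; apply: le_pt; lia.
  by apply: le_lt_trans y2; apply: le_pt; exact: ltnW.
have h1 := omega_toucherD kl.
have h2 : omega (toucher m `\` toucher l) = (tau - kap eps' (pt (m - l).-1))%:E.
  apply: (omegaD (mtou m) (mtou l) (omega_toucher m)).
  rewrite /toucher stripI maxxx min_r; last by apply: le_pt; lia.
  rewrite max_l; last by apply: le_pt; exact: ltnW.
  by rewrite omega_strip// ptB//; congr (kap _ (pt _))%:E; lia.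
rewrite [LHS]measureU; last 3 first.
- exact: measurableD.
- exact: measurableD.
- by rewrite -subset0 => z [[lz _] [_ nlz]].
by rewrite [X in (X + _)%E]h1 [X in (_ + X)%E]h2 -EFinD.
Qed.

Let u (d : nat) : R := expR (kap eps (pt d)).
Let v (i : nat) : R := expR (kap eps' (pt i)).
Let pr (A : set Omega) : R := fine (P A).

(* Mixed moments of the normalised indicators that the cells [k + d] and [k + e] are free,
   given that [k] is the first uncovered cell. *)
Definition cell_cov (d e : nat) : R :=
  if d == e then u d * expR tau else u (minn d e) * v (maxn d e - minn d e).-1.

Lemma cell_covC d e : cell_cov d e = cell_cov e d.
Proof. by rewrite /cell_cov eq_sym minnC maxnC; case: eqP => [->|]. Qed.

Let normalize1 (p a t : R) : t != 0 -> t * (p * (a * t^-1)) = p * a.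
Proof. by move=> t0; rewrite mulrCA; congr (_ * _); rewrite mulrCA divff// mulr1. Qed.

Let normalize2 (p a b t : R) : t != 0 ->
  t * t * (p * (a * t^-1 * (b * t^-1))) = p * (a * b).
Proof. by move=> t0; field. Qed.

Let t0 : expR tau != 0. Proof. by rewrite gt_eqF// expR_gt0. Qed.

Let prE A : measurable A -> P A = (pr A)%:E.
Proof. by move=> mA; rewrite /pr fineK// fin_num_measure. Qed.

Let pr_void (A : set (mR * mR)) (a : R) : measurable A -> omega A = a%:E ->
  P (void A) = (expR (- a))%:E.
Proof.
move=> mA hA; have Af : (omega A < +oo)%E by rewrite hA ltry.
apply: etrans (prob_void hZ mA Af) _.
by congr (expR (- _))%:E; exact: (congr1 fine hA).
Qed.

Let pt_toucher k d z : toucher (k + d.+1) z -> pt k.+1 < z.1 + z.2.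
Proof. by move=> [_ + _]; apply: le_lt_trans; apply: le_pt; rewrite addnS ltnS leq_addr. Qed.

Let mvoid A : measurable A -> measurable (void A).
Proof. by move=> mA; exact: (measurable_void hZ). Qed.

Let mfc k : measurable (first_cell k). Proof. exact: measurable_first_cell. Qed.

(** The conditioning rules out the intervals that cover cell [k] and reach cell [k + d]. Their
    intensity [kap eps (pt d)] drops out of the void probability, whence the bias [u d]. *)
Lemma first_cell_mean k d : (0 < d)%N ->
  expR tau * pr (first_cell k `&` void (toucher (k + d))) = pr (first_cell k) * u d.
Proof.
case: d => // d _.
have kd : (k < k + d.+1)%N by rewrite addnS ltnS leq_addr.
have f : (omega (toucher (k + d.+1)) < +oo)%E by rewrite omega_toucher ltry.
rewrite /pr prob_first_cell_void//; last by move=> z; exact: pt_toucher.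
rewrite (pr_void _ (omega_toucherD kd)); last exact: measurableD.
rewrite (prE (mfc k))/= addKn opprB expRD expRN /u.
exact: normalize1.
Qed.

Lemma first_cell_cov k d e : (0 < d)%N -> (0 < e)%N ->
  expR tau * expR tau *
    pr (first_cell k `&` (void (toucher (k + d)) `&` void (toucher (k + e)))) =
  pr (first_cell k) * cell_cov d e.
Proof.
wlog de : d e / (d <= e)%N.
  move=> h d0 e0; have [de|/ltnW ed] := leqP d e; first exact: h.
  by rewrite cell_covC -(h e d ed e0 d0) (setIC (void (toucher (k + d)))).
move=> d0 e0; rewrite /cell_cov; case: eqVneq => [<-|dne].
  by rewrite setIid -[LHS]mulrA (first_cell_mean k d0) mulrC -[LHS]mulrA.
have {dne}de : (d < e)%N by rewrite ltn_neqAle dne.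
rewrite (minn_idPl (ltnW de)) (maxn_idPr (ltnW de)).
case: d d0 de => // d _; case: e e0 => // e _ de.
have kd : (k < k + d.+1)%N by rewrite addnS ltnS leq_addr.
have kde : (k + d.+1 < k + e.+1)%N by rewrite ltn_add2l.
have mU : measurable (toucher (k + d.+1) `|` toucher (k + e.+1)) by exact: measurableU.
have f : (omega (toucher (k + d.+1) `|` toucher (k + e.+1)) < +oo)%E.
  apply: le_lt_trans (measureU2 _ (mtou _) (mtou _)) _.
  by apply: lte_add_pinfty; [have := omega_toucher (k + d.+1)|have := omega_toucher (k + e.+1)] => h; apply: le_lt_trans (ltry tau); rewrite -h.
rewrite -voidU /pr prob_first_cell_void//; last by move=> z []; exact: pt_toucher.
rewrite (pr_void _ (omega_toucherUD kd kde)); last exact: measurableD.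
rewrite (prE (mfc k))/= addKn subnDl /u /v opprD !opprB !expRD !expRN.
exact: normalize2.
Qed.

Variables (q : nat -> R) (n : nat) (eta : R).
Hypotheses (eta_ge0 : 0 <= eta) (q_0 : q 0%N = 0).
Hypothesis q_mean : \sum_(d < n) q d * u d = 1.
Hypothesis q_cov : \sum_(d < n) \sum_(e < n) q d * q e * cell_cov d e <= 1 + eta.

(** The weight at [d = 0] is 0: the intervals that touch cell [k] itself may also cover earlier
    cells, so they are not independent of the event that [k] is first. *)
Definition cell_mass (k : nat) (w : Omega) : R :=
  \sum_(d < n) q d * (expR tau * \1_(void (toucher (k + d))) w).

Let E (X : Omega -> R) : R := \int[P]_w X w.

Let intP X : bmf X -> P.-integrable setT (EFin \o X).
Proof. by move=> bX; exact: bmf_integrable. Qed.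

Let E_sum (I : Type) (r : seq I) (F : I -> Omega -> R) : (forall i, bmf (F i)) ->
  E (fun w => \sum_(i <- r) F i w) = \sum_(i <- r) E (F i).
Proof.
move=> bF; elim: r => [|i r ih].
  rewrite big_nil; under eq_fun do rewrite big_nil.
  by rewrite /E Rintegral_cst// mul0r.
rewrite big_cons -ih; under eq_fun do rewrite big_cons.
by rewrite /E RintegralD//; apply: intP => //; exact: bmf_sum.
Qed.

Let EZ c X : bmf X -> E (fun w => c * X w) = c * E X.
Proof. by move=> bX; rewrite /E RintegralZl//; exact: intP. Qed.

Let E_indic A : measurable A -> E (\1_A) = pr A.
Proof. by move=> mA; rewrite /E /Rintegral integral_indic// setIT. Qed.

Let E_mean k : E (fun w => \1_(first_cell k) w * cell_mass k w) = pr (first_cell k).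
Proof.
have -> : (fun w => \1_(first_cell k) w * cell_mass k w) = (fun w => \sum_(d < n)
   q d * expR tau * \1_(first_cell k `&` void (toucher (k + d))) w).
  apply/funext => w; rewrite /cell_mass mulr_sumr; apply: eq_bigr => d _.
  by rewrite indicI /=; ring.
have mI d : measurable (first_cell k `&` void (toucher (k + d))).
  by apply: measurableI => //; exact: mvoid.
rewrite E_sum; last by move=> d; apply: bmfM; [exact: bmf_cst|exact: bmf_indic].
rewrite -[RHS]mulr1 -q_mean mulr_sumr; apply: eq_bigr => d _.
rewrite EZ ?E_indic//; last exact: bmf_indic.
case: (posnP d) => [->|d0]; first by rewrite q_0 !mul0r mulr0.
by rewrite -mulrA first_cell_mean//; ring.
Qed.

Let E_sqr k : E (fun w => \1_(first_cell k) w * cell_mass k w ^+ 2) <=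
  pr (first_cell k) * (1 + eta).
Proof.
have -> : (fun w => \1_(first_cell k) w * cell_mass k w ^+ 2) =
  (fun w => \sum_(d < n) \sum_(e < n) q d * q e * (expR tau * expR tau) *
    \1_(first_cell k `&` (void (toucher (k + d)) `&` void (toucher (k + e)))) w).
  apply/funext => w; rewrite /cell_mass expr2 mulr_suml mulr_sumr; apply: eq_bigr => d _.
  rewrite mulr_sumr mulr_sumr; apply: eq_bigr => e _.
  by rewrite !indicI /=; ring.
have mI d e : measurable (first_cell k `&` (void (toucher (k + d)) `&` void (toucher (k + e)))).
  by apply: measurableI => //; apply: measurableI; exact: mvoid.
have b1 d e : bmf (fun w => q d * q e * (expR tau * expR tau) *
    \1_(first_cell k `&` (void (toucher (k + d)) `&` void (toucher (k + e)))) w).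
  by apply: bmfM; [exact: bmf_cst|exact: bmf_indic].
rewrite E_sum; last by move=> d; exact: bmf_sum.
apply: le_trans (ler_wpM2l (fine_ge0 (measure_ge0 P _)) q_cov).
rewrite -/(pr (first_cell k)) mulr_sumr; apply: ler_sum => d _.
rewrite E_sum// mulr_sumr; apply: ler_sum => e _.
rewrite EZ ?E_indic//; last exact: bmf_indic.
case: (posnP d) => [->|d0]; first by rewrite q_0 !mul0r mulr0.
case: (posnP e) => [->|e0]; first by rewrite q_0 !(mulr0, mul0r).
by rewrite -mulrA first_cell_cov//; rewrite mulrCA.
Qed.

Let bmf_cell_mass k : bmf (cell_mass k).
Proof.
apply: bmf_sum => d; apply: bmfM; first exact: bmf_cst.
by apply: bmfM; [exact: bmf_cst|apply: bmf_indic; exact: mvoid].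
Qed.

Definition small_mass (k : nat) : set Omega :=
  first_cell k `&` [set w | cell_mass k w <= 2^-1].

Lemma measurable_small_mass k : measurable (small_mass k).
Proof.
apply: measurableI => //; have [mX _] := bmf_cell_mass k.
rewrite (_ : mkset _ = setT `&` cell_mass k @^-1` `]-oo, 2^-1]%classic).
  by apply: mX => //; exact: measurable_itv.
by apply/seteqP; split=> w; rewrite /= in_itv//= => -[].
Qed.

(** Chebyshev's inequality on [first_cell k]: a mass [X] of at most 1/2 gives
    [1 <= 4 * (X - 1) ^+ 2], and the two moments bound the mean of [(X - 1) ^+ 2] there by [eta]
    times the probability of [first_cell k]. *)
Lemma prob_small_mass k : pr (small_mass k) <= 4 * eta * pr (first_cell k).
Proof.
have msm := measurable_small_mass k.
rewrite -E_indic//.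
have b1 : bmf (\1_(first_cell k) : Omega -> R) by exact: bmf_indic.
have bT1 : bmf (fun w => \1_(first_cell k) w * cell_mass k w) by exact: bmfM.
have bT2 : bmf (fun w => \1_(first_cell k) w * cell_mass k w ^+ 2).
  by apply: bmfM => //; apply: bmfM.
have b2 : bmf (fun w => 4 * (\1_(first_cell k) w * cell_mass k w ^+ 2) +
    (- 8 * (\1_(first_cell k) w * cell_mass k w) + 4 * \1_(first_cell k) w)).
  by apply: bmfD; [|apply: bmfD]; (apply: bmfM => //; exact: bmf_cst).
apply: (@le_trans _ _ (E (fun w => 4 * (\1_(first_cell k) w * cell_mass k w ^+ 2) +
    (- 8 * (\1_(first_cell k) w * cell_mass k w) + 4 * \1_(first_cell k) w)))).
  apply: le_Rintegral => //; [by apply: intP; exact: bmf_indic|exact: intP|].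
  move=> w _; rewrite /small_mass indicI /= !indicE.
  case: (w \in first_cell k); rewrite ?mul0r ?mulr0 ?addr0 ?mul1r ?mulr1//.
  case: (boolP (w \in _)) => /=; last by move=> _; have := sqr_ge0 (cell_mass k w - 1); rewrite !expr2; lra.
  rewrite inE/= => h; have : 0 <= (2^-1 - cell_mass k w) * (3 / 2 - cell_mass k w).
    by rewrite mulr_ge0// subr_ge0//; lra.
  rewrite expr2; lra.
rewrite /E RintegralD//; last 2 first.
- by apply: intP; apply: bmfM => //; exact: bmf_cst.
- by apply: intP; apply: bmfD; (apply: bmfM => //; exact: bmf_cst).
rewrite RintegralD//; [|by apply: intP; apply: bmfM => //; exact: bmf_cst..].
rewrite -!/(E _) !EZ// E_mean E_indic//.
have := E_sqr k; lra.
Qed.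

(** The first-cell events are disjoint, so their probabilities sum to at most 1 and the union bound
    does not deteriorate as the grid is refined. *)
Lemma prob_some_small_mass (m : nat) :
  (P (\big[setU/set0]_(k < m) small_mass k) <= (4 * eta)%:E)%E.
Proof.
apply: (@le_trans _ _ (\sum_(k < m) P (small_mass k))%E).
  by apply: (@Boole_inequality _ _ _ P small_mass) => k _; exact: measurable_small_mass.
apply: (@le_trans _ _ (\sum_(k < m) (4 * eta)%:E * P (first_cell k))%E).
  apply: lee_sum => k _; rewrite (prE (measurable_small_mass k)) (prE (mfc k)) -EFinM lee_fin.
  exact: prob_small_mass.
rewrite -ge0_sume_distrr// -[leRHS]mule1 lee_wpmul2l ?lee_fin ?mulr_ge0//.
have -> : (\sum_(k < m) P (first_cell k))%E = P (\big[setU/set0]_(k < m) first_cell k).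
  by rewrite measure_semi_additive//; [exact: trivIset_first_cell|exact: bigsetU_measurable].
by apply: probability_le1; exact: bigsetU_measurable.
Qed.

End FirstUncoveredCell.

(** * Power sums and second moments over separated scales *)

Section PowerSums.
Context {R : realType}.

(** Bernoulli's inequality for [x ^ b], from [expR t >= 1 + t] at [(1 - b) * ln x] and at
    [- b * ln x], with weights [b] and [1 - b]. *)
Lemma expR_mul_ln_le (b x : R) : 0 <= b -> b <= 1 -> 0 < x ->
  expR (b * ln x) <= 1 + b * (x - 1).
Proof.
move=> b0 b1 x0; pose y := ln x.
have h1 : expR (b * y) * (1 + (1 - b) * y) <= x.
  rewrite -[leRHS](lnK (_ : x \is Num.pos))// -/y.
  rewrite (_ : y = b * y + (1 - b) * y) ?[in leRHS]expRD; last by ring.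
  rewrite (_ : b * y + (1 - b) * y = y); last by ring.
  by rewrite ler_wpM2l ?expR_ge0// expR_ge1Dx.
have h2 : expR (b * y) * (1 - b * y) <= 1.
  rewrite -[leRHS](expRxMexpNx_1 (b * y)) ler_wpM2l ?expR_ge0//.
  by apply: le_trans (expR_ge1Dx _).
have h3 := ler_wpM2l b0 h1.
have b1' : 0 <= 1 - b by rewrite subr_ge0.
have h4 := ler_wpM2l b1' h2.
have -> : expR (b * ln x) = b * (expR (b * y) * (1 + (1 - b) * y)) +
    (1 - b) * (expR (b * y) * (1 - b * y)) by rewrite -/y; ring.
lra.
Qed.

(** Comparison with the integral of [x ^ (- a)], by induction on [M]; the induction step is
    Bernoulli's inequality. *)
Lemma sum_neg_power_le (a : R) (M N : nat) : 0 <= a -> a < 1 -> (0 < N)%N ->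
  \sum_(1 <= e < M.+1) expR (- a * ln (e%:R / N%:R)) <=
  N%:R * expR ((1 - a) * ln (M%:R / N%:R)) / (1 - a).
Proof.
move=> a0 a1 N0; have b0 : 0 < 1 - a by rewrite subr_gt0.
have NR : 0 < N%:R :> R by rewrite ltr0n.
have split_pow (x : R) : 0 < x -> N%:R * expR ((1 - a) * ln (x / N%:R)) = x * expR (- a * ln (x / N%:R)).
  move=> x0; have xN : 0 < x / N%:R by rewrite divr_gt0.
  have -> : (1 - a) * ln (x / N%:R) = ln (x / N%:R) + - a * ln (x / N%:R) by ring.
  by rewrite expRD lnK// mulrA mulrCA divff ?mulr1// gt_eqF.
elim: M => [|M ih].
  by rewrite big_geq// divr_ge0 ?(ltW b0)// mulr_ge0 ?expR_ge0.
rewrite big_nat_recr//=; set x : R := M.+1%:R.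
have x0 : 0 < x by rewrite ltr0n.
rewrite split_pow//; set g := expR (- a * ln (x / N%:R)).
have g0 : 0 <= g by exact: expR_ge0.
apply: (@le_trans _ _ ((x - (1 - a)) * g / (1 - a) + g)); last first.
  by rewrite -[X in _ + X](mulfK (lt0r_neq0 b0)) -mulrDl ler_wpM2r ?invr_ge0 ?(ltW b0)//; lra.
rewrite lerD2r; case: M ih @x x0 @g g0 => [|M] ih x x0 g g0.
  by rewrite big_geq// divr_ge0 ?(ltW b0)// mulr_ge0// /x; lra.
apply: le_trans ih _; rewrite ler_wpM2r ?invr_ge0 ?(ltW b0)//.
have z0 : 0 < M.+1%:R / x :> R by rewrite divr_gt0// ltr0n.
have -> : ln (M.+1%:R / N%:R : R) = ln (M.+1%:R / x) + ln (x / N%:R).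
  rewrite -lnM ?posrE ?divr_gt0//; congr ln.
  by rewrite mulrA divfK// gt_eqF.
rewrite mulrDr expRD mulrCA split_pow// -/g mulrA ler_wpM2r//.
apply: (@le_trans _ _ ((1 + (1 - a) * (M.+1%:R / x - 1)) * x)).
  rewrite ler_wpM2r ?(ltW x0)//; apply: expR_mul_ln_le => //; lra.
have -> : (1 + (1 - a) * (M.+1%:R / x - 1)) * x = x + (1 - a) * (M.+1%:R - x).
  by field; rewrite gt_eqF.
by rewrite /x -(natr1 M.+1); lra.
Qed.

(** Since [a < 1], the singularity at 0 is integrable and a short head of the sum is a small
    fraction of [N]. The 16 makes this fraction a quarter of the lower bound [h * N / 4] for the sum
    over a window. *)
Lemma small_head_sum (a C h : R) : 0 <= a -> a < 1 -> 0 < h ->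
  exists2 h', 0 < h' /\ h' <= h / 2 & forall N M : nat, (0 < N)%N ->
    M%:R <= h' * N%:R ->
    \sum_(1 <= e < M.+1) expR (C - a * ln (e%:R / N%:R)) <= h / 16 * N%:R.
Proof.
move=> a0 a1 h0; have b0 : 0 < 1 - a by rewrite subr_gt0.
pose t := h / 16 * (1 - a) * expR (- C).
have t0 : 0 < t by rewrite !mulr_gt0 ?expR_gt0// divr_gt0.
pose h' := expR (Num.min (ln (h / 2)) (ln t / (1 - a))).
exists h'.
  split; first exact: expR_gt0.
  have h20 : 0 < h / 2 by rewrite divr_gt0.
  by rewrite -[leRHS](lnK (_ : h / 2 \is Num.pos))// ler_expR ge_min lexx.
move=> N M N0 hM; have NR : 0 < N%:R :> R by rewrite ltr0n.
under eq_bigr do rewrite expRD -mulNr.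
rewrite -mulr_sumr.
case: M hM => [|M] hM; first by rewrite big_geq// mulr0 mulr_ge0// divr_ge0// ltW.
apply: le_trans (ler_wpM2l (expR_ge0 _) (sum_neg_power_le _ a0 a1 N0)) _.
have MN : M.+1%:R / N%:R <= h' by rewrite ler_pdivrMr.
have : expR ((1 - a) * ln (M.+1%:R / N%:R)) <= t.
  rewrite -[leRHS](lnK (_ : t \is Num.pos))// ler_expR mulrC -ler_pdivlMr//.
  apply: (@le_trans _ _ (ln h')).
    by rewrite ler_ln ?posrE ?divr_gt0 ?expR_gt0.
  by rewrite expRK ge_min lexx orbT.
move=> ht.
have -> : h / 16 * N%:R = expR C * (N%:R * t / (1 - a)).
  rewrite /t expRN; field; rewrite !gt_eqF ?expR_gt0//.
by rewrite ler_wpM2l ?expR_ge0// ler_wpM2r ?invr_ge0 ?(ltW b0)// ler_wpM2l// ltW.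
Qed.

End PowerSums.

Section Mixture.
Context {R : realType}.
Variables (p n : nat) (I : nat -> nat -> bool) (u : nat -> R) (c : nat -> nat -> R) (E : R).
Let a i := \sum_(d < n | I i d) u d.
Hypotheses (p0 : (0 < p)%N) (a0 : forall i, (i < p)%N -> 0 < a i) (E0 : 0 <= E).
Hypothesis diag : forall i, (i < p)%N ->
  \sum_(d < n | I i d) \sum_(e < n | I i e) c d e <= 4 * a i ^+ 2.
Hypothesis offdiag : forall i j, (i < p)%N -> (j < p)%N -> i != j ->
  \sum_(d < n | I i d) \sum_(e < n | I j e) c d e <= E * (a i * a j).

(* Averages uniform weights over [p] separated scales: the diagonal terms of the second
   moment are merely bounded, but they only weigh [1 / p]. *)
Definition mixture (d : nat) : R := p%:R^-1 * \sum_(i < p | I i d) (a i)^-1.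

Let pR : 0 < p%:R :> R. Proof. by rewrite ltr0n. Qed.

Let exchange (F : nat -> R) :
  \sum_(d < n) mixture d * F d = p%:R^-1 * \sum_(i < p) (a i)^-1 * \sum_(d < n | I i d) F d.
Proof.
under eq_bigr do rewrite /mixture -mulrA.
rewrite -mulr_sumr; congr (_ * _).
under eq_bigr do rewrite mulr_suml big_mkcond.
rewrite exchange_big/=; apply: eq_bigr => i _.
by rewrite mulr_sumr [RHS]big_mkcond.
Qed.

Lemma mixture_mean : \sum_(d < n) mixture d * u d = 1.
Proof.
rewrite exchange; under eq_bigr => i _ do rewrite mulVf ?gt_eqF ?a0//.
by rewrite sumr_const card_ord mulVf// gt_eqF.
Qed.

Lemma mixture_cov :
  \sum_(d < n) \sum_(e < n) mixture d * mixture e * c d e <= 4 / p%:R + E.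
Proof.
have -> : \sum_(d < n) \sum_(e < n) mixture d * mixture e * c d e =
    \sum_(d < n) mixture d * (\sum_(e < n) mixture e * c d e).
  by apply: eq_bigr => d _; rewrite mulr_sumr; apply: eq_bigr => e _; rewrite mulrA.
rewrite (exchange (fun d => \sum_(e < n) mixture e * c d e)).
have bound (i : 'I_p) : (a i)^-1 * \sum_(d < n | I i d) \sum_(e < n) mixture e * c d e <=
    p%:R^-1 * (4 + p%:R * E).
  have -> : \sum_(d < n | I i d) \sum_(e < n) mixture e * c d e =
      p%:R^-1 * \sum_(j < p) (a j)^-1 * \sum_(d < n | I i d) \sum_(e < n | I j e) c d e.
    under eq_bigr => d _ do rewrite (exchange (c d)).
    rewrite -mulr_sumr exchange_big/=; congr (_ * _).
    by apply: eq_bigr => j _; rewrite mulr_sumr.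
  rewrite mulrCA ler_wpM2l ?invr_ge0 ?(ltW pR)// mulr_sumr.
  apply: (@le_trans _ _ (\sum_(j < p) ((j == i)%:R * 4 + E))).
    apply: ler_sum => j _; rewrite mulrA; have ai := a0 (ltn_ord i); have aj := a0 (ltn_ord j).
    rewrite -invfM ler_pdivrMl ?mulr_gt0//; case: eqVneq => [->|ji].
      apply: le_trans (diag (ltn_ord i)) _; rewrite mul1r expr2 [leLHS]mulrC [leRHS]mulrDr lerDl.
      by rewrite mulr_ge0// mulr_ge0// ltW.
    rewrite mul0r add0r mulrC; apply: offdiag => //; by rewrite eq_sym.
  rewrite big_split/= -mulr_suml -natr_sum sumr_const card_ord.
  rewrite (eq_bigr (fun j => (j == i) : nat))// -big_mkcond/=.
  by rewrite big_pred1_eq mul1r mulr_natl.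
apply: (@le_trans _ _ (p%:R^-1 * \sum_(i < p) p%:R^-1 * (4 + p%:R * E))).
  by rewrite ler_wpM2l ?invr_ge0 ?(ltW pR)//; apply: ler_sum => i _; exact: bound.
rewrite sumr_const card_ord -(mulr_natl (p%:R^-1 * _)).
by rewrite mulKf ?gt_eqF// mulrDr mulKf ?gt_eqF// mulrC.
Qed.

Lemma mixture_ge0 d : 0 <= mixture d.
Proof.
by rewrite mulr_ge0 ?invr_ge0//; apply: sumr_ge0 => i _; rewrite invr_ge0 ltW// a0.
Qed.

Lemma mixture_le d (b : R) : (forall i, (i < p)%N -> (a i)^-1 <= b) -> mixture d <= b.
Proof.
move=> hb; rewrite /mixture mulrC ler_pdivrMr//.
apply: (@le_trans _ _ (\sum_(i < p) b)).
  rewrite big_mkcond; apply: ler_sum => i _; case: ifP => _; first exact: hb.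
  by apply: le_trans (hb _ (ltn_ord i)); rewrite invr_ge0 ltW// a0.
by rewrite sumr_const card_ord mulr_natr.
Qed.

End Mixture.

Section ScaleSums.
Context {R : realType}.
Variables (p n N : nat) (H g : nat -> R) (u v : nat -> R) (w E : R) (c : nat -> nat -> R).
Hypotheses (N0 : (0 < N)%N) (nE : forall d, (d < n)%N = (d%:R <= H 0 * N%:R)).
Hypotheses (H0 : forall i, 0 < H i) (g0 : forall i, 0 < g i).
Hypotheses (gH2 : forall i, g i <= H i / 2) (HS : forall i, H i.+1 <= g i / 4).
Hypotheses (u1 : forall d, 1 <= u d) (v0 : forall d, 0 <= v d) (E0 : 0 <= E).
Hypotheses (cdd : forall d, c d d = u d * w) (cC : forall d e, c d e = c e d).
Hypothesis clt : forall d e, (d < e)%N -> c d e = u d * v (e - d).-1.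
Hypothesis head : forall i M, (i < p)%N -> M%:R <= g i * N%:R ->
  \sum_(1 <= e < M.+1) v e <= H i / 16 * N%:R.
Hypothesis vu : forall m, H p * N%:R <= m%:R -> v m <= u m.
Hypothesis shift : forall i d e, (i < p)%N -> (e < d)%N -> g i * N%:R < d%:R ->
  e%:R <= H i.+1 * N%:R -> v (d - e).-1 <= E * u d.
Hypotheses (v0w : v 0%N <= w) (big : 12 * w + 4 <= H p * N%:R).

(** Later windows lie closer to the starting cell. The gap between [H i.+1] and [g i] keeps the
    distance from an offset of window [i] to one of a later window comparable to the larger
    offset. *)
Definition in_scale i d := (g i * N%:R < d%:R) && (d%:R <= H i * N%:R).
Definition scale_sum i := \sum_(d < n | in_scale i d) u d.

Let NR : 0 < N%:R :> R. Proof. by rewrite ltr0n. Qed.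
Let w0 : 0 <= w. Proof. exact: le_trans (v0 0%N) v0w. Qed.
Let u0 d : 0 <= u d. Proof. exact: le_trans ler01 (u1 d). Qed.

Lemma scales_anti i j : (i <= j)%N -> H j <= H i.
Proof.
elim: j => [|j ih]; first by rewrite leqn0 => /eqP->.
rewrite leq_eqVlt => /predU1P[->//|]; rewrite ltnS => /ih; apply: le_trans.
by have := HS j; have := gH2 j; have := H0 j; lra.
Qed.

Let sumE (Q : pred nat) (F : nat -> R) : \sum_(d < n | Q d) F d =
  \sum_(0 <= d < n) (if Q d then F d else 0).
Proof. by rewrite big_mkcond big_mkord. Qed.

Let part_le (F : nat -> R) (x y : nat) : (forall d, 0 <= F d) -> (x <= y)%N -> (y <= n)%N ->
  \sum_(x <= d < y) F d <= \sum_(0 <= d < n) F d.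
Proof.
move=> F0 xy yn; rewrite (big_cat_nat (leq0n y) yn)/= (big_cat_nat (leq0n x) xy)/=.
by rewrite addrAC -[leLHS]add0r lerD2r addr_ge0// sumr_ge0.
Qed.

Let if_ge0 (b : bool) (x : R) : 0 <= x -> 0 <= (if b then x else 0).
Proof. by case: b. Qed.

Let HN4 i : (i <= p)%N -> 4 <= H i * N%:R.
Proof.
move=> ip; have h : 4 <= H p * N%:R by have := big; have := w0; lra.
by apply: le_trans h _; rewrite ler_wpM2r ?(ltW NR)// scales_anti.
Qed.

Let head_lt i M : (i < p)%N -> M%:R <= g i * N%:R -> (M < n)%N.
Proof.
move=> ip h; rewrite nE; apply: le_trans h _; rewrite ler_wpM2r ?(ltW NR)//.
by have := gH2 i; have := H0 i; have := scales_anti (leq0n i); lra.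
Qed.

(** The window contains at least [H i * N / 2 - 1] integers, each of weight at least 1, and
    [H i * N >= 4]. *)
Lemma scale_sum_ge i : (i < p)%N -> H i * N%:R / 4 <= scale_sum i.
Proof.
move=> ip; have gN0 : 0 <= g i * N%:R by rewrite mulr_ge0// ltW.
have HN0 : 0 <= H i * N%:R by rewrite mulr_ge0// ltW.
have /andP[A1 A2] := truncn_itv gN0; have /andP[B1 B2] := truncn_itv HN0.
have HiN := HN4 (ltnW ip).
have g2N := ler_wpM2r (ltW NR) (gH2 i).
have gHN : g i * N%:R <= H i * N%:R by lra.
have AB := le_truncn gHN.
set A := Num.Def.trunc (g i * N%:R) in A1 A2 AB.
set B := Num.Def.trunc (H i * N%:R) in B1 B2 AB.
clearbody A B.
have Bn : (B < n)%N.
  by rewrite nE; apply: le_trans B1 _; rewrite ler_wpM2r ?(ltW NR)// scales_anti.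
rewrite /scale_sum sumE.
apply: (@le_trans _ _ (\sum_(A.+1 <= d < B.+1) (if in_scale i d then u d else 0))); last first.
  by apply: part_le => // d; exact: if_ge0.
apply: (@le_trans _ _ (\sum_(A.+1 <= d < B.+1) 1)).
  rewrite -(natr1 B) in B2.
  rewrite sumr_const_nat subSS natrB//; lra.
rewrite !big_nat; apply: ler_sum => d /andP[Ad dB]; rewrite ifT//.
apply/andP; split; first by apply: lt_le_trans A2 _; rewrite ler_nat.
by apply: le_trans B1; rewrite ler_nat.
Qed.

Lemma scale_sum_ge_last i : (i < p)%N -> H p / 4 * N%:R <= scale_sum i.
Proof.
move=> ip; apply: le_trans (scale_sum_ge ip); rewrite mulrAC ler_wpM2r//.
by rewrite ler_wpM2r ?(ltW NR)// scales_anti// ltnW.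
Qed.

Lemma scale_sum_gt0 i : (i < p)%N -> 0 < scale_sum i.
Proof.
by move=> ip; apply: lt_le_trans (scale_sum_ge_last ip); rewrite mulr_gt0// divr_gt0.
Qed.

Let near_sum i : (i < p)%N -> \sum_(m < n | m%:R <= H i * N%:R) v m <=
  v 0%N + scale_sum i / 4 + scale_sum i.
Proof.
move=> ip; have gN0 : 0 <= g i * N%:R by rewrite mulr_ge0// ltW.
have /andP[A1 A2] := truncn_itv gN0.
move: (Num.Def.trunc _) A1 A2 => M A1 A2.
have Mn := head_lt ip A1.
rewrite (sumE (fun m => m%:R <= H i * N%:R)).
rewrite (big_cat_nat (leq0n M.+1) Mn)/= big_ltn//.
rewrite ifT; last by rewrite mulr_ge0 ?(ltW NR)// ltW.
rewrite lerD//; first rewrite lerD2l//.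
  apply: (@le_trans _ _ (H i / 16 * N%:R)); last first.
    by have := scale_sum_ge ip; lra.
  apply: le_trans (head ip A1); apply: ler_sum => e _.
  by case: ifP.
rewrite /scale_sum sumE.
apply: (@le_trans _ _ (\sum_(M.+1 <= d < n) (if in_scale i d then u d else 0))); last first.
  by apply: part_le => // d; exact: if_ge0.
rewrite !big_nat; apply: ler_sum => d /andP[Md dn].
have gd : g i * N%:R < d%:R by apply: lt_le_trans A2 _; rewrite ler_nat.
rewrite /in_scale gd /=; case: ifP => // _; apply: vu.
apply: le_trans (ltW gd); rewrite ler_wpM2r ?(ltW NR)//.
by apply: le_trans (scales_anti ip) _; have := HS i; have := g0 i; lra.
Qed.

(** With [a] the sum over the window, the diagonal and the two triangles give at most
    [a * w + 2 * a * (v 0 + a / 4 + a)]. As [v 0 <= w] and [3 * w <= a], this is at most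
    [7 / 2 * a ^+ 2]. *)
Lemma scale_diag i : (i < p)%N ->
  \sum_(d < n | in_scale i d) \sum_(e < n | in_scale i e) c d e <= 4 * scale_sum i ^+ 2.
Proof.
move=> ip; pose up d e := if (d < e)%N then u d * v (e - d).-1 else 0.
have covE d e : c d e = (if d == e then u d * w else 0) + up d e + up e d.
  rewrite /up; case: ltngtP => [de|ed|->].
  - by rewrite add0r addr0 clt.
  - by rewrite !add0r cC clt.
  - by rewrite !addr0 cdd.
have upS : \sum_(d < n | in_scale i d) \sum_(e < n | in_scale i e) up d e <=
    scale_sum i * (v 0%N + scale_sum i / 4 + scale_sum i).
  rewrite {1}/scale_sum mulr_suml; apply: ler_sum => d _.
  apply: (@le_trans _ _ (u d * \sum_(m < n | m%:R <= H i * N%:R) v m)); last first.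
    by rewrite ler_wpM2l// near_sum.
  rewrite (sumE (fun m => m%:R <= H i * N%:R)) (sumE (in_scale i)).
  rewrite (big_cat_nat (leq0n d.+1) (ltn_ord d))/= big_nat big1 ?add0r; last first.
    by move=> e /andP[_ ed]; rewrite /up ltnNge -ltnS ed /=; case: ifP.
  rewrite -{1}(add0n d.+1) big_addn.
  apply: (@le_trans _ _ (u d * \sum_(0 <= m < n - d.+1) (if m%:R <= H i * N%:R then v m else 0))).
    rewrite mulr_sumr; apply: ler_sum => m _; rewrite /up addnS ltnS leq_addl -addnS.
    case: ifP => [/andP[_ hm]|_].
      rewrite ifT; last by apply: le_trans hm; rewrite ler_nat leq_addr.
      by rewrite addnS subSn ?leq_addl// addnK.
    by rewrite mulr_ge0//; exact: if_ge0.
  rewrite ler_wpM2l//; apply: part_le => //; last exact: leq_subr.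
  by move=> m; exact: if_ge0.
have -> : \sum_(d < n | in_scale i d) \sum_(e < n | in_scale i e) c d e =
    \sum_(d < n | in_scale i d) \sum_(e < n | in_scale i e) (if d == e :> nat then u d * w else 0) +
    \sum_(d < n | in_scale i d) \sum_(e < n | in_scale i e) up d e +
    \sum_(d < n | in_scale i d) \sum_(e < n | in_scale i e) up d e.
  rewrite [X in _ = _ + X]exchange_big/= -!big_split/=; apply: eq_bigr => d _.
  by rewrite -!big_split/=; apply: eq_bigr => e _; rewrite covE.
have dS : \sum_(d < n | in_scale i d) \sum_(e < n | in_scale i e)
    (if d == e :> nat then u d * w else 0) <= scale_sum i * w.
  rewrite {1}/scale_sum mulr_suml; apply: ler_sum => d Id.
  rewrite -big_mkcondr/= (eq_bigl (pred1 d)) ?big_pred1_eq// => e.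
  by rewrite /= eq_sym -val_eqE/=; case: eqVneq => [/val_inj->|]; rewrite ?Id ?andbF// andbT.
have W3 : 3 * w <= scale_sum i.
  by apply: le_trans (scale_sum_ge_last ip); have := big; lra.
have ai := scale_sum_gt0 ip.
have h1 : 0 <= scale_sum i * (scale_sum i - 3 * w) by rewrite mulr_ge0 ?(ltW ai)// subr_ge0.
have h2 : scale_sum i * v 0%N <= scale_sum i * w by rewrite ler_wpM2l ?(ltW ai).
apply: le_trans (lerD (lerD dS upS) upS) _.
move: (scale_sum i) h1 h2 => a h1 h2.
have -> : a * w + a * (v 0%N + a / 4 + a) + a * (v 0%N + a / 4 + a) =
  3 * (a * w) - 2 * (a * w - a * v 0%N) + 5 / 2 * a ^+ 2 by field.
have h3 : 3 * (a * w) <= a ^+ 2.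
  by move: h1; rewrite mulrBr subr_ge0 mulrCA expr2.
have := sqr_ge0 a; lra.
Qed.

Let scale_offdiag_lt i j : (i < j)%N -> (j < p)%N ->
  \sum_(d < n | in_scale i d) \sum_(e < n | in_scale j e) c d e <=
  E * (scale_sum i * scale_sum j).
Proof.
move=> ij jp; have ip := ltn_trans ij jp.
rewrite {1}/scale_sum mulr_suml mulr_sumr; apply: ler_sum => d Id.
rewrite {1}/scale_sum !mulr_sumr; apply: ler_sum => e Ie.
have /andP[gd _] := Id; have /andP[_ eH] := Ie.
have eH' : e%:R <= H i.+1 * N%:R.
  by apply: le_trans eH _; rewrite ler_wpM2r ?(ltW NR)// scales_anti.
have gN : H i.+1 * N%:R <= g i * N%:R / 4 by rewrite mulrAC ler_wpM2r ?(ltW NR).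
have ed : (e < d)%N.
  by rewrite -(ltr_nat R); apply: le_lt_trans gd; have := HN4 ip; lra.
by rewrite cC clt// mulrA mulrC ler_wpM2r//; exact: shift ip ed gd eH'.
Qed.

Lemma scale_offdiag i j : (i < p)%N -> (j < p)%N -> i != j ->
  \sum_(d < n | in_scale i d) \sum_(e < n | in_scale j e) c d e <=
  E * (scale_sum i * scale_sum j).
Proof.
move=> ip jp; rewrite neq_ltn => /orP[ij|ji]; first exact: scale_offdiag_lt.
rewrite exchange_big/= (mulrC (scale_sum i)); apply: le_trans (scale_offdiag_lt ji ip).
by apply: ler_sum => d _; apply: ler_sum => e _; rewrite cC.
Qed.

End ScaleSums.

(** * Choice of the scales and weights *)

Section Weights.
Context {R : realType}.
Variable Lambda : {sigma_finite_measure set (measurableTypeR R) -> \bar R}.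
Hypothesis Lfin : forall eps : R, (0 < eps)%R -> (Lambda `]eps, 1%R[%classic < +oo)%E.
Local Notation kap := (kap Lambda).
Variables (C chi' : R).
Hypothesis growth : forall eps, 0 < eps -> eps <= 1 -> kap eps 0 <= C - chi' * ln eps.
Hypotheses (chi0 : 0 <= chi') (chi1 : chi' < 1).

(** The point is uniformity in the cutoff: lengths below [r] do not count when [eps <= r], and for
    [r < eps] the growth bound at [eps] is the smaller one. *)
Lemma kap_growth_pos (eps r : R) : 0 < eps -> 0 < r -> r <= 1 ->
  kap eps r <= C - chi' * ln r.
Proof.
move=> e0 r0 r1; have [er|re] := leP eps r.
  exact: le_trans (kap_le0 Lfin e0 er) (growth r0 r1).
have [e1|/ltW e1] := leP eps 1; last first.
  rewrite /kap set_itv_ge ?Rintegral_set0; last by rewrite bnd_simp -leNgt.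
  have := growth ltr01 (lexx _); rewrite ln1 mulr0 subr0 => C0.
  have : 0 <= C by apply: le_trans C0; exact: kap_ge0.
  by move=> h; rewrite addr_ge0// oppr_ge0 mulr_ge0_le0// ln_le0.
apply: le_trans (le_kap Lfin e0 (ltW r0)) _; apply: le_trans (growth e0 e1) _.
by rewrite lerD2l lerN2 ler_wpM2l// ler_ln ?posrE// ltW.
Qed.

(** Raising both cutoffs to [rho0] gives a Lipschitz constant independent of [eps] and [eps'], which
    may be far smaller. *)
Lemma kap_shift (eps eps' rho r : R) : 0 < eps' -> eps' <= eps -> eps <= rho -> rho <= r ->
  forall rho0, 0 < rho0 -> eps <= rho0 -> rho0 <= rho ->
  kap eps' rho <= kap eps r + (r - rho) * tail Lambda rho0.
Proof.
move=> e0 ee er rr rho0 r0 er0 rr0.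
have e1 : 0 < eps by exact: lt_le_trans ee.
rewrite (kap_cutoff Lambda e0 (le_trans ee er0) rr0).
rewrite (kap_cutoff Lambda e1 er0 (le_trans rr0 rr)).
exact: kap_lipschitz.
Qed.

Variables (h eta : R).
Hypotheses (h0 : 0 < h) (h1 : h <= 1) (eta0 : 0 < eta).

(** The order of the quantifiers matters: [eps] and [gam] are fixed before [eps'] and [N], so the
    same first-cell cutoff serves while [eps'] tends to 0. *)
Lemma weights : exists eps gam : R, [/\ 0 < eps, eps <= 1, 0 < gam &
  forall eps', 0 < eps' -> eps' <= eps -> exists N0 : nat, forall N, (N0 <= N)%N -> (0 < N)%N ->
  exists (q : nat -> R) (n : nat), [/\ q 0%N = 0,
    forall d, 0 <= q d <= (gam * N%:R)^-1,
    forall d, (d < n)%N -> d%:R <= h * N%:R,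
    \sum_(d < n) q d * expR (kap eps (d%:R / N%:R)) = 1 &
    \sum_(d < n) \sum_(e < n) q d * q e * cell_cov Lambda eps eps' N d e <= 1 + eta]].
Proof.
(* The diagonal share [4 / p] and the off-diagonal excess [expR ce - 1] each receive half of
   [eta]. *)
have [p p0 p_eta] : exists2 p : nat, (0 < p)%N & 4 / p%:R <= eta / 2.
  have e8 : 0 <= 8 / eta by rewrite divr_ge0// ltW.
  exists (Num.Def.archi_bound (8 / eta)).+1 => //.
  have hp : 8 / eta <= (Num.Def.archi_bound (8 / eta)).+1%:R.
    by apply: ltW; apply: lt_le_trans (archi_boundP e8) _; rewrite ler_nat.
  rewrite ler_pdivrMr ?ltr0n//.
  have := ler_wpM2l (ltW eta0) hp; rewrite mulrCA divff ?gt_eqF// mulr1; lra.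
have [ce ce0 ceE] : exists2 ce, 0 < ce & expR ce = 1 + eta / 2.
  exists (ln (1 + eta / 2)); first by rewrite ln_gt0// ltrDl divr_gt0.
  by rewrite lnK// posrE addr_gt0// divr_gt0.
have /choice[g hg] : forall x : R, exists y, 0 < x -> 0 < y /\ y <= x / 2 /\
    forall N M : nat, (0 < N)%N -> M%:R <= y * N%:R ->
    \sum_(1 <= e < M.+1) expR (C - chi' * ln (e%:R / N%:R)) <= x / 16 * N%:R.
  move=> x; case: (ltP 0 x) => x0; last by exists 0.
  by have [y [y0 yx] hy] := small_head_sum C chi0 chi1 x0; exists y.
have tail1 x : 0 < tail Lambda x + 1 by rewrite ltr_wpDl// tail_ge0.
have [H [H_0 H0 HS HS2]] : exists H : nat -> R, [/\ H 0%N = h, forall i, 0 < H i,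
    forall i, H i.+1 <= g (H i) / 4 &
    forall i, 2 * H i.+1 * tail Lambda (g (H i) / 4) <= ce].
  (* The second term bounds by [ce] the Lipschitz loss over a shift of [(e + 1) / N], at most
     [2 * H i.+1] for an offset [e] of a later window. *)
  pose nexth x := Num.min (g x / 4) (ce / (2 * (tail Lambda (g x / 4) + 1))).
  exists (fun i => iter i nexth h); split => //.
  - elim=> [//|i ih]; rewrite iterS lt_min.
    have [gi _] := hg _ ih.
    by rewrite !divr_gt0// mulr_gt0.
  - by move=> i; rewrite iterS ge_min lexx.
  move=> i; set x := iter i nexth h.
  have : nexth x <= ce / (2 * (tail Lambda (g x / 4) + 1)) by rewrite ge_min lexx orbT.
  rewrite ler_pdivlMr ?mulr_gt0// iterS -/x => hh.
  have nx : 0 <= tail Lambda (g x / 4) by exact: tail_ge0.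
  have [nx0|nx0] := leP 0 (nexth x).
    by apply: le_trans hh; rewrite mulrA (mulrC (nexth x)) ler_wpM2l ?mulr_ge0// lerDl.
  apply: le_trans (ltW ce0); rewrite mulr_le0_ge0// mulr_ge0_le0// ltW//.
have gH i : 0 < g (H i) by have [] := hg _ (H0 i).
have gH2 i : g (H i) <= H i / 2 by have [_ []] := hg _ (H0 i).
have Hanti := @scales_anti R H (fun i => g (H i)) H0 gH2 HS.
have Hh i : H i <= h by rewrite -H_0; exact: Hanti.
exists (H p), (H p / 4); split => //; first exact: le_trans (Hh p) h1.
  by rewrite divr_gt0.
move=> eps' e'0 e'e.
(* [kap eps' (-1)] dominates [kap eps' (- N%:R^-1)] for every [N], which keeps the threshold
   independent of [N]. *)
exists (Num.Def.archi_bound ((12 * expR (kap eps' (-1)) + 4) / H p)) => N NN N0.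
have NR : 0 < N%:R :> R by rewrite ltr0n.
pose w := expR (kap eps' (- N%:R^-1)).
have bigN : 12 * w + 4 <= H p * N%:R.
  apply: (@le_trans _ _ (12 * expR (kap eps' (-1)) + 4)).
    by rewrite lerD2r ler_wpM2l// ler_expR (le_kap Lfin)// lerN2 invf_le1// ler1n.
  rewrite [leRHS]mulrC -ler_pdivrMr// ltW//; apply: lt_le_trans (archi_boundP _) _.
    by rewrite divr_ge0 ?(ltW (H0 p))// addr_ge0// mulr_ge0// expR_ge0.
  by rewrite ler_nat.
have [n nE] : exists n, forall d, (d < n)%N = (d%:R <= H 0%N * N%:R).
  exists (Num.Def.trunc (h * N%:R)).+1 => d.
  by rewrite ltnS truncn_ge_nat ?H_0// mulr_ge0// ltW.
pose u d := expR (kap (H p) (d%:R / N%:R)).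
pose v d := expR (kap eps' (d%:R / N%:R)).
have u1 d : 1 <= u d by rewrite -expR0 ler_expR kap_ge0.
have v0 d : 0 <= v d by exact: expR_ge0.
have v0w : v 0%N <= w by rewrite ler_expR mul0r (le_kap Lfin)// oppr_le0 invr_ge0.
have cdd d : cell_cov Lambda (H p) eps' N d d = u d * w by rewrite /cell_cov eqxx.
have cC d e : cell_cov Lambda (H p) eps' N d e = cell_cov Lambda (H p) eps' N e d.
  exact: cell_covC.
have clt d e : (d < e)%N -> cell_cov Lambda (H p) eps' N d e = u d * v (e - d).-1.
  by move=> de; rewrite /cell_cov (ltn_eqF de) (minn_idPl (ltnW de)) (maxn_idPr (ltnW de)).
have head i M : (i < p)%N -> M%:R <= g (H i) * N%:R ->
    \sum_(1 <= e < M.+1) v e <= H i / 16 * N%:R.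
  move=> ip Mg; have [_ [_ hs]] := hg _ (H0 i); apply: le_trans (hs N M N0 Mg).
  rewrite !big_nat; apply: ler_sum => e /andP[e1 eM].
  rewrite ler_expR kap_growth_pos// ?divr_gt0 ?ltr0n// ler_pdivrMr// mul1r.
  apply: (@le_trans _ _ M%:R); first by rewrite ler_nat.
  apply: le_trans Mg _; rewrite ger_pMl//; apply: le_trans (gH2 i) _.
  by have := Hh i; have := h1; have := H0 i; lra.
have vu m : H p * N%:R <= m%:R -> v m <= u m.
  move=> hm; rewrite /v /u (@kap_cutoff _ Lambda eps' (H p))//.
  by rewrite ler_pdivlMr.
have shift i d e : (i < p)%N -> (e < d)%N -> g (H i) * N%:R < d%:R ->
    e%:R <= H i.+1 * N%:R -> v (d - e).-1 <= expR ce * u d.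
  move=> ip ed gd eH.
  have N1 : 4 <= H i.+1 * N%:R.
    have w0 : 0 <= w by exact: expR_ge0.
    apply: (@le_trans _ _ (H p * N%:R)); first by have := bigN; lra.
    by rewrite ler_wpM2r ?(ltW NR)// Hanti.
  have gN : H i.+1 * N%:R <= g (H i) * N%:R / 4 by rewrite mulrAC ler_wpM2r ?(ltW NR).
  have de1 : (d - e).-1%:R = d%:R - e%:R - 1 :> R.
    by rewrite -subn1 natrB ?subn_gt0// natrB// ltnW.
  rewrite -expRD ler_expR addrC.
  have epsg : H p <= g (H i) / 4 by apply: le_trans (Hanti _ _ ip) (HS i).
  have rho0 : g (H i) / 4 <= (d - e).-1%:R / N%:R.
    by rewrite ler_pdivlMr// de1 mulrAC; lra.
  have rr : (d - e).-1%:R / N%:R <= d%:R / N%:R :> R.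
    by rewrite ler_wpM2r ?invr_ge0 ?(ltW NR)// ler_nat (leq_trans (leq_pred _))// leq_subr.
  have g40 : 0 < g (H i) / 4 by rewrite divr_gt0.
  apply: le_trans (kap_shift e'0 e'e (le_trans epsg rho0) rr g40 epsg rho0) _.
  rewrite lerD2l; apply: le_trans (HS2 i); rewrite ler_wpM2r ?tail_ge0//.
  by rewrite -mulrBl ler_pdivrMr// de1; lra.
have agt0 := scale_sum_gt0 N0 nE H0 gH gH2 HS u1 v0 v0w bigN.
have a_eps := scale_sum_ge_last N0 nE H0 gH gH2 HS u1 v0 v0w bigN.
have diag := scale_diag N0 nE H0 gH gH2 HS u1 v0 cdd cC clt head vu v0w bigN.
have offdiag := scale_offdiag n N0 H0 gH2 HS u1 v0 cC clt shift v0w bigN.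
exists (mixture p n (in_scale N H (fun i => g (H i))) u), n; split.
- rewrite /mixture big1 ?mulr0// => i /andP[+ _].
  by rewrite ltNge mulr_ge0// ltW.
- move=> d; rewrite (mixture_ge0 agt0)/=; apply: (mixture_le p0 agt0) => i ip.
  by rewrite lef_pV2 ?posrE ?agt0 ?a_eps// mulr_gt0// divr_gt0.
- by move=> d; rewrite nE H_0.
- exact: mixture_mean p0 agt0.
- apply: le_trans (mixture_cov p0 agt0 (expR_ge0 ce) diag offdiag) _.
  by rewrite ceE; have := p_eta; lra.
Qed.

End Weights.

(** * Almost sure positivity of the mass *)

Section PositiveMass.
Context {R : realType} dsp (Omega : measurableType dsp) (P : probability Omega R).
Variable Lambda : {sigma_finite_measure set (measurableTypeR R) -> \bar R}.
Local Notation mR := (measurableTypeR R).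
Local Notation leb := (@lebesgue_measure R).
Local Notation omega := (leb \x Lambda)%E.
Variable Z : Omega -> set (mR * mR).
Hypothesis hZ : is_PPP P omega Z.
Hypothesis Lfin : forall eps : R, (0 < eps)%R -> (Lambda `]eps, 1%R[%classic < +oo)%E.
Local Notation kap := (kap Lambda).
Local Notation void := (void Z).
Local Notation density := (density Lambda Z).
Local Notation mass := (mass Lambda Z).

Lemma prob_liminf_le (A : nat -> set Omega) (c : \bar R) :
  (forall n, measurable (A n)) -> (forall n, P (A n) <= c)%E ->
  (P (\bigcup_n \bigcap_(m in [set m | (n <= m)%N]) A m) <= c)%E.
Proof.
move=> mA Ac; pose B n := \bigcap_(m in [set m | (n <= m)%N]) A m.
have mB n : measurable (B n) by apply: bigcap_measurable => //; exists n => /=.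
have ndB : nondecreasing_seq B.
  move=> i j ij; apply/subsetPset => w h m /= jm; apply: h => /=.
  exact: leq_trans jm.
have mU : measurable (\bigcup_n B n) by exact: bigcupT_measurable.
have cv := @nondecreasing_cvg_mu _ _ _ P B mB mU ndB.
rewrite -(cvg_lim _ cv)//; apply: lime_le; first by apply: cvgP cv.
apply: nearW => n; apply: le_trans (Ac n).
by apply: le_measure; rewrite ?inE//; move=> w; apply => /=.
Qed.

Lemma cell_mass_le (eps' gam : R) (N n : nat) (q : nat -> R) (k : nat) (hh : R) w :
  0 < eps' -> 0 <= hh -> (0 < N)%N -> 0 < gam -> tail Lambda eps' <= N%:R ->
  k%:R + hh * N%:R < N%:R ->
  (forall d, 0 <= q d <= (gam * N%:R)^-1) -> (forall d, (d < n)%N -> d%:R <= hh * N%:R) ->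
  cell_mass Lambda Z eps' N q n k w <= expR 1 / gam * mass eps' w.
Proof.
move=> e0 hh0 N0 gam0 tailN kN qb dn.
have NR : 0 < N%:R :> R by rewrite ltr0n.
pose Q l := \1_(void (toucher eps' N l)) w : R.
have Q0 l : 0 <= Q l by rewrite /Q indicE.
have massE : mass eps' w >= expR (kap eps' 0) / N%:R * \sum_(l < N) Q l.
  rewrite /mass -[X in `[0, X]](_ : N%:R * N%:R^-1 = 1); last by rewrite divff// gt_eqF.
  rewrite Rintegral_itv_sum; [|exact: (bmf_density hZ)|by rewrite invr_ge0 ltW].
  rewrite mulr_sumr; apply: ler_sum => l _.
  have lenE : l.+1%:R * N%:R^-1 - l%:R * N%:R^-1 = N%:R^-1 :> R.
    by rewrite -mulrBl -natrB// subSnn mul1r.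
  have lebE : fine (leb `[(l%:R * N%:R^-1)%R, (l.+1%:R * N%:R^-1)%R]%classic) = N%:R^-1.
    by rewrite lebesgue_measure_itv/= lte_fin -subr_gt0 lenE invr_gt0 NR -EFinB lenE.
  have -> : expR (kap eps' 0) / N%:R * Q l =
      \int[leb]_(t in `[(l%:R * N%:R^-1)%R, (l.+1%:R * N%:R^-1)%R]) (expR (kap eps' 0) * Q l).
    rewrite Rintegral_cst; last exact: measurable_itv.
    rewrite mulrAC; congr (_ * _); apply: esym; exact: lebE.
  apply: le_Rintegral => //.
  - by apply: bmf_integrable_itv; exact: bmf_cst.
  - by apply: bmf_integrable_itv; exact: (bmf_density hZ).
  move=> t /=; rewrite in_itv/= => /andP[t0 t1]; rewrite /density ler_wpM2l ?expR_ge0//.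
  rewrite /Q !indicE; case: (boolP (w \in void _)) => // wv; rewrite mem_set//.
  move: wv; rewrite inE; apply: void_sub => z [z1 z2 z3]; split=> //.
    by apply: lt_le_trans z1 _.
  by apply: le_lt_trans z2.
pose tau := kap eps' (- N%:R^-1).
have tauE : tau <= kap eps' 0 + 1.
  rewrite /tau (kapN Lfin)// ?invr_ge0 ?(ltW NR)// lerD2l.
  by rewrite mulrC ler_pdivrMr// mul1r.
apply: (@le_trans _ _ ((gam * N%:R)^-1 * (expR tau * \sum_(l < N) Q l))).
  rewrite /cell_mass; apply: (@le_trans _ _
     (\sum_(d < n) (gam * N%:R)^-1 * (expR tau * Q (k + d)%N))).
    apply: ler_sum => d _; rewrite ler_wpM2r// ?mulr_ge0 ?expR_ge0//.
    by have /andP[] := qb d.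
  rewrite -!mulr_sumr ler_wpM2l ?invr_ge0 ?mulr_ge0 ?(ltW gam0) ?(ltW NR)//.
  rewrite ler_wpM2l ?expR_ge0//.
  have knN : (k + n <= N)%N.
    case: n dn => [|n'] dn.
      rewrite addn0 -(ler_nat R) ltW//; apply: le_lt_trans kN.
      by rewrite lerDl mulr_ge0 ?(ltW NR).
    have := dn n' (leqnn _) => h; rewrite addnS -(ltr_nat R) natrD.
    by apply: le_lt_trans kN; rewrite lerD2l.
  rewrite -(big_mkord xpredT (fun d => Q (k + d)%N)) -(big_mkord xpredT Q).
  rewrite -[X in _ <= X]addr0.
  have -> : \sum_(0 <= d < n) Q (k + d)%N = \sum_(k <= l < k + n) Q l.
    rewrite -{2}(add0n k) big_addn addKn; apply: eq_bigr => d _; by rewrite addnC.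
  rewrite addr0 (big_cat_nat (leq0n (k + n)) knN)/=.
  rewrite (big_cat_nat (leq0n k) (leq_addr n k))/=.
  by rewrite addrAC -[leLHS]add0r lerD2r addr_ge0// sumr_ge0.
have S0 : 0 <= \sum_(l < N) Q l by apply: sumr_ge0.
apply: (@le_trans _ _ (expR 1 / gam * (expR (kap eps' 0) / N%:R * \sum_(l < N) Q l))).
  rewrite invfM (_ : expR 1 / gam * (expR (kap eps' 0) / N%:R * \sum_(l < N) Q l) =
    gam^-1 / N%:R * (expR (kap eps' 0 + 1) * \sum_(l < N) Q l)); last by rewrite expRD; ring.
  rewrite ler_wpM2l ?mulr_ge0 ?invr_ge0 ?(ltW gam0) ?(ltW NR)//.
  by rewrite ler_wpM2r// ler_expR.
by rewrite ler_wpM2l// divr_ge0 ?expR_ge0// ltW.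
Qed.

Variable M : R.-ker Omega ~> measurableTypeR R.
Hypothesis chi1 : (chi Lambda < 1)%E.

(** If the masses tend to 0 although a point is uncovered, then at every late stage the first
    uncovered cell has a cell mass of at most 1/2, so the outcome lies in a lower limit of events of
    probability at most [4 * eta]. The margin [h] keeps the weighted cells inside the unit
    interval. *)
Lemma positive_mass_left (h : R) : 0 < h -> h < 1 ->
  P.-negligible [set w | [/\ MRC_limit P Z M w, M w setT = 0%E &
    exists2 t, 0 <= t < 1 - h & uncovered (Z w) t]].
Proof.
move=> h0 h1.
have [c [c0 c1 cE]] : exists c, [/\ 0 <= c, c < 1 & (chi Lambda < c%:E)%E].
  have := chi_ge0 Lambda; case: (chi Lambda) chi1 => [x x1 x0|//|//].
  rewrite lte_fin in x1; rewrite lee_fin in x0.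
  by exists ((x + 1) / 2); rewrite lte_fin; split; lra.
have [C hC] := kap_growth Lfin cE.
set Bad := mkset _.
suff cover j : exists A : set Omega, [/\ measurable A, (P A <= (4 * j.+1%:R^-1)%:E)%E & Bad `<=` A].
  have [A hA] := choice cover.
  exists (\bigcap_j A j); split.
  - by apply: bigcapT_measurable => j; have [] := hA j.
  - apply/eqP; rewrite eq_le measure_ge0 andbT; apply/lee_addgt0Pr => e e0; rewrite add0e.
    have e4 : 0 <= (e / 4)^-1 by rewrite invr_ge0 divr_ge0// ltW.
    pose j := Num.Def.archi_bound (e / 4)^-1.
    have [mAj PAj _] := hA j; apply: (@le_trans _ _ (P (A j))).
      apply: le_measure; rewrite ?inE//; first by apply: bigcapT_measurable => i; have [] := hA i.
      by move=> w; apply.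
    apply: le_trans PAj _; rewrite lee_fin mulrC -ler_pdivlMr//.
    rewrite -[leRHS]invrK lef_pV2 ?posrE ?invr_gt0 ?divr_gt0//.
    by apply: ltW; apply: lt_le_trans (archi_boundP e4) _; rewrite ler_nat.
  - by move=> w Bw j _; have [_ _ ] := hA j; exact.
pose eta : R := j.+1%:R^-1.
have eta0 : 0 < eta by rewrite invr_gt0.
have [eps [gam [eps0 eps1 gam0 wts]]] := weights Lfin hC c0 c1 h0 (ltW h1) eta0.
have [m0 hm0] : exists m0, forall m, scale (R := R) (m0 + m) <= eps.
  have [m0 _ hm] := cvgr_le _ (scale_cvg0 (R := R)) _ eps0.
  by exists m0 => m; apply: hm; rewrite /= leq_addr.
have step m : exists Nqn : nat * (nat -> R) * nat,
    let: (N, q, n) := Nqn in let eps' := scale (m0 + m) in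
    [/\ [/\ (0 < N)%N, tail Lambda eps' <= N%:R & q 0%N = 0],
    forall d, 0 <= q d <= (gam * N%:R)^-1,
    forall d, (d < n)%N -> d%:R <= h * N%:R,
    \sum_(d < n) q d * expR (kap eps (d%:R / N%:R)) = 1 &
    \sum_(d < n) \sum_(e < n) q d * q e * cell_cov Lambda eps eps' N d e <= 1 + eta].
  have [N0 hN] := wts (scale (m0 + m)) (scale_gt0 _) (hm0 m).
  pose t := Num.Def.archi_bound (tail Lambda (scale (m0 + m))).
  have [|//|q [n [q0 q1 q2 q3 q4]]] := hN (N0 + t).+1 _; first by rewrite leqW// leq_addr.
  exists ((N0 + t).+1, q, n); split => //; split => //.
  apply: ltW; apply: lt_le_trans (archi_boundP (tail_ge0 _ _)) _.
  by rewrite ler_nat leqW// leq_addl.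
have [F hF] := choice step.
pose A m := \big[setU/set0]_(k < (F m).1.1)
  small_mass Lambda Z eps (scale (m0 + m)) (F m).1.1 (F m).1.2 (F m).2 k.
have mA m : measurable (A m).
  by apply: bigsetU_measurable => k _; exact: (measurable_small_mass hZ).
have PA m : (P (A m) <= (4 * eta)%:E)%E.
  have := hF m; rewrite /A; case: (F m) => [[N q] n] /= [[N0 _ q0] _ _ q3 q4].
  exact: (prob_some_small_mass hZ Lfin (scale_gt0 _) (hm0 m) N0 (ltW eta0) q0 q3 q4).
exists (\bigcup_n \bigcap_(m in [set m | (n <= m)%N]) A m); split.
- apply: bigcupT_measurable => n; apply: bigcap_measurable => //.
  by exists n => /=.
- exact: prob_liminf_le.
move=> w [lim M0 [t /andP[t0 t1] unc]].
have massto0 : (fun j => mass (scale j) w) @ \oo --> (0 : R).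
  have := MRC_limit_scale hZ Lfin lim (@cst_continuous _ _ (1 : R)).
  rewrite (_ : \int[M w]_(t in `[0, 1]) cst 1 t = 0); last first.
    rewrite Rintegral_cst; last exact: measurable_itv.
    rewrite (_ : M w _ = 0%E) ?mulr0//; apply/eqP; rewrite eq_le measure_ge0 andbT -M0.
    by apply: le_measure; rewrite ?inE//; exact: measurable_itv.
  apply: cvg_trans; apply: near_eq_cvg; apply: nearW => i.
  by apply: eq_Rintegral => x _; rewrite mul1r.
pose del := gam / (2 * expR 1).
have del0 : 0 < del by rewrite divr_gt0// mulr_gt0// expR_gt0.
have [m1 _ hm1] := cvgr_le _ massto0 _ del0.
exists m1 => // m /= m1m; rewrite /A.
have := hF m; case: (F m) => [[N q] n] /= [[N0 tN q0] q1 q2 _ _].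
have NR : 0 < N%:R :> R by rewrite ltr0n.
rewrite -(bigcup_mkord N (fun k => small_mass Lambda Z eps (scale (m0 + m)) N q n k)).
have tN0 : 0 <= t * N%:R by rewrite mulr_ge0// ltW.
have /andP[k1 k2] := truncn_itv tN0.
set k0 := Num.truncn _ in k1 k2.
(* An interval covering the whole grid cell of the uncovered point [t] would cover [t]; hence some
   cell is not covered and a first one exists. *)
have vk0 : `[< void (coverer eps N k0) w >].
  apply/asboolP; rewrite /void /= -subset0 => z [Zz [z1 z2 z3]].
  have [_ nc] := unc; apply: nc; exists z => //; rewrite /= in_itv/=.
  apply/andP; split; first by apply: lt_le_trans z1 _; rewrite ler_pdivrMr.
  by apply: lt_trans z2; rewrite ltr_pdivlMr.
have ex : exists k, `[< void (coverer eps N k) w >] by exists k0.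
case: (ex_minnP ex) => k /asboolP vk kmin.
have kk0 : (k <= k0)%N by exact: kmin.
have kN : k%:R + h * N%:R < N%:R.
  apply: (@le_lt_trans _ _ (t * N%:R + h * N%:R)).
    by rewrite lerD2r (le_trans _ k1)// ler_nat.
  by rewrite -mulrDl gtr_pMl//; lra.
exists k => /=.
  rewrite -(ltr_nat R); apply: le_lt_trans kN.
  by rewrite lerDl mulr_ge0// ltW.
split.
  split=> // i ik vi; have := kmin i (asboolT vi); by rewrite leqNgt ik.
rewrite /=; apply: le_trans (cell_mass_le w (scale_gt0 _) (ltW h0) N0 gam0 tN kN q1 q2) _.
have hm : mass (scale (m0 + m)) w <= del.
  by apply: hm1; rewrite /= (leq_trans m1m)// leq_addl.
apply: (@le_trans _ _ (expR 1 / gam * del)).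
  by rewrite ler_wpM2l// divr_ge0 ?expR_ge0// ltW.
rewrite [leLHS](_ : _ = 2^-1)//.
by rewrite /del; field; rewrite !gt_eqF ?expR_gt0.
Qed.

End PositiveMass.

(** * Support of the limit measure *)

Section Support.
Context {R : realType} dsp (Omega : measurableType dsp) (P : probability Omega R).
Local Notation mR := (measurableTypeR R).
Local Notation leb := (@lebesgue_measure R).
Variable Z : Omega -> set (mR * mR).
Variable M : R.-ker Omega ~> measurableTypeR R.
Local Notation MRC_limit := (MRC_limit P Z M).

Lemma measurable_uncovered (S : set (mR * mR)) : measurable (uncovered S : set mR).
Proof.
apply: measurableD; first exact: measurable_itv.
apply: open_measurable; apply: bigcup_open => z _; exact: interval_open.
Qed.

(** Weak convergence tests only continuous functions: the tent over the interval is positive exactly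
    inside it, and its approximating integrals vanish once [eps < z.2]. *)
Lemma MRC_limit_covered w (z : mR * mR) : MRC_limit w -> Z w z -> 0 < z.2 < 1 ->
  (M w).-negligible (`]z.1, z.1 + z.2[%classic `&` `[0%R, 1%R]%classic).
Proof.
move=> lim Zz /andP[z0 z1]; have [Mfin _ cvM] := lim.
pose f t : R := Num.max 0 (Num.min (t - z.1) (z.1 + z.2 - t)).
have cf : continuous f.
  move=> t; apply: (@continuous_max R R (cst 0) _ t); first exact: cst_continuous.
  apply: (@continuous_min R R (fun t : R => t - z.1) (fun t : R => z.1 + z.2 - t) t).
    by apply: (@continuousB R R^o R id (cst z.1)) => //; exact: cst_continuous.
  by apply: (@continuousB R R^o R (cst (z.1 + z.2)) id); [exact: cst_continuous|exact: cvg_id].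
have f0 t : 0 <= f t by rewrite /f le_max lexx.
have m01 : measurable (`[0%R, 1%R]%classic : set mR) by exact: measurable_itv.
have If0 : (\int[M w]_(t in `[0%R, 1%R]) (f t)%:E)%E = 0%E.
  apply: (cvg_unique _ (cvM f cf)); first exact: ereal_hausdorff.
  apply: cvg_near_cst; near=> eps; apply: integral0_eq => t _.
  rewrite /MRC_density indicE; case: (boolP (t \in _)) => [|_]; last by rewrite mul0r mulr0.
  rewrite inE => -[_ nc]; rewrite (_ : f t = 0) ?mul0r//.
  rewrite /f max_l// leNgt lt_min !subr_gt0; apply/negP => tz; apply: nc.
  exists z; last by rewrite /= in_itv.
  by split => //=; rewrite z1 andbT; near: eps; exact: nbhs_right_lt.
have [N [mN N0 hN]] : ae_eq (M w) `[0%R, 1%R]%classic (EFin \o (f : mR -> R)) (cst 0%E).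
  apply/ae_eq_integral_abs => //.
    by apply/measurable_EFinP; apply: measurable_funTS; exact: continuous_measurable_fun.
  by rewrite -[RHS]If0; apply: eq_integral => t _ /=; rewrite ger0_norm.
exists N; split => // t [/= tz t01]; apply: hN => /= h; have /eqP := h t01.
rewrite eqe /f eq_le ge_max lexx/= => /andP[+ _]; apply/negP; rewrite -ltNge.
by rewrite lt_min !subr_gt0; move: tz; rewrite in_itv.
Unshelve. all: by end_near. Qed.

(** [Z w] is an arbitrary set of intervals, while null sets add up only countably. The rational
    intervals contained in some interval of [Z w] are countably many and have the same union. *)
Lemma MRC_limit_supported w : Z w `<=` [set z | 0 < z.2 < 1] -> MRC_limit w ->
  M w (~` uncovered (Z w)) = 0%E.
Proof.
move=> Zs lim; have [_ M01 _] := lim.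
pose U (pq : rat * rat) := `]ratr pq.1 : R, ratr pq.2[%classic `&` `[0, 1]%classic `&`
  [set t | exists2 z, Z w z & z.1 <= ratr pq.1 /\ ratr pq.2 <= z.1 + z.2].
have negU pq : (M w).-negligible (U pq).
  have [[z Zz [z1 z2]]|nz] :=
      pselect (exists2 z, Z w z & z.1 <= ratr pq.1 /\ ratr pq.2 <= z.1 + z.2).
    apply: negligibleS (MRC_limit_covered lim Zz (Zs _ Zz)) => t [[/= tU t01] _]; split => //=.
    move: tU; rewrite !in_itv/= => /andP[t1 t2].
    by rewrite (le_lt_trans z1)// (lt_le_trans t2).
  by apply: negligibleS (negligible_set0 _) => t [_ /= /nz].
pose F n := if (choice.unpickle n : option (rat * rat)) is Some pq then U pq else set0.
have negF : (M w).-negligible (\bigcup_n F n).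
  by apply: negligible_bigcup => n; rewrite /F; case: choice.unpickle => [pq|]; [exact: negU|exact: negligible_set0].
have negC : (M w).-negligible (~` `[0, 1]%classic `|` \bigcup_n F n).
  apply: negligibleU => //; apply/negligibleP => //; apply: measurableC; exact: measurable_itv.
apply: measure_negligible; first by apply: measurableC; exact: measurable_uncovered.
apply: negligibleS negC.
move=> t; have [t01|] := pselect (`[0, 1]%classic t); last by left.
move=> nunc; right; have [[z Zz]|] := pselect ((\bigcup_(z in Z w) `]z.1, z.1 + z.2[%classic) t).
  rewrite /= in_itv/= => /andP[t1 t2].
  have [p] := rat_in_itvoo t1; have [q] := rat_in_itvoo t2.
  rewrite !in_itv/= => /andP[q1 q2] /andP[p1 p2].
  have [k Fk] : exists k, F k = U (p, q) by exists (choice.pickle (p, q)); rewrite /F choice.pickleK.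
  exists k; [exact: I|rewrite Fk; split; first by split => //=; rewrite in_itv/= p2 q1].
  by exists z => //=; rewrite !ltW.
by move=> nc; exfalso; apply: nunc; split.
Qed.

Lemma dimF_le_dimF_set w : Z w `<=` [set z | 0 < z.2 < 1] -> MRC_limit w ->
  M w setT != 0%E -> (dimF (M w) <= dimF_set (uncovered (Z w)))%E.
Proof.
move=> Zs lim M0; apply: ereal_sup_ubound; exists (M w) => //; split => //.
  by have [] := lim.
exact: MRC_limit_supported.
Qed.

Lemma fourier0 (nu : {measure set mR -> \bar R}) x : nu setT = 0%E -> fourier nu x = 0.
Proof.
move=> nu0; have I0 (f : mR -> R) : measurable_fun setT f -> \int[nu]_t f t = 0.
  by move=> mf; rewrite /Rintegral null_set_integral//; exact/measurable_EFinP.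
have ml : measurable_fun setT (fun t : mR => 2 * pi * x * t).
  by apply: measurable_funM => //; exact: measurable_id.
rewrite /fourier !I0 ?oppr0//; apply: measurableT_comp => //.
  by apply: continuous_measurable_fun; exact: continuous_sin.
by apply: continuous_measurable_fun; exact: continuous_cos.
Qed.

End Support.

(** * The right end point, and infinite mass near 1 *)

Section Alternatives.
Context {R : realType} dsp (Omega : measurableType dsp) (P : probability Omega R).
Variable Lambda : {sigma_finite_measure set (measurableTypeR R) -> \bar R}.
Local Notation mR := (measurableTypeR R).
Local Notation leb := (@lebesgue_measure R).
Local Notation omega := (leb \x Lambda)%E.
Variable Z : Omega -> set (mR * mR).
Hypothesis hZ : is_PPP P omega Z.
Hypothesis Zs : forall w, Z w `<=` [set z | 0 < z.2 < 1].
Local Notation void := (void Z).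

Lemma uncovered_void w t : 0 <= t <= 1 -> uncovered (Z w) t <-> void (strip 0 t t) w.
Proof.
move=> t01; split=> [[_ nc]|v].
  rewrite /void /= -subset0 => z [Zz [z1 z2 _]].
  by apply: nc; exists z; rewrite //= in_itv/= z1 z2.
split; first by rewrite /= in_itv.
move=> [z Zz]; rewrite /= in_itv/= => /andP[z1 z2].
suff : set0 z by []. by rewrite -v; split=> //; split=> //; exact: Zs Zz.
Qed.

(* [positive_mass_left] says nothing about the right end point. *)
Lemma one_isolated_negligible :
  P.-negligible [set w | uncovered (Z w) 1 /\ forall t, 0 <= t < 1 -> ~ uncovered (Z w) t].
Proof.
pose S t : set (mR * mR) := strip 0 t t.
have mS t : measurable (S t) by exact: measurable_strip.
have mv B : measurable B -> measurable (void B) by exact: (measurable_void hZ).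
have SE t : omega (S t) = kapE Lambda 0 0.
  by have := measure_strip Lambda 0 t t; rewrite subrr.
have one w : uncovered (Z w) 1 -> void (S 1) w.
  by move=> u; apply/uncovered_void => //; rewrite ler01 lexx.
(* If a point is covered with infinite intensity, then 1 is almost surely covered. Otherwise the
   intensity of the intervals that contain [tk k] but not 1 tends to 0, and so does the probability
   that 1 is free while [tk k] is not. *)
have [koo|kfin] : kapE Lambda 0 0 = +oo%E \/ (kapE Lambda 0 0 < +oo)%E.
  by case: (kapE Lambda 0 0) => [r| |]; [right; exact: ltry|left|right].
  exists (void (S 1)); split; first exact: mv.
    by apply: (prob_void_pinfty hZ (mS 1)); rewrite -koo; exact: SE.
  by move=> w [/one].
pose tk (k : nat) : R := 1 - k.+1%:R^-1.
have tk01 k : 0 <= tk k < 1.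
  by rewrite subr_ge0 invf_le1// ler1n/= gtrBl invr_gt0.
pose T k : set (mR * mR) := strip 0 (tk k) 1.
have mT k : measurable (T k) by exact: measurable_strip.
pose A k := void (S 1) `\` void (S (tk k)).
have mA k : measurable (A k) by apply: measurableD; exact: mv.
pose y k := fine (omega (T k)). pose x := fine (kapE Lambda 0 0).
have TS k : S (tk k) `&` S 1 = T k.
  rewrite /S stripI /T maxxx; have /andP[_ /ltW h] := tk01 k.
  by rewrite (min_idPl h) (max_idPr h).
have Sfin t : (omega (S t) < +oo)%E by have := kfin; rewrite -(SE t).
have Tfin k : (omega (T k) < +oo)%E.
  apply: le_lt_trans (Sfin 1); apply: le_measure; rewrite ?inE//.
  by rewrite -TS; exact: subIsetr.
have PA k : (P (A k) <= (x - y k)%:E)%E.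
  pose D := S (tk k) `\` S 1.
  have mD : measurable D by exact: measurableD.
  have DE : omega D = (x - y k)%:E.
    have h := measureD (mS (tk k)) (mS 1) (Sfin (tk k)).
    apply: etrans h _; rewrite TS EFinB; congr (_ - _)%E.
      apply: etrans (SE _) _; rewrite /x fineK// ge0_fin_numE//.
      by apply: integral_ge0 => z _; rewrite lee_fin le_max lexx.
    by rewrite /y fineK// ge0_fin_numE.
  have Dfin : (omega D < +oo)%E by rewrite DE ltry.
  apply: (@le_trans _ _ (P (~` void D))).
    apply: le_measure; rewrite ?inE//; first by apply: measurableC; exact: mv.
    move=> w [v1 nv] vD; apply: nv.
    rewrite /void /= -subset0 => z [Zz Sz].
    suff : set0 z by []. 
    have [S1|nS1] := pselect (S 1 z); first by rewrite -v1; split.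
    by rewrite -vD; split.
  rewrite probability_setC; last exact: mv.
  have pD := prob_void hZ mD Dfin; have fD : fine (omega D) = x - y k by have := congr1 fine DE.
  have -> : P (void D) = (expR (- (x - y k)))%:E by rewrite -fD.
  by rewrite -EFinB lee_fin; have := expR_ge1Dx (- (x - y k)); lra.
have yx : y @ \oo --> x.
  have UT : \bigcup_k T k = S 1.
    apply/seteqP; split=> [z [k _]|z].
      by rewrite -TS => -[].
    move=> [z1 z2 z3].
    have /ltW e0 : 0 < (1 - z.1)^-1 by rewrite invr_gt0 subr_gt0.
    exists (Num.Def.archi_bound (1 - z.1)^-1) => //; split=> //.
    rewrite /tk ltrBrDl -ltrBrDr -[ltRHS]invrK ltf_pV2 ?posrE ?invr_gt0 ?subr_gt0//.
    by apply: lt_le_trans (archi_boundP e0) _; rewrite ler_nat.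
  have mU : measurable (\bigcup_n T n) by rewrite UT.
  have ndT : nondecreasing_seq T.
    move=> i j ij; apply/subsetPset => z [z1 z2 z3]; split=> //.
    by apply: lt_le_trans z1 _; rewrite lerB// lef_pV2 ?posrE// ler_nat.
  have cv := @nondecreasing_cvg_mu _ _ _ omega T mT mU ndT.
  apply/fine_cvg; move: cv; rewrite UT => cv.
  have -> : x%:E = omega (S 1).
    apply: etrans (esym (SE 1)); rewrite /x fineK// ge0_fin_numE//.
    by apply: integral_ge0 => z _; rewrite lee_fin le_max lexx.
  exact: cv.
exists (\bigcap_k A k); split.
- exact: bigcapT_measurable.
- apply/eqP; rewrite eq_le measure_ge0 andbT; apply/lee_addgt0Pr => e e0; rewrite add0e.
  have xe : x - e < x by rewrite gtrBl.
  have [k _ hk] := cvgr_ge _ yx _ xe.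
  apply: (@le_trans _ _ (P (A k))).
    by apply: le_measure; rewrite ?inE//; [exact: bigcapT_measurable|move=> w; apply].
  apply: le_trans (PA k) _; rewrite lee_fin; have := hk k (leqnn _); rewrite /=; lra.
- move=> w [u1 nu] k _; split; first exact: one.
  move=> v; apply: (nu (tk k)) => //; apply/uncovered_void => //.
  by have /andP[-> /ltW->] := tk01 k.
Qed.

Variable M : R.-ker Omega ~> measurableTypeR R.

Lemma positive_mass_ae : (forall eps : R, (0 < eps)%R -> (Lambda `]eps, 1%R[%classic < +oo)%E) ->
  (chi Lambda < 1)%E ->
  {ae P, forall w, MRC_limit P Z M w -> uncovered (Z w) !=set0 -> M w setT != 0%E}.
Proof.
move=> Lfin chi1.
(* These margins stay below 1 and tend to 0, so the points below [1 - h n] exhaust [[0, 1[]. *)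
pose h n : R := n.+2%:R^-1.
have h0 n : 0 < h n by rewrite invr_gt0.
have h1 n : h n < 1 by rewrite invf_lt1// ltr1n.
apply: negligibleS (negligibleU one_isolated_negligible
  (negligible_bigcup (fun n => positive_mass_left hZ Lfin M chi1 (h0 n) (h1 n)))).
move=> w /= /not_implyP[lim /not_implyP[[t unc] /negP]]; rewrite negbK => /eqP M0.
have [[s s01 us]|none] := pselect (exists2 s, 0 <= s < 1 & uncovered (Z w) s).
  right; have /andP[s0 s1] := s01.
  have /ltW e0 : 0 < (1 - s)^-1 by rewrite invr_gt0 subr_gt0.
  exists (Num.Def.archi_bound (1 - s)^-1) => //; split=> //; exists s => //.
  rewrite s0/= ltrBrDl -ltrBrDr -[ltRHS]invrK ltf_pV2 ?posrE ?invr_gt0 ?subr_gt0//.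
  by apply: lt_le_trans (archi_boundP e0) _; rewrite ler_nat leqW.
left; have nunc s : 0 <= s < 1 -> ~ uncovered (Z w) s by move=> s01 us; apply: none; exists s.
split=> //; have [] := unc; rewrite /= in_itv/= => /andP[t0 t1] _.
move: t1; rewrite le_eqVlt => /orP[/eqP <-//|t1].
by exfalso; apply: (nunc t) unc; rewrite t0.
Qed.

(* Infinitely many intervals longer than 1/2 start in any given interval, and three of
   them cover [0, 1]. *)
Lemma covered_ae : Lambda `](2^-1)%R, 1%R[%classic = +oo%E ->
  {ae P, forall w eps, eps <= 2^-1 -> uncovered_eps (Z w) eps = set0}.
Proof.
move=> Loo; pose S (i : nat) : set (mR * mR) := strip 2^-1 (i%:R / 3) (i.+1%:R / 3).
have mS i : measurable (S i) by exact: measurable_strip.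
have Soo i : omega (S i) = +oo%E.
  apply: etrans (measure_strip Lambda _ _ _) _.
  have -> : i.+1%:R / 3 - i%:R / 3 = 3^-1 :> R by rewrite -mulrBl -natrB// subSnn mul1r.
  apply/eqP; rewrite -leye_eq.
  apply: (@le_trans _ _ (\int[Lambda]_(y in `](2^-1)%R, 1%R[) (cst (6^-1)%:E) y)%E).
    rewrite integral_cst; last exact: measurable_itv.
    have h : ((6^-1)%:E * Lambda `](2^-1)%R, 1%R[%classic = +oo :> \bar R)%E.
      by rewrite Loo gt0_muley// lte_fin.
    by rewrite -h.
  apply: ge0_le_integral => //.
  - by move=> y _ /=; rewrite lee_fin.
  - by apply/measurable_EFinP; exact: measurable_pos_part.
  by move=> y /=; rewrite in_itv/= lee_fin le_max => /andP[y1 _]; apply/orP; right; lra.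
have ae : {ae P, forall w i, ~ void (S i) w}.
  apply: ae_foralln => i; exists (void (S i)); split.
  - exact: (measurable_void hZ).
  - exact: (prob_void_pinfty hZ (mS i) (Soo i)).
  - by move=> w /= /contrapT.
apply: filterS ae => w hit eps eps2; rewrite -subset0 => t [/=]; rewrite in_itv/=.
move=> /andP[t0 t1] nc.
suff [i [it ti]] : exists i : nat, i%:R / 3 <= t /\ t <= i.+1%:R / 3.
  apply: (hit i); rewrite /void /= -subset0 => z [Zz [z1 z2 /andP[z3 z4]]].
  apply: nc; exists z; first by split=> //=; rewrite z4 andbT (le_lt_trans eps2).
  by rewrite /= in_itv/= (lt_le_trans z1)// (le_lt_trans ti).
have t3 : 0 <= t * 3 by rewrite mulr_ge0.
have /andP[k1 k2] := truncn_itv t3.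
by exists (Num.truncn (t * 3)); split; [rewrite ler_pdivrMr|rewrite ler_pdivlMr// ltW].
Qed.

Lemma covered_mass0 w : MRC_limit P Z M w ->
  (forall eps, eps <= 2^-1 -> uncovered_eps (Z w) eps = set0) -> M w setT = 0%E.
Proof.
move=> [Mfin M01 cvM] cov.
have m01 : measurable (`[0%R, 1%R]%classic : set mR) by exact: measurable_itv.
have I0 : (\int[M w]_(t in `[0%R, 1%R]) (cst (1 : R) t)%:E)%E = 0%E.
  apply: (cvg_unique _ (cvM (cst 1) (@cst_continuous _ _ (1 : R)))); first exact: ereal_hausdorff.
  apply: cvg_near_cst; near=> eps; apply: integral0_eq => t _.
  rewrite /MRC_density cov; first by rewrite indicE in_set0 mul0r mulr0.
  by near: eps; apply: nbhs_right_le; rewrite invr_gt0.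
have M0 : M w `[0, 1]%classic = 0%E.
  have h := integral_cst (M w) m01 1%E.
  by rewrite mul1e in h; apply: etrans (esym h) _; exact: I0.
rewrite -(setUv `[0%R, 1%R]%classic).
have h := @measureU _ _ _ (M w) _ (~` `[0%R, 1%R]%classic) m01 (measurableC m01) (setICr _).
apply: etrans h _; apply: etrans (congr2 adde M0 M01) _; rewrite /adde/= addr0.
Unshelve. all: by end_near. Qed.

End Alternatives.

Local Open Scope ereal_scope.

Theorem theorem1p3 (R : realType) (d : measure_display)
    (Omega : measurableType d) (P : probability Omega R)
    (Lambda : {sigma_finite_measure set (measurableTypeR R) -> \bar R})
    (Z : Omega -> set (measurableTypeR R * measurableTypeR R))
    (M : R.-ker Omega ~> measurableTypeR R) :
  radon01 Lambda ->
  Lambda `]0%R, 1%R[%classic = +oo ->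
  (forall w, Z w `<=` [set z | (0 < z.2 < 1)%R]) ->
  is_PPP P (lebesgue_measure \x Lambda) Z ->
  is_MRC P Z M ->
  chi Lambda < 1 ->
  {ae P, forall w,
    [/\ (uncovered (Z w) !=set0 -> dimF (M w) <= dimF_set (uncovered (Z w))),
        1 - chi Lambda <= dimF (M w)
      & 0 < 1 - chi Lambda]}.
Proof.
move=> rad _ Zs hZ lim chi1.
have [c [c0 c1 chiE]] : exists c, [/\ (0 <= c)%R, (c < 1)%R & chi Lambda = c%:E].
  have := chi_ge0 Lambda; case: (chi Lambda) chi1 => [c|//|//].
  by rewrite lte_fin lee_fin => ? ?; exists c.
have chi_pos : 0 < 1 - chi Lambda by rewrite sube_gt0.
have [half_fin|half_oo] : Lambda `](2^-1)%R, 1%R[%classic < +oo \/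
    Lambda `](2^-1)%R, 1%R[%classic = +oo.
  by case: ltP => [|h]; [left|right; apply/eqP; rewrite -leye_eq].
  have Lfin := radon01_tail_fin rad half_fin.
  have decay : {ae P, forall w n, MRC_limit P Z M w -> (0 <= 1 - c - n.+1%:R^-1)%R ->
      exists C A : R, forall x : R, (A <= `|x|)%R ->
      (ComplexField.Normc.normc (fourier (M w) x) ^+ 2 <=
        C * `|x| `^ (- (1 - c - n.+1%:R^-1)))%R}.
    apply: ae_foralln => n; case: (leP 0%R (1 - c - n.+1%:R^-1)%R) => Dn.
      have Dc : (1 - c - n.+1%:R^-1)%R%:E < 1 - chi Lambda.
        by rewrite chiE -EFinB lte_fin gtrBl invr_gt0.
      by apply: filterS (Fourier_decay_ae hZ Lfin M chi1 Dn Dc) => w h lw _; exact: h.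
    by apply: (filterS _ lim) => w _ _.
  have mass := positive_mass_ae hZ Zs M Lfin chi1.
  have [] := And3 lim decay mass.
  move=> h1 h2 h3; near=> w.
  have lw : MRC_limit P Z M w by near: w; exact: h1.
  split => //.
    move=> une; apply: (dimF_le_dimF_set (Zs w) lw).
    by have : MRC_limit P Z M w -> uncovered (Z w) !=set0 -> M w setT != 0; [near: w|exact].
  rewrite chiE; apply: dimF_ge => // n Dn.
  have h : forall n, MRC_limit P Z M w -> (0 <= 1 - c - n.+1%:R^-1)%R ->
      exists C A : R, forall x : R, (A <= `|x|)%R ->
      (ComplexField.Normc.normc (fourier (M w) x) ^+ 2 <=
        C * `|x| `^ (- (1 - c - n.+1%:R^-1)))%R by near: w.
  exact: h.
(* Infinite mass near 1: everything is covered and [M w] vanishes, so its Fourier transform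
   satisfies every decay bound, while the comparison with the uncovered set is vacuous. *)
have cov := covered_ae hZ half_oo.
near=> w.
have lw : MRC_limit P Z M w by near: w; exact: lim.
have cw : forall eps, (eps <= 2^-1)%R -> uncovered_eps (Z w) eps = set0 by near: w.
split => //.
  move=> [t ut]; exfalso; suff : set0 t by [].
  rewrite -(cw 2^-1%R (lexx _)); split; first by have [] := ut.
  by move=> [z [Zz _] tz]; have [_] := ut; apply; exists z.
rewrite chiE; apply: dimF_ge => // n Dn; exists 0%R, 0%R => x _.
by rewrite fourier0 ?(covered_mass0 lw cw)// mul0r /ComplexField.Normc.normc/= expr0n/= addr0 sqrtr0 expr0n.
Unshelve. all: by end_near. Qed.
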